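(* Let $s\ge 1$ and $k\ge 1$ be fixed integers (not depending on $n$). For each $n$, let $K_n,P_n$ be positive integers with $s\le K_n\le P_n$, and let $G_s(n,K_n,P_n)$ be the uniform random $s$-intersection graph. Suppose $P_n=\Omega(n)$, and define the real sequence $\alpha_n$ by $$\frac{1}{s!}\cdot\frac{K_n^{2s}}{P_n^{s}}=\frac{\ln n+(k-1)\ln\ln n+\alpha_n}{n}.$$ Then $$\lim_{n\to\infty}\mathbb{P}[G_s(n,K_n,P_n)\text{ is }k\text{-vertex-connected}]=\lim_{n\to\infty}\mathbb{P}[G_s(n,K_n,P_n)\text{ is }k\text{-edge-connected}]=\lim_{n\to\infty}\mathbb{P}[G_s(n,K_n,P_n)\text{ has minimum vertex degree at least }k],$$ and this common limit equals $e^{-e^{-\alpha^*}/(k-1)!}$ if $\lim_{n\to\infty}\alpha_n=\alpha^*\in(-\infty,\infty)$, equals $0$ if $\lim_{n\to\infty}\alpha_n=-\infty$, and equals $1$ if $\lim_{n\to\infty}\alpha_n=\infty$.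
   Context: The uniform random $s$-intersection graph $G_s(n,K_n,P_n)$ has $n$ vertices; each vertex independently selects a set of $K_n$ distinct items uniformly at random from a common pool of $P_n$ distinct items, and two vertices are joined by an (undirected) edge if and only if their item sets share at least $s$ items. A graph is $k$-vertex-connected (resp. $k$-edge-connected) if it remains connected after deleting any at most $k-1$ vertices (resp. edges). Asymptotic notation is as $n\to\infty$. *)

(* Defs.v *)
From HB Require Import structures.
From mathcomp Require Import all_boot all_order all_algebra.
From mathcomp Require Import all_classical all_reals all_analysis.
Set Implicit Arguments. Unset Strict Implicit. Unset Printing Implicit Defensive.
Import Order.TTheory GRing.Theory Num.Theory.
Local Open Scope ring_scope.

(* A configuration of the random s-intersection graph on n vertices with a
   pool of P items: vertex i holds the item set w i. *)
Definition valid_config (n P K : nat) (w : {ffun 'I_n -> {set 'I_P}}) : bool :=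
  [forall i, #|w i| == K].

Definition isg_adj (n P s : nat) (w : {ffun 'I_n -> {set 'I_P}}) : rel 'I_n :=
  fun i j => (i != j) && (s <= #|w i :&: w j|)%N.

Definition connected_on (V : finType) (e : rel V) (A : {set V}) : bool :=
  [forall x in A, forall y in A,
     connect (fun u v => [&& u \in A, v \in A & e u v]) x y].

Definition k_vertex_connected (V : finType) (k : nat) (e : rel V) : bool :=
  [forall D : {set V}, (#|D| <= k.-1)%N ==> connected_on e (~: D)].

Definition k_edge_connected (V : finType) (k : nat) (e : rel V) : bool :=
  [forall F : {set V * V}, (#|F| <= k.-1)%N ==>
     connected_on (fun u v => [&& e u v, (u, v) \notin F & (v, u) \notin F]) (finset.setT : {set V})].

Definition min_degree_ge (V : finType) (k : nat) (e : rel V) : bool :=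
  [forall v, (k <= #|[set u | e v u]|)%N].

(* Probability of an event under the uniform random choice: each vertex
   independently picks a uniformly random K-subset of the pool, i.e. the
   configuration is uniform over all valid configurations. *)
Definition isg_prob (R : realType) (n P K : nat)
    (E : pred {ffun 'I_n -> {set 'I_P}}) : R :=
  (#|[set w : {ffun 'I_n -> {set 'I_P}} | valid_config K w && E w]%SET|%:R
   / #|[set w : {ffun 'I_n -> {set 'I_P}} | valid_config K w]%SET|%:R)%R.
Arguments isg_prob R n P K E : clear implicits.

Definition isg_alpha (R : realType) (s k : nat) (K P : nat -> nat) (n : nat) : R :=
  (n%:R * ((K n)%:R ^+ (2 * s) / (P n)%:R ^+ s / (s`!)%:R)
   - ln (n%:R) - (k.-1)%:R * ln (ln (n%:R)))%R.

(* Main.v *)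
Require Import Defs.
From HB Require Import structures.
From mathcomp Require Import all_boot all_order all_algebra.
From mathcomp Require Import ring lra zify.
Set Implicit Arguments. Unset Strict Implicit. Unset Printing Implicit Defensive.

(* Put a = (K^2/P)^s / s!, which is asymptotically the edge probability, and A = n a. Given the item
   sets of the vertices of U, the other vertices choose theirs independently, so each estimate reduces
   to the probability that one uniform K-set shares s items with some of finitely many given K-sets.

   Minimum degree: the factorial moments of the number of vertices of degree less than k are
   asymptotic to lambda^j / j! with lambda = n A^(k-1) e^(-A) / (k-1)!, which tends to
   e^(-alpha) / (k-1)!; Bonferroni's inequalities give the limit.

   Connectivity: a graph of minimum degree at least k which is not k-connected has a connected set of
   r vertices, 2 <= r <= n/2, with fewer than k outside neighbours. There are few trees to sum over,
   about n (4A)^(r-1) in expectation, and a second moment bound shows that a fresh vertex is adjacent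
   to the set with probability about r a / (1 + r a + O(sqrt(ln n))), provided that no two item sets
   share 3s items.

   These estimates are uniform in K and P as long as |alpha| <= (ln n)/20; since the three properties
   are monotone in K, larger |alpha| reduces to this case by changing K. *)

(** * Small cuts of a graph *)

(** The obstacle is that [K] may be as small as a multiple of sqrt(ln n), which is all that P =
    Omega(n) guarantees for s = 1. The events that a fresh item set hits two given ones are then
    noticeably correlated through shared items. [Zint] measures this: it is at most M s a / K for
    two sets sharing at most M items, and at most s^2 a^2 / K on average. Its sum over the other
    vertices of a set of size r is at most a r M s / K, and, by an exponential moment bound, at most
    a times O(sqrt(ln n)) for all vertices at once; the smaller of the two is used. A cut of size r
    then costs a factor exp(- const r sqrt(ln n)) against a polylogarithmic factor per tree vertex;
    once r a exceeds a multiple of sqrt(ln n), summing over all 2^n sets is affordable.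

    The value 3s: with x = K^2/P, x^s is about ln n / n up to a constant, so some two of n vertices
    share 3s items with probability at most n^2 x^(3s), which is 1/n up to logarithms. The factor 4:
    in breadth-first order the parent positions are non-decreasing, so that r vertices admit at most
    4^(r-1) parent sequences. *)

Section Graph.
Variables (V : finType) (e : rel V).
Hypotheses (e_sym : symmetric e) (e_irr : irreflexive e).
Implicit Types (A B : {set V}) (x y u v : V).

Definition nbhd A : {set V} := [set v in ~: A | [exists u in A, e u v]].

Lemma connect_ind (r : rel V) (Q : pred V) x y :
  (forall u v, Q u -> r u v -> Q v) -> Q x -> connect r x y -> Q y.
Proof.
move=> h Qx /connectP[p]; elim: p x Qx => [|z p IH] x Qx /=; first by move=> _ ->.
by case/andP => /(h _ _ Qx) Qz; apply: IH.
Qed.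

Lemma restr_sym A (r : rel V) : symmetric r ->
  symmetric (fun u v => [&& u \in A, v \in A & r u v]).
Proof. by move=> rs u v /=; rewrite rs andbCA. Qed.

Lemma min_deg_card k A u : min_degree_ge k e -> A = [set u] -> (k <= #|nbhd A|)%N.
Proof.
move=> /forallP/(_ u) h ->; apply: leq_trans h _; apply: subset_leq_card.
apply/subsetP => v; rewrite !inE => uv; apply/andP; split.
  by apply: contraTneq uv => ->; rewrite e_irr.
by apply/existsP; exists u; rewrite inE eqxx.
Qed.

(* The smaller of two distinct components of a graph r on B, where r is e with some edges removed. *)
Lemma small_component (r : rel V) B :
  symmetric r -> subrel r e -> ~~ connected_on r B ->
  exists A : {set V}, [/\ A \subset B, (0 < #|A|)%N, (#|A|.*2 <= #|V|)%N,
    connected_on e A & forall u v, u \in A -> v \in B -> r u v -> v \in A].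
Proof.
move=> rs re.
rewrite negb_forall_in => /exists_inP[x xB]; rewrite negb_forall_in => /exists_inP[y yB].
set r' := (fun u v => _) => nxy.
have r's : connect_sym r' by apply: sym_connect_sym; apply: restr_sym.
pose C z := [set t | connect r' z t].
have CB z : z \in B -> C z \subset B.
  move=> zB; apply/subsetP => t; rewrite inE; apply: connect_ind zB.
  by move=> u v _ /and3P[].
have Ccl z u v : u \in C z -> v \in B -> z \in B -> r u v -> v \in C z.
  move=> uC vB zB ruv; have uB := subsetP (CB _ zB) _ uC.
  move: uC; rewrite !inE => uC; apply: (connect_trans uC); apply: connect1.
  by rewrite /r' uB vB.
have Cconn z : connected_on e (C z).
  have h t : t \in C z -> connect (fun u v => [&& u \in C z, v \in C z & e u v]) z t.
    rewrite inE => zt.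
    pose Q t := (t \in C z) && connect (fun u v => [&& u \in C z, v \in C z & e u v]) z t.
    have : Q t.
      apply: (connect_ind (Q := Q)) zt => [u v /andP[uC zu] uv|]; last by rewrite /Q inE !connect0.
      have vC : v \in C z by move: uC; rewrite !inE => /connect_trans; apply; apply: connect1.
      rewrite /Q vC; apply: (connect_trans zu); apply: connect1; rewrite uC vC re //.
      by case/and3P: uv.
    by case/andP.
  apply/forall_inP => t tC; apply/forall_inP => t' tC'.
  apply: connect_trans (h _ tC').
  rewrite (sym_connect_sym (restr_sym _ e_sym)); exact: h.
have dis : [disjoint C x & C y].
  rewrite -setI_eq0; apply/eqP/setP => t; rewrite !inE; apply/negP => /andP[xt yt].
  by move: nxy; rewrite (connect_trans xt) // r's.
have cardle : (#|C x| + #|C y| <= #|V|)%N.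
  by rewrite -cardsUI (eqP (_ : C x :&: C y == set0)) ?setI_eq0 // cards0 addn0 max_card.
have Cpos z : (0 < #|C z|)%N by apply/card_gt0P; exists z; rewrite inE connect0.
have [le|le] := leqP #|C x| #|C y|.
  exists (C x); split => //; [exact: CB|lia|by move=> u v uC vB; apply: Ccl].
exists (C y); split => //; [exact: CB|lia|by move=> u v uC vB; apply: Ccl].
Qed.

Definition small_cut k A :=
  [&& (1 < #|A|)%N, (#|A|.*2 <= #|V|)%N, connected_on e A & (#|nbhd A| <= k.-1)%N].

(** Minimum degree at least [k] is what excludes singletons, whose neighbourhood is too large. *)
Lemma small_cutI k A : (1 <= k)%N -> min_degree_ge k e ->
  (0 < #|A|)%N -> (#|A|.*2 <= #|V|)%N -> connected_on e A -> (#|nbhd A| <= k.-1)%N ->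
  small_cut k A.
Proof.
move=> k1 md A0 A2 Ac An; apply/and4P; split=> //.
rewrite ltn_neqAle A0 andbT eq_sym; apply/negP => /cards1P[u Au].
by have := min_deg_card md Au; lia.
Qed.

(** A component of the graph without [D] has all its outside neighbours in [D]. *)
Lemma not_vertex_connected k : (1 <= k)%N -> min_degree_ge k e ->
  ~~ k_vertex_connected k e -> exists A, small_cut k A.
Proof.
move=> k1 md; rewrite negb_forall => /existsP[D]; rewrite negb_imply => /andP[Dk nc].
have [A [AD A0 A2 Ac Acl]] := small_component e_sym (fun _ _ => id) nc.
exists A; apply: small_cutI => //; apply: leq_trans Dk; apply: subset_leq_card.
apply/subsetP => v; rewrite !inE => /andP[vA /existsP[u /andP[uA uv]]].
by apply: contraR vA => vD; apply: Acl uv => //; rewrite inE.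
Qed.

Lemma not_edge_connected k : (1 <= k)%N -> min_degree_ge k e ->
  ~~ k_edge_connected k e -> exists A, small_cut k A.
Proof.
move=> k1 md; rewrite negb_forall => /existsP[F]; rewrite negb_imply => /andP[Fk].
set r := (fun u v => _) => nc.
have rs : symmetric r by move=> u v; rewrite /r e_sym [X in _ && X]andbC.
have re : subrel r e by move=> u v /and3P[].
have [A [AD A0 A2 Ac Acl]] := small_component rs re nc.
exists A; apply: small_cutI => //; apply: leq_trans Fk.
(* Each vertex of the boundary is the only endpoint outside A of a deleted edge. *)
pose out (p : V * V) := if p.1 \in A then p.2 else p.1.
apply: leq_trans (leq_imset_card out (mem F)); apply: subset_leq_card.
apply/subsetP => v; rewrite !inE => /andP[vA /existsP[u /andP[uA uv]]].
have : ~~ r u v by apply: contra vA => ruv; apply: Acl ruv.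
rewrite /r uv /= negb_and !negbK => /orP[uF|vF]; apply/imsetP.
  by exists (u, v); rewrite // /out uA.
by exists (v, u); rewrite // /out (negbTE vA).
Qed.

(** Deleting the neighbourhood of a vertex of degree less than [k] isolates it; [k < #|V|] ensures
    that another vertex is left. *)
Lemma vertex_connected_min_degree k : (k < #|V|)%N -> (1 <= k)%N ->
  k_vertex_connected k e -> min_degree_ge k e.
Proof.
move=> kV k1 /forallP kc; apply/forallP => v; rewrite leqNgt; apply/negP => dk.
set N := [set u | e v u] in dk.
have /implyP/(_ _)/forall_inP h := kc N.
have {}h := h (ltac:(lia)).
have vN : v \in ~: N by rewrite !inE e_irr.
have [y] : exists y, y \in ~: (v |: N).
  apply/card_gt0P; rewrite cardsCs setCK subn_gt0.
  by rewrite cardsU1; apply: leq_ltn_trans kV; case: (_ \notin _) => //=; lia.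
rewrite !inE negb_or => /andP[yv yN].
have /forall_inP/(_ y) := h v vN; rewrite !inE => /(_ yN) c.
suff : y == v by rewrite (negbTE yv).
apply: (connect_ind (Q := pred1 v)) c => //= u w /eqP -> /and3P[_].
by rewrite !inE => /negP.
Qed.

(** Deleting all edges at a vertex of degree less than [k] isolates it. One orientation per edge is
    put into [F], since [k_edge_connected] removes both. *)
Lemma edge_connected_min_degree k : (1 < #|V|)%N -> (1 <= k)%N ->
  k_edge_connected k e -> min_degree_ge k e.
Proof.
move=> V1 k1 /forallP kc; apply/forallP => v; rewrite leqNgt; apply/negP => dk.
set N := [set u | e v u] in dk.
pose F := [set (v, u) | u in N].
have Fk : (#|F| <= k.-1)%N by apply: leq_trans (leq_imset_card _ _) _; lia.
have /implyP/(_ Fk)/forall_inP h := kc F.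
have [y yv] : exists y, y != v.
  by apply/existsP; rewrite -negb_forall; apply/negP => /forallP av;
     move: V1; rewrite ltnNge; case/negP; rewrite -(cards1 v) subset_leq_card //; apply/subsetP => z _; rewrite inE; apply/eqP/eqP/negPn/negPn; have := av z.
have /forall_inP/(_ y) c := h v (in_setT _); have {}c := c (in_setT _).
suff : y == v by rewrite (negbTE yv).
apply: (connect_ind (Q := pred1 v)) c => //= u w /eqP -> /and5P[_ _ vw wF _].
by case/negP: wF; apply/imsetP; exists w => //; rewrite inE.
Qed.

(* Breadth-first order: the list p gives the positions of the parents of the vertices of behead v,
   and t is the number of vertices whose neighbours have all been listed. *)
Record bfs A (x0 : V) (v : seq V) (p : seq nat) (t : nat) : Prop := Bfs {
  bfs_size : size v = (size p).+1;
  bfs_uniq : uniq v;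
  bfs_sub : {subset v <= A};
  bfs_sorted : sorted leq p;
  bfs_lt : forall i, (i < size p)%N -> (nth 0 p i <= i)%N;
  bfs_t : all (fun j => j < t)%N p;
  bfs_edge : forall i, (i < size p)%N -> e (nth x0 v (nth 0 p i)) (nth x0 v i.+1);
  bfs_closed : forall i u, (i < t)%N -> (i < size v)%N -> u \in A -> e (nth x0 v i) u -> u \in v }.

(** The vertex at position [t] is processed: its unlisted neighbours in [A] are appended with parent
    position [t]. Earlier parent positions are below [t], so the list of parents stays sorted. *)
Lemma bfs_step A x0 (v : seq V) p t : bfs A x0 v p t -> (t < size v)%N ->
  exists (v' : seq V) p', bfs A x0 v' p' t.+1 /\ (size v <= size v')%N.
Proof.
case=> sz uv sub so lt at_ ed cl tv.
pose w := [seq u <- enum A | e (nth x0 v t) u && (u \notin v)].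
exists (v ++ w), (p ++ nseq (size w) t); split; last by rewrite size_cat leq_addr.
have ws u : u \in w = [&& u \in A, e (nth x0 v t) u & u \notin v].
  by rewrite mem_filter mem_enum andbC andbA.
split.
- by rewrite !size_cat size_nseq sz.
- rewrite cat_uniq uv filter_uniq ?enum_uniq // andbT.
  by apply/hasPn => u; rewrite ws => /and3P[].
- by move=> u; rewrite mem_cat ws => /orP[/sub|/and3P[]].
- rewrite sorted_pairwise ?pairwise_cat; last exact: leq_trans.
  rewrite -!sorted_pairwise ?so; try exact: leq_trans.
  apply/and3P; split => //.
    apply/allrelP => i j ip; rewrite mem_nseq => /andP[_ /eqP ->].
    exact: ltnW (allP at_ _ ip).
  by case: (size w) => //= m; elim: m => //= m ->; rewrite leqnn.
- move=> i; rewrite size_cat size_nseq nth_cat => ilt; case: ltnP => ip; first exact: lt.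
  by rewrite nth_nseq; case: ifP => // _; lia.
- rewrite all_cat all_nseq ltnSn orbT andbT.
  by apply: sub_all at_ => j /ltnW.
- move=> i; rewrite size_cat size_nseq => ilt; rewrite !nth_cat sz ltnS.
  case: (ltnP i (size p)) => ip.
    have -> : nth 0 p i <= size p by apply: leq_trans (lt _ ip) (ltnW ip).
    by rewrite ltnS ip; apply: ed.
  have iw : i - size p < size w by lia.
  rewrite nth_nseq iw.
  have -> : t <= size p by rewrite -ltnS -sz.
  rewrite ltnS ltnNge ip /= subSS.
  have : nth x0 w (i - size p) \in w by apply: mem_nth.
  by rewrite ws => /and3P[].
- move=> i u it iv uA; rewrite nth_cat mem_cat ws uA.
  have [iv'|iv'] := ltnP i (size v).
    have [it'|it'] := ltnP i t; first by move/(cl _ _ it' iv' uA) => ->.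
    have -> : i = t by lia.
    by move=> ->; case: (u \in v).
  by lia.
Qed.

(** The sortedness of [p] is the point: it reduces the number of parent sequences from a factorial
    to an exponential in the size of [A]. *)
Lemma bfs_order A x0 : connected_on e A -> x0 \in A ->
  exists (v : seq V) p, [/\ v =i A, uniq v, size v = (size p).+1, sorted leq p &
    forall i, (i < size p)%N -> (nth 0 p i <= i)%N /\
       e (nth x0 v (nth 0 p i)) (nth x0 v i.+1)].
Proof.
move=> Ac x0A.
have [v [p [t [b tv]]]] : exists (v : seq V) p t, bfs A x0 v p t /\ t = size v.
  (* Either the search has ended or [m] vertices are processed; the latter fails for [m = #|A|.+1]
     because the list has no repetitions. *)
  have : forall m, (exists (v : seq V) p t, bfs A x0 v p t /\ t = size v) \/
      (exists (v : seq V) p, bfs A x0 v p m /\ (m <= size v)%N).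
    elim=> [|m [IH|[v [p [b mv]]]]]; [|by left|].
      by right; exists [:: x0], [::]; split => //; split => // u; rewrite inE => /eqP ->.
    have [mv'|mv'] := eqVneq m (size v); first by left; exists v, p, m.
    have [|v' [p' [b' vv']]] := bfs_step b; first by rewrite ltn_neqAle mv'.
    right; exists v', p'; split => //; apply: leq_trans vv'.
    by rewrite ltn_neqAle mv'.
  case/(_ #|A|.+1) => // -[v [p [b]]]; rewrite ltnNge -(card_uniqP (bfs_uniq b)).
  by case/negP; apply: subset_leq_card; apply/subsetP; apply: bfs_sub b.
have clo i u : (i < size v)%N -> u \in A -> e (nth x0 v i) u -> u \in v.
  by move=> iv; apply: (bfs_closed b) => //; rewrite tv.
exists v, p; split; [|exact: bfs_uniq b|exact: bfs_size b|exact: bfs_sorted b|].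
  move=> u; apply/idP/idP => [/(bfs_sub b)//|uA].
  have v0 : (0 < size v)%N by rewrite (bfs_size b).
  have y0 := mem_nth x0 v0; have y0A := bfs_sub b y0.
  have /forall_inP/(_ _ uA) := forall_inP Ac _ y0A.
  apply: (connect_ind (Q := mem v)) => //= z t' zv /and3P[_ tA].
  by rewrite -(nth_index x0 zv); apply: clo => //; rewrite index_mem.
by move=> i ip; split; [apply: bfs_lt b _ ip | apply: bfs_edge b _ ip].
Qed.

End Graph.

Import Order.TTheory GRing.Theory Num.Theory.
Local Open Scope ring_scope.

(** * Product measures *)

Lemma eq_ler (R : numDomainType) (x y : R) : x = y -> x <= y.
Proof. by move=> ->. Qed.

Lemma ffact_leq_expn n m : (n ^_ m <= n ^ m)%N.
Proof.
rewrite ffact_prod; apply: (@leq_trans (\prod_(i < m) n)).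
  by apply: leq_prod => i _; apply: leq_subr.
by rewrite prod_nat_const card_ord.
Qed.

Lemma bin_leq_expn n m : ('C(n, m) <= n ^ m)%N.
Proof.
apply: leq_trans (ffact_leq_expn n m); rewrite -bin_ffact.
by rewrite leq_pmulr ?fact_gt0.
Qed.

Lemma sum_small_sets (R : pzSemiRingType) (I : finType) (a : R) (k : nat) :
  \sum_(B : {set I} | (#|B| <= k)%N) a ^+ #|B| = \sum_(d < k.+1) 'C(#|I|, d)%:R * a ^+ d.
Proof.
rewrite (partition_big (fun B : {set I} => inord #|B| : 'I_k.+1) xpredT) //=.
apply: eq_bigr => d _; rewrite mulr_natl -card_draws -sumr_const.
apply: eq_big => B; last by case/andP => Bk /eqP <-; rewrite inordK.
rewrite inE; apply/andP/eqP => [[hB /eqP <-]|->]; first by rewrite inordK.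
by split; [rewrite -ltnS | apply/eqP/val_inj; rewrite /= inordK].
Qed.

Section Expectation.
Variables (R : realFieldType) (U : finType) (mu : U -> R).

Definition Ex1 (f : U -> R) : R := \sum_x mu x * f x.

Hypothesis mu_ge0 : forall x, 0 <= mu x.
Hypothesis mu_sum1 : \sum_x mu x = 1.

Lemma Ex1_const c : Ex1 (fun=> c) = c.
Proof. by rewrite /Ex1 -mulr_suml mu_sum1 mul1r. Qed.

Lemma Ex1_ge0 f : (forall x, mu x != 0 -> 0 <= f x) -> 0 <= Ex1 f.
Proof.
move=> h; apply: sumr_ge0 => x _.
by have [->|/h ?] := eqVneq (mu x) 0; rewrite ?mul0r // mulr_ge0.
Qed.

Lemma Ex1_le f g : (forall x, mu x != 0 -> f x <= g x) -> Ex1 f <= Ex1 g.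
Proof.
move=> h; apply: ler_sum => x _.
by have [->|/h ?] := eqVneq (mu x) 0; rewrite ?mul0r // ler_wpM2l.
Qed.

Lemma eq_Ex1 f g : (forall x, mu x != 0 -> f x = g x) -> Ex1 f = Ex1 g.
Proof.
move=> h; apply: eq_bigr => x _.
by have [->|/h ->] := eqVneq (mu x) 0; rewrite ?mul0r.
Qed.

Lemma Ex1_sum (I : Type) (r : seq I) (Q : pred I) (F : I -> U -> R) :
  Ex1 (fun x => \sum_(i <- r | Q i) F i x) = \sum_(i <- r | Q i) Ex1 (F i).
Proof. by rewrite /Ex1 exchange_big; apply: eq_bigr => x _; rewrite mulr_sumr. Qed.

Lemma Ex1Z c f : Ex1 (fun x => c * f x) = c * Ex1 f.
Proof. by rewrite /Ex1 mulr_sumr; apply: eq_bigr => x _; rewrite mulrCA. Qed.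

Lemma Ex1D f g : Ex1 (fun x => f x + g x) = Ex1 f + Ex1 g.
Proof. by rewrite /Ex1 -big_split; apply: eq_bigr => x _; rewrite mulrDr. Qed.

Lemma Ex1B f g : Ex1 (fun x => f x - g x) = Ex1 f - Ex1 g.
Proof. by rewrite /Ex1 -sumrB; apply: eq_bigr => x _; rewrite mulrBr. Qed.

Lemma Ex1_le_const f c : (forall x, mu x != 0 -> f x <= c) -> Ex1 f <= c.
Proof. by move=> h; rewrite -[leRHS]Ex1_const; apply: Ex1_le. Qed.

Lemma Ex1_exchange (g : U -> U -> R) :
  Ex1 (fun x => Ex1 (g x)) = Ex1 (fun y => Ex1 (g^~ y)).
Proof.
rewrite /Ex1; under eq_bigr do rewrite mulr_sumr.
rewrite exchange_big; apply: eq_bigr => y _; rewrite mulr_sumr.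
by apply: eq_bigr => x _; rewrite mulrCA.
Qed.

(* Optimising over the multiple of the indicator of X <> 0 in a square gives the Cauchy-Schwarz lower bound. *)
Lemma second_moment (X : U -> R) (m V : R) :
  0 < m -> m <= Ex1 X -> 0 < V -> Ex1 (fun x => X x ^+ 2) <= V ->
  m ^+ 2 / V <= Ex1 (fun x => (X x != 0)%:R).
Proof.
move=> m0 mX V0 XV.
set p := Ex1 _; set e := Ex1 X in mX.
have e0 : 0 < e by lra.
pose t := V / e.
have : 0 <= Ex1 (fun x => (X x - t * (X x != 0)%:R) ^+ 2).
  by apply: Ex1_ge0 => x _; rewrite sqr_ge0.
have -> : Ex1 (fun x => (X x - t * (X x != 0)%:R) ^+ 2) =
   Ex1 (fun x => X x ^+ 2) - 2 * t * e + t ^+ 2 * p.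
  rewrite /e /p -!Ex1Z -Ex1B -Ex1D; apply: eq_Ex1 => x _.
  by case: eqP => [->|_] /=; ring.
have -> : 2 * t * e = 2 * V by rewrite /t; field; rewrite gt_eqF.
move=> h; have h2 : V <= t ^+ 2 * p by lra.
have {h2} h3 : e ^+ 2 / V <= p.
  rewrite ler_pdivrMr //.
  have -> : e ^+ 2 = V * (e / V * e) by field; rewrite gt_eqF.
  have := ler_wpM2l (ltW (exprn_gt0 2 (divr_gt0 e0 V0))) h2.
  have -> : (e / V) ^+ 2 * V = e / V * e by field; rewrite gt_eqF.
  have -> : (e / V) ^+ 2 * (t ^+ 2 * p) = p by rewrite /t; field; rewrite !gt_eqF.
  by rewrite [p * V]mulrC => h4; rewrite ler_pM2l.
apply: le_trans h3; apply: ler_wpM2r; first by rewrite invr_ge0 ltW.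
by rewrite ler_sqr ?nnegrE // ltW.
Qed.

(** * Independent copies of one finite random variable *)

Section Product.
Variable I : finType.
Implicit Types (w : {ffun I -> U}) (A : {set I}).

Definition Ex (f : {ffun I -> U} -> R) : R := \sum_(w : {ffun I -> U}) (\prod_i mu (w i)) * f w.

Let wt_ge0 w : 0 <= \prod_i mu (w i).
Proof. exact: prodr_ge0. Qed.

Lemma Ex_le f g :
  (forall w, (forall i, mu (w i) != 0) -> f w <= g w) -> Ex f <= Ex g.
Proof.
move=> h; apply: ler_sum => w _.
have [->|/prodf_neq0 wn0] := eqVneq (\prod_i mu (w i)) 0; first by rewrite !mul0r.
by rewrite ler_wpM2l // h // => i; apply: wn0.
Qed.

Lemma eq_Ex f g :
  (forall w, (forall i, mu (w i) != 0) -> f w = g w) -> Ex f = Ex g.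
Proof. by move=> h; apply/le_anti; rewrite !Ex_le // => w /h ->. Qed.

Lemma Ex_prod (g : I -> U -> R) :
  Ex (fun w => \prod_i g i (w i)) = \prod_i Ex1 (g i).
Proof.
by rewrite /Ex /Ex1 bigA_distr_bigA; apply: eq_bigr => w _; rewrite big_split.
Qed.

Let sum_wt : \sum_(w : {ffun I -> U}) \prod_i mu (w i) = 1.
Proof. by rewrite -(bigA_distr_bigA (fun=> mu)) /= big1. Qed.

Lemma Ex_const c : Ex (fun=> c) = c.
Proof.
by rewrite /Ex -mulr_suml sum_wt mul1r.
Qed.

Lemma Ex_le_const f c : (forall w, (forall i, mu (w i) != 0) -> f w <= c) -> Ex f <= c.
Proof. by move=> h; rewrite -[leRHS]Ex_const; apply: Ex_le. Qed.

Lemma Ex_ge0 f : (forall w, 0 <= f w) -> 0 <= Ex f.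
Proof. by move=> h; apply: sumr_ge0 => w _; rewrite mulr_ge0. Qed.

Lemma ExZ c f : Ex (fun w => c * f w) = c * Ex f.
Proof. by rewrite /Ex mulr_sumr; apply: eq_bigr => x _; rewrite mulrCA. Qed.

Lemma ExD f g : Ex (fun w => f w + g w) = Ex f + Ex g.
Proof. by rewrite /Ex -big_split; apply: eq_bigr => x _; rewrite mulrDr. Qed.

Lemma ExB f g : Ex (fun w => f w - g w) = Ex f - Ex g.
Proof. by rewrite /Ex -sumrB; apply: eq_bigr => x _; rewrite mulrBr. Qed.

Lemma Ex_sum (J : Type) (r : seq J) (Q : pred J) (F : J -> {ffun I -> U} -> R) :
  Ex (fun x => \sum_(i <- r | Q i) F i x) = \sum_(i <- r | Q i) Ex (F i).
Proof. by rewrite /Ex exchange_big; apply: eq_bigr => x _; rewrite mulr_sumr. Qed.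

Lemma Ex_prod_in A (g : I -> U -> R) :
  Ex (fun w => \prod_(i in A) g i (w i)) = \prod_(i in A) Ex1 (g i).
Proof.
pose g' i x := if i \in A then g i x else 1.
rewrite [RHS]big_mkcond -[LHS](_ : Ex (fun w => \prod_i g' i (w i)) = _).
  rewrite Ex_prod; apply: eq_bigr => i _; rewrite /g'; case: ifP => // _.
  exact: Ex1_const.
by apply: eq_Ex => w _; rewrite [RHS]big_mkcond.
Qed.

Lemma Ex_coord i (g : U -> R) : Ex (fun w => g (w i)) = Ex1 g.
Proof.
have := Ex_prod_in [set i] (fun=> g); rewrite big_set1 => <-.
by apply: eq_Ex => w _; rewrite big_set1.
Qed.

Definition mix A w w' : {ffun I -> U} := [ffun i => if i \in A then w i else w' i].

(* (w, w') |-> (mix A w w', mix A w' w) is a measure preserving involution. *)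
Lemma Ex_mix A f : Ex f = Ex (fun w => Ex (fun w' => f (mix A w w'))).
Proof.
transitivity (\sum_(p : {ffun I -> U} * {ffun I -> U})
   ((\prod_i mu (p.1 i)) * (\prod_i mu (p.2 i))) * f p.1).
  rewrite -(pair_bigA _ (fun w w' => (\prod_i mu (w i)) * (\prod_i mu (w' i)) * f w)) /=.
  apply: eq_bigr => w _; rewrite -mulr_suml -mulr_sumr.
  by rewrite sum_wt mulr1.
have inv : involutive (fun p : {ffun I -> U} * {ffun I -> U} =>
    (mix A p.1 p.2, mix A p.2 p.1)).
  case=> w w' /=; congr pair; apply/ffunP => i; rewrite /mix ffunE.
    by case: ifP => iA; rewrite ffunE iA.
  by case: ifP => iA; rewrite ffunE iA.
rewrite (reindex_inj (inv_inj inv)) /=.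
rewrite -(pair_bigA _ (fun w w' => (\prod_i mu (mix A w w' i)) *
   (\prod_i mu (mix A w' w i)) * f (mix A w w'))) /=.
apply: eq_bigr => w _; rewrite mulr_sumr; apply: eq_bigr => w' _.
rewrite mulrA -!big_split /=; congr (_ * _).
by apply: eq_bigr => i _; rewrite !ffunE; case: ifP => // _; rewrite mulrC.
Qed.

Definition upd w i x : {ffun I -> U} := [ffun j => if j == i then x else w j].

Lemma Ex_upd i f : Ex f = Ex (fun w => Ex1 (fun x => f (upd w i x))).
Proof.
rewrite (Ex_mix [set~ i]); apply: eq_Ex => w _.
rewrite -(Ex_coord i (fun x => f (upd w i x))); apply: eq_Ex => w' _.
by congr f; apply/ffunP => j; rewrite !ffunE !inE; case: eqP => [->|].
Qed.

Lemma Ex_coord2 i j (g : U -> U -> R) : i != j ->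
  Ex (fun w => g (w i) (w j)) = Ex1 (fun x => Ex1 (g x)).
Proof.
move=> ij; rewrite (Ex_upd j) -(Ex_coord i (fun x => Ex1 (g x))).
apply: eq_Ex => w _; apply: eq_Ex1 => x _.
by rewrite !ffunE eqxx (negbTE ij).
Qed.

Definition Pr (E : pred {ffun I -> U}) : R := Ex (fun w => (E w)%:R).

Lemma Pr_ge0 E : 0 <= Pr E.
Proof. by apply: Ex_ge0 => w; rewrite ler0n. Qed.

Lemma Pr_le (E F : pred {ffun I -> U}) :
  (forall w, (forall i, mu (w i) != 0) -> E w -> F w) -> Pr E <= Pr F.
Proof. 
move=> h; apply: Ex_le => w /h; rewrite ler_nat.
by case: (E w) (F w) => -[] // ->.
Qed.

Lemma Pr_le1 E : Pr E <= 1.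
Proof. by apply: Ex_le_const => w _; rewrite lern1 leq_b1. Qed.

Lemma PrC E : Pr (fun w => ~~ E w) = 1 - Pr E.
Proof.
rewrite -[1]Ex_const -ExB; apply: eq_Ex => w _.
by case: (E w); rewrite ?subrr ?subr0.
Qed.

Lemma Pr_sub2 (E F G : pred {ffun I -> U}) :
  (forall w, (forall i, mu (w i) != 0) -> E w -> F w || G w) -> Pr E <= Pr F + Pr G.
Proof.
move=> h; rewrite -ExD; apply: Ex_le => w /h; rewrite -natrD ler_nat.
by case: (E w) => [/(_ isT)|//]; case: (F w); case: (G w).
Qed.

Lemma Pr_exists (J : finType) (Q : pred J) (E : pred {ffun I -> U})
    (F : J -> pred {ffun I -> U}) :
  (forall w, (forall i, mu (w i) != 0) -> E w -> exists2 j, Q j & F j w) ->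
  Pr E <= \sum_(j | Q j) Pr (F j).
Proof.
move=> h; rewrite -Ex_sum; apply: Ex_le => w /h.
case: (E w) => [/(_ isT)[j Qj Fj]|_]; last by apply: sumr_ge0 => *; rewrite ler0n.
by rewrite (bigD1 j) //= Fj lerDl sumr_ge0 // => *; rewrite ler0n.
Qed.

Lemma Pr_forall_in A (H : I -> pred U) :
  Pr (fun w => [forall v in A, H v (w v)]) = \prod_(v in A) Ex1 (fun x => (H v x)%:R).
Proof.
rewrite -Ex_prod_in; apply: eq_Ex => w _; case: forall_inP => h.
  by rewrite big1 // => v /h ->.
have [v vA /negbTE hv] : exists2 v, v \in A & ~~ H v (w v).
  by apply/exists_inP; rewrite -negb_forall_in; apply/forall_inP.
by rewrite (bigD1 v) //= hv mul0r.
Qed.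

(** The product of the couplings [nu] over the coordinates couples the two product measures. The
    right-hand side is the probability of [E] under [mu'], written out because [Pr] here refers to
    [mu]. *)
Lemma Pr_coupling (mu' : U -> R) (nu : U -> U -> R) (E : pred {ffun I -> U}) :
  (forall x y, 0 <= nu x y) -> (forall x, \sum_y nu x y = mu x) ->
  (forall y, \sum_x nu x y = mu' y) ->
  (forall w w', E w -> (forall i, nu (w i) (w' i) != 0) -> E w') ->
  Pr E <= \sum_(w : {ffun I -> U}) (\prod_i mu' (w i)) * (E w)%:R.
Proof.
move=> nu0 nu1 nu2 h.
have -> : Pr E = \sum_(w : {ffun I -> U}) \sum_(w' : {ffun I -> U})
    (\prod_i nu (w i) (w' i)) * (E w)%:R.
  apply: eq_bigr => w _; rewrite -mulr_suml; congr (_ * _).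
  rewrite -(bigA_distr_bigA (fun i => nu (w i))) /=.
  by apply: eq_bigr => i _; rewrite nu1.
rewrite exchange_big /=; apply: ler_sum => w' _.
have -> : \prod_i mu' (w' i) = \sum_(w : {ffun I -> U}) \prod_i nu (w i) (w' i).
  rewrite -(bigA_distr_bigA (fun i x => nu x (w' i))) /=.
  by apply: eq_bigr => i _; rewrite nu2.
rewrite mulr_suml; apply: ler_sum => w _.
have [->|/prodf_neq0 pn0] := eqVneq (\prod_i nu (w i) (w' i)) 0; first by rewrite !mul0r.
rewrite ler_wpM2l ?prodr_ge0 // ler_nat; have := h w w'.
by case: (E w) => // /(_ isT) -> // i; apply: pn0.
Qed.

(** Union bound over the exact set [B] of hits outside [A], whose probability is Q^|B| (1 - Q)^(N -
    |B|) with N the number of coordinates outside [A]. Since C(n, d) <= C(k, d) n^d for d <= k, the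
    sum over [B] is at most the binomial expansion of (1 + n Q)^k. *)
Lemma Pr_few_hits A (H : pred U) (k : nat) :
  Pr (fun w => #|[set v in ~: A | H (w v)]| <= k)%N
    <= (1 + #|I|%:R * Ex1 (fun x => (H x)%:R)) ^+ k
       * (1 - Ex1 (fun x => (H x)%:R)) ^+ (#|I| - #|A| - k).
Proof.
set Q := Ex1 _.
have Q0 : 0 <= Q by apply: Ex1_ge0 => x _; rewrite ler0n.
have Q1 : Q <= 1 by apply: Ex1_le_const => x _; rewrite lern1 leq_b1.
pose F (B : {set I}) w := [forall (v | v \in ~: A), H (w v) == (v \in B)].
apply: (@le_trans _ _ (\sum_(B : {set I} | (B \subset ~: A) && (#|B| <= k)%N) Pr (F B))).
  apply: Pr_exists => w _ hk; exists [set v in ~: A | H (w v)].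
    by rewrite hk andbT; apply/subsetP => v; rewrite inE => /andP[].
  by apply/forall_inP => v vA; rewrite inE vA.
have PrF (B : {set I}) : B \subset ~: A ->
    Pr (F B) = Q ^+ #|B| * (1 - Q) ^+ (#|I| - #|A| - #|B|).
  move=> BA.
  rewrite (Pr_forall_in _ (fun v x => H x == (v \in B))) (bigID (mem B)) /= -big_filter.
  congr (_ * _).
    rewrite big_filter (eq_bigl (mem B)) => [|v]; last first.
      by apply/andP/idP => [[]//|vB]; rewrite (subsetP BA).
    rewrite (eq_bigr (fun=> Q)) ?prodr_const // => v; rewrite inE => vB.
    by apply: eq_Ex1 => x _; rewrite vB eqb_id.
  rewrite (eq_bigl (mem (~: A :\: B))) => [|v]; last by rewrite !inE andbC.
  rewrite (eq_bigr (fun=> 1 - Q)) ?prodr_const.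
    by congr (_ ^+ _); rewrite cardsD (setIidPr BA) cardsCs setCK.
  move=> v; rewrite inE /= in_setD => /andP[vB _]; rewrite -[X in X - _]Ex1_const -Ex1B.
  apply: eq_Ex1 => x _; rewrite (negbTE vB).
  by case: (H x); rewrite ?subrr ?subr0.
apply: (@le_trans _ _ (\sum_(B : {set I} | (#|B| <= k)%N)
    Q ^+ #|B| * (1 - Q) ^+ (#|I| - #|A| - k))).
  rewrite [leRHS](bigID (fun B : {set I} => B \subset ~: A)) /=.
  rewrite -[leLHS]addr0 lerD //; last first.
    by apply: sumr_ge0 => B _; rewrite mulr_ge0 ?exprn_ge0 // subr_ge0.
  rewrite [leLHS](eq_bigl (fun B : {set I} => (#|B| <= k)%N && (B \subset ~: A))).
    apply: ler_sum => B /andP[Bk BA]; rewrite PrF // ler_wpM2l ?exprn_ge0 //.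
    by apply: ler_wiXn2l; rewrite ?subr_ge0 // ?lerBlDr ?lerDl // leq_sub2l.
  by move=> B; rewrite andbC.
rewrite -mulr_suml ler_wpM2r ?exprn_ge0 ?subr_ge0 //.
rewrite sum_small_sets exprDn; apply: ler_sum => i _.
rewrite expr1n mul1r exprMn -[leRHS]mulr_natl [leRHS]mulrA.
rewrite ler_wpM2r ?exprn_ge0 // -natrX -natrM ler_nat.
apply: leq_trans (bin_leq_expn _ _) _.
by rewrite leq_pmull // bin_gt0 -ltnS.
Qed.

End Product.
End Expectation.

(** * Uniform K-subsets *)

Lemma sum_natr_pred (R : pzSemiRingType) (T : finType) (Q : pred T) :
  \sum_x (Q x)%:R = #|[set x | Q x]|%:R :> R.
Proof.
rewrite -sum1dep_card natr_sum [RHS]big_mkcond; apply: eq_bigr => x _.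
by case: (Q x).
Qed.

Lemma prodr_ge1 (R : numDomainType) (I : finType) (F : I -> R) :
  (forall i, 1 <= F i) -> 1 <= \prod_i F i.
Proof.
by move=> h; elim/big_ind: _ => // x y x1 y1; rewrite mulr_ege1.
Qed.

Section UniformSubset.
Variables (R : realFieldType) (P K : nat).
Hypothesis KP : (K <= P)%N.
Implicit Types (S T F W : {set 'I_P}).

Definition unif_subset S : R := (#|S| == K)%:R / 'C(P, K)%:R.
Local Notation mu := unif_subset.
Local Notation E1 := (Ex1 mu).

Let bin_neq0 : 'C(P, K)%:R != 0 :> R.
Proof. by rewrite pnatr_eq0 -lt0n bin_gt0. Qed.

Lemma unif_ge0 S : 0 <= mu S.
Proof. by rewrite /mu divr_ge0. Qed.

Lemma unif_neq0 S : mu S != 0 -> #|S| = K.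
Proof.
rewrite /unif_subset; have [//|_] := eqVneq #|S| K.
by rewrite (_ : false%:R = 0) // mul0r eqxx.
Qed.

Lemma unif_sum1 : \sum_S mu S = 1.
Proof.
by rewrite -mulr_suml sum_natr_pred card_draws card_ord mulfV.
Qed.
Hint Resolve unif_ge0 unif_sum1 : core.

Lemma card_supsets F k : (#|F| <= k)%N ->
  #|[set T : {set 'I_P} | (F \subset T) && (#|T| == k)]| = 'C(P - #|F|, k - #|F|).
Proof.
move=> Fk.
have <- : #|~: F| = (P - #|F|)%N by rewrite cardsCs setCK card_ord.
rewrite -cards_draws; set D := [set A : {set _} | A \subset _ & _].
rewrite -(@card_in_imset _ _ (fun B => B :|: F) D) /D {D}.
  apply: eq_card => T; rewrite inE; apply/andP/imsetP => [[FT /eqP Tk]|[B]].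
    exists (T :\: F); last first.
      apply/setP => i; have := subsetP FT i; rewrite !inE.
      by case: (i \in F) => /= [->|_]; rewrite ?orbF.
    by rewrite inE subDset setUCr subsetT /= cardsD (setIidPr FT) Tk.
  rewrite inE => /andP[BF /eqP Bk] ->; rewrite subsetUr; split => //.
  rewrite cardsU Bk (_ : B :&: F = set0) ?cards0 ?subn0 ?subnK //.
  by apply/eqP; rewrite setI_eq0 disjoints_subset.
move=> B C; rewrite !inE => /andP[BF _] /andP[CF _] /setP eBC.
apply/setP => i; have := eBC i; rewrite !inE.
have := subsetP BF i; have := subsetP CF i; rewrite !inE.
case: (i \in F) => /= [hC hB _|_ _]; last by rewrite !orbF.
by apply/idP/idP => [/hB|/hC].
Qed.

Lemma Ex1_supset F : E1 (fun T => (F \subset T)%:R) = (K ^_ #|F|)%:R / (P ^_ #|F|)%:R.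
Proof.
have FP : (#|F| <= P)%N by rewrite -[leqRHS]card_ord max_card.
have -> : E1 (fun T => (F \subset T)%:R) =
   #|[set T : {set 'I_P} | (F \subset T) && (#|T| == K)]|%:R / 'C(P, K)%:R.
  rewrite -sum1dep_card natr_sum big_mkcond mulr_suml.
  apply: eq_bigr => T _; rewrite /mu mulrAC -natrM mulnb andbC.
  by case: (_ && _).
have [FK|KF] := leqP #|F| K; last first.
  rewrite (ffact_small KF) mul0r eq_card0 ?mul0r // => T; rewrite inE.
  by apply/andP => -[/subset_leq_card FT /eqP TK]; move: KF; rewrite -TK ltnNge FT.
rewrite card_supsets //.
apply/eqP; rewrite eqr_div ?bin_neq0 ?pnatr_eq0 -?lt0n ?ffact_gt0 //.
rewrite -!natrM; apply/eqP; congr (_%:R).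
have : (0 < (K - #|F|)`! * (P - K)`!)%N by rewrite muln_gt0 !fact_gt0.
move=> h; apply/eqP; rewrite -(eqn_pmul2r h) {h}.
have e1 := bin_fact (leq_sub2r #|F| KP).
have e2 := ffact_fact FP.
have e3 := ffact_fact FK.
have e4 := bin_fact KP.
have e5 : (P - #|F| - (K - #|F|) = P - K)%N by rewrite subnBA // subnK.
by apply/eqP; rewrite e5 in e1 *; nia.
Qed.

Lemma ffact_ratio_le i : (i <= P)%N -> (K ^_ i)%:R / (P ^_ i)%:R <= (K%:R / P%:R) ^+ i :> R.
Proof.
move=> iP; rewrite expr_div_n.
have [P0|P0] := posnP P.
  by move: iP; rewrite P0 leqn0 => /eqP ->; rewrite !ffactn0 !expr0.
rewrite ler_pdivrMr ?ltr0n ?ffact_gt0 // mulrAC ler_pdivlMr ?exprn_gt0 ?ltr0n //.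
rewrite -!natrX -!natrM ler_nat {iP}.
elim: i => [|i IH]; first by rewrite !ffactn0 !expn0.
rewrite !ffactnSr !expnSr mulnACA [leqRHS]mulnACA leq_mul //.
by rewrite mulnBl mulnBr leq_sub2l // mulnC leq_mul2l KP orbT.
Qed.

Lemma Ex1_supset_le F : E1 (fun T => (F \subset T)%:R) <= (K%:R / P%:R) ^+ #|F|.
Proof. by rewrite Ex1_supset ffact_ratio_le // -[leqRHS]card_ord max_card. Qed.

Lemma bin_supset T S i :
  'C(#|T :&: S|, i)%:R = \sum_(F : {set 'I_P} | (F \subset S) && (#|F| == i)) (F \subset T)%:R :> R.
Proof.
rewrite -cards_draws -sum1dep_card natr_sum big_mkcond [RHS]big_mkcond.
apply: eq_bigr => F _; rewrite subsetI; case: (F \subset T) => //=.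
by case: (_ && _).
Qed.

Lemma Ex1_bin S i : E1 (fun T => 'C(#|T :&: S|, i)%:R) = 'C(#|S|, i)%:R * ((K ^_ i)%:R / (P ^_ i)%:R).
Proof.
under eq_Ex1 do rewrite bin_supset.
rewrite Ex1_sum -cards_draws -sum1dep_card natr_sum mulr_suml.
by apply: eq_bigr => F /andP[_ /eqP Fi]; rewrite Ex1_supset Fi mul1r.
Qed.

(** The product counts the choices of a [c u]-subset [f u] of [T :&: S u] for every [u]. By
    disjointness the union of the [f u] has exactly the sum of the [c u] as its size, and each
    prescribed element of [T] costs at most K / P. *)
Lemma Ex1_prod_bin (I : finType) (S : I -> {set 'I_P}) (c : I -> nat) :
  (forall u v, u != v -> [disjoint S u & S v]) ->
  E1 (fun T => \prod_u 'C(#|T :&: S u|, c u)%:R) <=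
  \prod_u ('C(#|S u|, c u)%:R * (K%:R / P%:R) ^+ c u).
Proof.
move=> dis; pose Q u : pred {set 'I_P} := fun F => (F \subset S u) && (#|F| == c u).
have -> : E1 (fun T => \prod_u 'C(#|T :&: S u|, c u)%:R) =
  \sum_(f in family Q)
    E1 (fun T => \prod_u (f u \subset T)%:R).
  rewrite -Ex1_sum; apply: eq_Ex1 => T _.
  rewrite -(bigA_distr_big_dep Q (fun u F => (F \subset T)%:R)).
  by apply: eq_bigr => u _; rewrite bin_supset.
have -> : \prod_u ('C(#|S u|, c u)%:R * (K%:R / P%:R) ^+ c u) =
  \sum_(f in family Q)
    \prod_u ((K%:R / P%:R) ^+ c u : R).
  rewrite -(bigA_distr_big_dep Q (fun u F => (K%:R / P%:R) ^+ c u)).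
  apply: eq_bigr => u _.
  by rewrite sumr_const -cards_draws mulr_natl; congr (_ *+ _); apply: eq_card => F; rewrite !inE.
apply: ler_sum => f /familyP /= fP.
have fc u : #|f u| = c u by have /andP[_ /eqP] : Q u (f u) := fP u.
have fS u : f u \subset S u by have /andP[] : Q u (f u) := fP u.
rewrite prodrXr.
have <- : #|\bigcup_u f u| = (\sum_u c u)%N.
  rewrite -sum1_card partition_disjoint_bigcup => [|u v uv].
    by apply: eq_bigr => u _; rewrite sum1_card fc.
  by rewrite (disjointWl (fS u)) // (disjointWr (fS v)) // dis.
apply: le_trans (Ex1_supset_le _); apply: Ex1_le => // T _.
case: (boolP (_ \subset T)) => [_|/bigcupsP h].
  by apply: prodr_ile1 => u _; rewrite ler0n lern1 leq_b1.
have [u hu] : exists u, ~~ (f u \subset T).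
  by apply/existsP; rewrite -negb_forall; apply/negP => /forallP hh; apply: h => u _.
by rewrite (bigD1 u) //= (negbTE hu) mul0r.
Qed.

Lemma bin_ffact_le i : 'C(K, i)%:R * (K%:R / P%:R) ^+ i <= (K%:R ^+ 2 / P%:R) ^+ i / i`!%:R :> R.
Proof.
rewrite ler_pdivlMr ?ltr0n ?fact_gt0 // mulrAC -natrM bin_ffact.
have -> : K%:R ^+ 2 / P%:R = K%:R * (K%:R / P%:R) :> R by rewrite expr2 mulrA.
rewrite [leRHS]exprMn ler_wpM2r ?exprn_ge0 ?divr_ge0 //.
by rewrite -natrX ler_nat ffact_leq_expn.
Qed.

(** Markov's inequality for the number of [i]-subsets of [T :&: S], which is the case of a single
    set in [Ex1_prod_bin]. *)
Lemma inter_card_tail_le S i : #|S| = K ->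
  E1 (fun T => (i <= #|T :&: S|)%:R) <= (K%:R ^+ 2 / P%:R) ^+ i / i`!%:R.
Proof.
move=> SK; apply: le_trans (bin_ffact_le i).
have -> : 'C(K, i)%:R * (K%:R / P%:R) ^+ i =
   \prod_(u : 'I_1) ('C(#|S|, i)%:R * (K%:R / P%:R) ^+ i : R) by rewrite big_ord1 SK.
have dis (u v : 'I_1) : u != v -> [disjoint S & S] by rewrite !ord1.
apply: le_trans (Ex1_prod_bin (S := fun=> S) (fun=> i) dis).
apply: Ex1_le => // T _; rewrite big_ord1 ler_nat.
by case: (leqP i _) => //= h; rewrite bin_gt0.
Qed.

(** * The event that a uniform set shares s items with given sets *)

Variable s : nat.
Hypotheses (s1 : (1 <= s)%N) (sK : (s <= K)%N).

Definition hit S T := (s <= #|S :&: T|)%N.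
(* The probability of [hit S T] for a uniform K-set T is asymptotic to this. *)
Definition edge_rate : R := K%:R ^+ (2 * s) / P%:R ^+ s / s`!%:R.
Local Notation x := (K%:R ^+ 2 / P%:R : R).
Local Notation a := edge_rate.

Let K0 : 0 < K%:R :> R. Proof. by rewrite ltr0n (leq_trans s1). Qed.
Let P0 : 0 < P%:R :> R. Proof. by rewrite ltr0n (leq_trans s1) // (leq_trans sK). Qed.

Lemma edge_rateE : a = x ^+ s / s`!%:R.
Proof. by rewrite /edge_rate exprM expr_div_n. Qed.

Lemma edge_rate_gt0 : 0 < a.
Proof. by rewrite /edge_rate !divr_gt0 ?exprn_gt0 // ltr0n fact_gt0. Qed.

Lemma hitC S T : hit S T = hit T S.
Proof. by rewrite /hit setIC. Qed.

Lemma hit_le S : #|S| = K -> E1 (fun T => (hit S T)%:R) <= a.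
Proof.
move=> SK; rewrite edge_rateE; apply: le_trans (inter_card_tail_le s SK).
by apply: Ex1_le => // T _; rewrite hitC.
Qed.

Lemma hit_family_le (I : finType) (X : {set I}) (S : I -> {set 'I_P}) :
  {in X, forall u, #|S u| <= K}%N ->
  {in X &, forall u v, u != v -> [disjoint S u & S v]} ->
  E1 (fun T => [forall u in X, hit (S u) T]%:R) <= a ^+ #|X|.
Proof.
move=> SK dis.
(* Outside [X] the pair (empty set, 0) contributes the factor C(0, 0) = 1. *)
pose S' u := if u \in X then S u else set0.
pose c u := if u \in X then s else 0%N.
have dis' u v : u != v -> [disjoint S' u & S' v].
  rewrite /S'; case: ifP => uX; case: ifP => vX uv.
  - exact: dis.
  - by rewrite disjoint_sym -setI_eq0 set0I.
  - by rewrite -setI_eq0 set0I.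
  - by rewrite -setI_eq0 set0I.
apply: (@le_trans _ _ (\prod_u ('C(#|S' u|, c u)%:R * (K%:R / P%:R) ^+ c u))).
  apply: le_trans (Ex1_prod_bin _ dis'); apply: Ex1_le => // T _.
  case: (boolP [forall _ in _, _]) => [/forall_inP h|_]; last first.
    by apply: prodr_ge0 => u _; rewrite ler0n.
  apply: prodr_ge1 => u; rewrite ler1n bin_gt0 /c /S'; case: ifP => // uX.
  by rewrite setIC; apply: h.
rewrite -prodr_const [leRHS]big_mkcond; apply: ler_prod => u _.
rewrite mulr_ge0 ?exprn_ge0 ?divr_ge0 //= /c /S'; case: ifP => uX.
  apply: le_trans (_ : _ <= 'C(K, s)%:R * (K%:R / P%:R) ^+ s) _.
    rewrite ler_wpM2r ?exprn_ge0 ?divr_ge0 // ler_nat.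
    by rewrite leq_bin2l // SK.
  by rewrite edge_rateE bin_ffact_le.
by rewrite bin0 expr0 mulr1.
Qed.

(** Sum over the common element [e]: besides [e], the set [T] contains s - 1 elements of [S :\ e],
    and C(K-1, s-1) = (s / K) C(K, s). The Boolean index runs over the two disjoint sets, the
    singleton of [e] and [S :\ e]. *)
Lemma hit_inter_le S W : #|S| = K ->
  E1 (fun T => (hit S T && (T :&: S :&: W != set0))%:R)
    <= #|S :&: W|%:R * (s%:R / K%:R * a).
Proof.
move=> SK.
pose D e (b : bool) := if b then [set e] else S :\ e.
pose c (b : bool) := if b then 1%N else s.-1.
apply: (@le_trans _ _ (\sum_(e in S :&: W) E1 (fun T => \prod_b 'C(#|T :&: D e b|, c b)%:R))).
  rewrite -Ex1_sum; apply: Ex1_le => // T _.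
  case: andP => [[hT /set0Pn[e]]|_]; last first.
    by apply: sumr_ge0 => e _; apply: prodr_ge0.
  rewrite !inE => /andP[/andP[eT eS] eW].
  rewrite (bigD1 e) ?inE ?eS //= -[leLHS]addr0 lerD //; last first.
    by apply: sumr_ge0 => e' _; apply: prodr_ge0.
  apply: prodr_ge1 => -[]; rewrite ler1n bin_gt0 /c /D.
    by rewrite (setIidPr _) ?cards1 // sub1set.
  move: hT; rewrite /hit setIC (cardsD1 e) !inE eT eS setDIl.
  rewrite (_ : (T :\ e) :&: (S :\ e) = T :&: (S :\ e)); first by case: (s) s1.
  by apply/setP => i; rewrite !inE; case: eqP; rewrite ?andbF.
rewrite mulr_natl -sumr_const; apply: ler_sum => e; rewrite inE => /andP[eS eW].
apply: le_trans (Ex1_prod_bin _ _) _ => [[] [] //= _|].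
- by rewrite disjoints1 !inE eqxx.
- by rewrite disjoint_sym disjoints1 !inE eqxx.
rewrite big_bool /= /D /c cards1 bin1 mul1r expr1.
have -> : #|S :\ e| = K.-1 by rewrite -SK (cardsD1 e S) eS.
have -> : K%:R / P%:R * ('C(K.-1, s.-1)%:R * (K%:R / P%:R) ^+ s.-1) =
    'C(K.-1, s.-1)%:R * (K%:R / P%:R) ^+ s :> R.
  by rewrite mulrCA -exprS prednK.
have -> : 'C(K.-1, s.-1)%:R = s%:R / K%:R * 'C(K, s)%:R :> R.
  rewrite mulrAC -natrM; have := mul_bin_diag K s.-1; rewrite prednK // => <-.
  by rewrite natrM mulrAC mulfV ?mul1r // gt_eqF.
rewrite -mulrA ler_wpM2l ?divr_ge0 // edge_rateE bin_ffact_le //.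
Qed.

(* Accounts for the dependence of the events [hit S1 T] and [hit S2 T]. *)
Definition Zint S1 S2 : R :=
  E1 (fun T => [&& hit S1 T, hit S2 T & T :&: S1 :&: S2 != set0]%:R).

Lemma Zint_ge0 S1 S2 : 0 <= Zint S1 S2.
Proof. by apply: Ex1_ge0. Qed.

(** If [T] avoids [S1 :&: S2], it hits the disjoint sets [S1 :\: S2] and [S2 :\: S1], which has
    probability at most a^2. *)
Lemma pair_hit_le S1 S2 : #|S1| = K -> #|S2| = K ->
  E1 (fun T => (hit S1 T && hit S2 T)%:R) <= a ^+ 2 + Zint S1 S2.
Proof.
move=> S1K S2K; pose D (b : bool) := if b then S1 :\: S2 else S2 :\: S1.
have Dle : {in [set: bool], forall u, #|D u| <= K}%N.
  by case=> _; rewrite /D -?S1K; [|rewrite S1K -S2K]; apply: subset_leq_card; apply: subsetDl.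
have Ddis : {in [set: bool] &, forall u v, u != v -> [disjoint D u & D v]}.
  by move=> [] [] _ _ //= _; rewrite /D -setI_eq0; apply/eqP/setP => i; rewrite !inE;
    case: (i \in S1); case: (i \in S2).
have := hit_family_le Dle Ddis; rewrite cardsT card_bool => h.
apply: (le_trans _ (lerD h (lexx _))); rewrite -Ex1D; apply: Ex1_le => // T _.
rewrite -natrD ler_nat; case: (boolP (hit S1 T)) => //= h1; case: (boolP (hit S2 T)) => //= h2.
case: (boolP (T :&: S1 :&: S2 == set0)) => [/eqP T0|_]; last by rewrite addn1.
rewrite addn0 lt0b; apply/forall_inP => -[] _; rewrite /hit /D.
  rewrite (_ : _ :&: T = S1 :&: T) //; apply/setP => i; have /setP/(_ i) := T0.
  by rewrite !inE; case: (i \in S1); case: (i \in S2); case: (i \in T).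
rewrite (_ : _ :&: T = S2 :&: T) //; apply/setP => i; have /setP/(_ i) := T0.
by rewrite !inE; case: (i \in S1); case: (i \in S2); case: (i \in T).
Qed.

Lemma Zint_le S1 S2 : #|S1| = K -> Zint S1 S2 <= #|S1 :&: S2|%:R * (s%:R / K%:R * a).
Proof.
move=> S1K; apply: le_trans (hit_inter_le S2 S1K); apply: Ex1_le => // T _.
by rewrite ler_nat; case: (hit S1 T) => //=; case: (hit S2 T).
Qed.

(** Averaging over the second set before [T] lets [hit_inter_le] apply with [T] as the given set,
    giving |T :&: S1| (s / K) a. On [hit S1 T] one has X <= s C(X, s) for X = |T :&: S1|, and the
    mean of C(X, s) is at most [a]. The result is smaller than the pointwise bound by a factor of
    order [a], as concentration requires. *)
Lemma Zint_mean S1 : #|S1| = K -> E1 (Zint S1) <= s%:R ^+ 2 / K%:R * a ^+ 2.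
Proof.
move=> S1K; rewrite Ex1_exchange.
apply: (@le_trans _ _ (E1 (fun T => (s%:R ^+ 2 / K%:R * a) * 'C(#|T :&: S1|, s)%:R))).
  apply: Ex1_le => // T /unif_neq0 TK.
  apply: (@le_trans _ _ ((hit S1 T)%:R * (#|T :&: S1|%:R * (s%:R / K%:R * a)))).
    case: (boolP (hit S1 T)) => h /=; last first.
      by rewrite mul0r Ex1_le_const // => S2 _; rewrite (negbTE h).
    rewrite mul1r; apply: le_trans (hit_inter_le S1 TK); apply: Ex1_le => // S2 _.
    rewrite /= hitC.
    by rewrite -setIA [S1 :&: S2]setIC setIA [T :&: S2]setIC.
  have -> : s%:R ^+ 2 / K%:R * a * 'C(#|T :&: S1|, s)%:R = (s * 'C(#|T :&: S1|, s))%:R * (s%:R / K%:R * a).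
    by rewrite natrM; ring.
  have sa : 0 <= s%:R / K%:R * a by apply: mulr_ge0; [apply: divr_ge0 | apply: ltW edge_rate_gt0].
  rewrite mulrA ler_wpM2r //.
  rewrite -natrM ler_nat setIC /hit; set X := #|_|.
  case: (leqP s X) => [sX|_] /=; rewrite ?mul0n // mul1n.
  have := mul_bin_diag X s.-1; rewrite prednK // => <-.
  by rewrite leq_pmulr // bin_gt0; lia.
rewrite Ex1Z expr2 [X in _ <= X]mulrA ler_wpM2l //.
  by apply: mulr_ge0; [rewrite divr_ge0 // mulr_ge0 | apply: ltW edge_rate_gt0].
by rewrite Ex1_bin S1K edge_rateE; apply: le_trans (bin_ffact_le s); rewrite ler_wpM2l // ffact_ratio_le // (leq_trans sK).
Qed.

(** Truncated inclusion-exclusion, so that binomial moments bound the hitting probability from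
    below. For X >= s + 2 the last term alone suffices, as (s + 1) C(X, s+1) = (X - s) C(X, s). *)
Lemma bin_bonferroni X : ('C(X, s) <= (s <= X) + s * 'C(X, s.+1))%N.
Proof.
have [sX|Xs] := leqP s X; last by rewrite bin_small.
have := mul_bin_left X s.
have [->|Xs] := eqVneq X s; first by rewrite binn.
have [->|Xs1] := eqVneq X s.+1.
  by rewrite binn binSn; lia.
move=> e; have : (s.+1 * 'C(X, s) <= s.+1 * (s * 'C(X, s.+1)))%N.
  rewrite mulnCA e mulnA leq_mul2r; apply/orP; right; nia.
by rewrite leq_pmul2l //; lia.
Qed.

Lemma ffact_ge i : (i <= K)%N -> K%:R ^+ i * (1 - (i * i.-1)%:R / K%:R) <= (K ^_ i)%:R :> R.
Proof.
elim: i => [|i IH] iK; first by rewrite mul0n mul0r subr0 expr0 ffactn0 mulr1.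
have {}IH := IH (ltnW iK).
have -> : (K ^_ i.+1)%:R = (K ^_ i)%:R * (K%:R - i%:R) :> R.
  by rewrite ffactnSr natrM natrB // ltnW.
have Ki : 0 <= K%:R - i%:R :> R by rewrite subr_ge0 ler_nat ltnW.
apply: le_trans (ler_wpM2r Ki IH); rewrite exprSr -!mulrA ler_wpM2l ?exprn_ge0 //.
have -> : K%:R * (1 - (i.+1 * i)%:R / K%:R) = K%:R - (i.+1 * i)%:R :> R.
  by field; rewrite gt_eqF.
have -> : (1 - (i * i.-1)%:R / K%:R) * (K%:R - i%:R) = K%:R - (i * i.-1)%:R - i%:R + (i * i.-1)%:R * i%:R / K%:R :> R.
  by field; rewrite gt_eqF.
have h1 : 0 <= (i * i.-1)%:R * i%:R / K%:R :> R by rewrite divr_ge0 // mulr_ge0.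
have h2 : (i * i.-1)%:R + i%:R <= (i.+1 * i)%:R :> R by rewrite -natrD ler_nat; case: (i) => //= n; lia.
lra.
Qed.

(** The loss x pays for more than [s] common items. The other loss comes from replacing the falling
    factorial of K, which occurs twice, by K^s; it vanishes for s = 1, which is essential because a
    n / K need not be small then. *)
Lemma hit_ge S : #|S| = K ->
  a * (1 - 2 * ((s * s.-1)%:R / K%:R) - x) <= E1 (fun T => (hit S T)%:R).
Proof.
move=> SK; have sP : (s <= P)%N := leq_trans sK KP.
have P1 : 0 < (P ^_ s)%:R :> R by rewrite ltr0n ffact_gt0.
have x0 : 0 <= x by rewrite divr_ge0 ?exprn_ge0.
have a0 := edge_rate_gt0.
set c := (s * s.-1)%:R / K%:R.
have c0 : 0 <= c by rewrite divr_ge0.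
(* The expected number of [s]-subsets of [T :&: S]. *)
set b := 'C(K, s)%:R * ((K ^_ s)%:R / (P ^_ s)%:R) : R.
have bx : b * (1 - x) <= E1 (fun T => (hit S T)%:R).
  have : b - s%:R * E1 (fun T => 'C(#|T :&: S|, s.+1)%:R) <= E1 (fun T => (hit S T)%:R).
    rewrite /b -{1}SK -Ex1_bin -Ex1Z -Ex1B; apply: Ex1_le => // T _.
    by rewrite lerBlDr -natrM -natrD ler_nat hitC bin_bonferroni.
  apply: le_trans; rewrite mulrBr mulr1 lerD2l lerN2 Ex1_bin SK.
  have [->|sK'] := eqVneq s K.
    by rewrite bin_small // mul0r mulr0 mulr_ge0 // mulr_ge0 ?divr_ge0.
  have {}sK' : (s < K)%N by rewrite ltn_neqAle sK'.
  have sP' : (s < P)%N := leq_trans sK' KP.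
  have KsPs : (K%:R - s%:R) / (P%:R - s%:R) <= K%:R / P%:R :> R.
    rewrite ler_pdivrMr ?subr_gt0 ?ltr_nat // mulrAC ler_pdivlMr //.
    have : s%:R * K%:R <= s%:R * P%:R :> R by rewrite ler_wpM2l // ler_nat.
    lra.
  have e1 : s.+1%:R * 'C(K, s.+1)%:R = (K%:R - s%:R) * 'C(K, s)%:R :> R.
    by rewrite -natrM mul_bin_left natrM natrB.
  have -> : (K ^_ s.+1)%:R / (P ^_ s.+1)%:R = (K ^_ s)%:R / (P ^_ s)%:R * ((K%:R - s%:R) / (P%:R - s%:R)) :> R.
    rewrite !ffactnSr !natrM !natrB // 1?ltnW //; field.
    by rewrite (gt_eqF P1) andbT subr_eq0 eqr_nat gtn_eqF.
  have h1 : s%:R * 'C(K, s.+1)%:R <= 'C(K, s)%:R * K%:R :> R.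
    apply: (@le_trans _ _ (s.+1%:R * 'C(K, s.+1)%:R)); first by rewrite ler_wpM2r // ler_nat.
    by rewrite e1 mulrC ler_wpM2l // lerBlDr lerDl.
  rewrite /b !mulrA -[X in _ <= X]mulrA.
  have h2 : 0 <= (K ^_ s)%:R / (P ^_ s)%:R :> R by rewrite divr_ge0.
  have h3 : 0 <= (K%:R - s%:R) / (P%:R - s%:R) :> R by rewrite divr_ge0 // subr_ge0 ler_nat ltnW.
  have := ler_wpM2l h2 (ler_pM (mulr_ge0 (ler0n _ s) (ler0n _ _)) h3 h1 KsPs).
  move=> hh; apply: le_trans (le_trans hh _); apply: eq_ler; ring.
have [x1|x1] := lerP x 1; last first.
  apply: (@le_trans _ _ 0); last by apply: Ex1_ge0.
  by rewrite pmulr_rle0 //; lra.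
apply: le_trans bx.
have ab : a * (1 - 2 * c) <= b.
  have Ks0 : 0 < K%:R ^+ s :> R by rewrite exprn_gt0.
  have Ps0 : 0 < P%:R ^+ s :> R by rewrite exprn_gt0.
  have sf0 : 0 < s`!%:R :> R by rewrite ltr0n fact_gt0.
  pose y : R := (K ^_ s)%:R / K%:R ^+ s.
  have y1 : 1 - c <= y by rewrite ler_pdivlMr // mulrC ffact_ge.
  have y2 : 1 - 2 * c <= y ^+ 2 by have := sqr_ge0 (y - 1); lra.
  have -> : b = (K ^_ s)%:R ^+ 2 / s`!%:R / (P ^_ s)%:R.
    by rewrite /b -bin_ffact natrM; field; rewrite !gt_eqF.
  apply: (@le_trans _ _ ((K ^_ s)%:R ^+ 2 / s`!%:R / P%:R ^+ s)).
    have -> : (K ^_ s)%:R ^+ 2 / s`!%:R / P%:R ^+ s = a * y ^+ 2.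
      by rewrite /y /edge_rate mulnC exprM; field; rewrite !gt_eqF.
    by rewrite ler_pM2l.
  rewrite ler_wpM2l ?divr_ge0 ?sqr_ge0 ?(ltW sf0) // lef_pV2 ?posrE //.
  by rewrite -natrX ler_nat ffact_leq_expn.
apply: le_trans (ler_wpM2r _ ab); last by rewrite subr_ge0.
rewrite -[leRHS]mulrA ler_pM2l //.
have : 0 <= c * x by rewrite mulr_ge0.
lra.
Qed.

End UniformSubset.

(** * Sets of vertices with few neighbours *)

Section Isg.
Variables (R : realFieldType) (n P K s : nat).
Hypotheses (KP : (K <= P)%N) (s1 : (1 <= s)%N) (sK : (s <= K)%N).
Local Notation config := {ffun 'I_n -> {set 'I_P}}.
Implicit Types (w : config) (A U : {set 'I_n}) (T : {set 'I_P}).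
Local Notation mu := (unif_subset R K).
Local Notation E1 := (Ex1 mu).
Local Notation a := (edge_rate R P K s).
Local Notation x := (K%:R ^+ 2 / P%:R : R).
Local Notation Z := (Zint R K s).

Let mu_ge0 := @unif_ge0 R P K.
Let mu_sum1 := unif_sum1 R KP.
Let a_gt0 : 0 < a := edge_rate_gt0 R KP s1 sK.

Lemma isg_adj_sym w : symmetric (isg_adj s w).
Proof. by move=> u v; rewrite /isg_adj eq_sym setIC. Qed.

Lemma isg_adj_irr w : irreflexive (isg_adj s w).
Proof. by move=> u; rewrite /isg_adj eqxx. Qed.

Definition hits w A T := [exists u in A, hit s (w u) T].
Definition hit_prob w A := E1 (fun T => (hits w A T)%:R).

Lemma mix_in A w w' u : u \in A -> mix A w w' u = w u.
Proof. by move=> uA; rewrite ffunE uA. Qed.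

Lemma mix_out A w w' u : u \notin A -> mix A w w' u = w' u.
Proof. by move=> uA; rewrite ffunE (negbTE uA). Qed.

Lemma nbhd_mix A w w' :
  nbhd (isg_adj s (mix A w w')) A = [set v in ~: A | hits w A (w' v)].
Proof.
apply/setP => v; rewrite !inE; case: (boolP (v \in A)) => //= vA.
apply: eq_existsb => u; case: (boolP (u \in A)) => //= uA.
rewrite /isg_adj /hit mix_in // mix_out //.
by have -> : u != v by apply: contraNneq vA => <-.
Qed.

(** The bound of [Pr_few_hits] is not monotone in the hitting probability, so its first factor takes
    the upper bound r a and its second the lower bound [Q]. *)
Definition few_bound r (Q : R) k := (1 + n%:R * (r%:R * a)) ^+ k * (1 - Q) ^+ (n - r - k).

Lemma hit_prob_le w A : (forall u, #|w u| = K) -> hit_prob w A <= #|A|%:R * a.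
Proof.
move=> wK; rewrite mulr_natl -sumr_const.
apply: (@le_trans _ _ (E1 (fun T => \sum_(u in A) (hit s (w u) T)%:R))).
  apply: Ex1_le => // T _; rewrite /hits; case: (boolP [exists _ in _, _]) => [|_].
    by case/exists_inP => u uA h; rewrite (bigD1 u) //= h lerDl sumr_ge0.
  exact: sumr_ge0.
by rewrite Ex1_sum; apply: ler_sum => u _; apply: hit_le.
Qed.

Lemma hit_prob01 w A : 0 <= hit_prob w A <= 1.
Proof.
apply/andP; split; first by apply: Ex1_ge0.
by apply: Ex1_le_const => // T _; rewrite lern1 leq_b1.
Qed.

Lemma few_nbhd w A k Q : (forall u, #|w u| = K) -> Q <= hit_prob w A ->
  Ex mu (fun w' => (#|nbhd (isg_adj s (mix A w w')) A| <= k)%N%:R) <= few_bound #|A| Q k.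
Proof.
move=> wK Qh.
have /andP[q0 q1] := hit_prob01 w A.
apply: le_trans (_ : _ <= (1 + n%:R * hit_prob w A) ^+ k * (1 - hit_prob w A) ^+ (n - #|A| - k)) _.
  have := @Pr_few_hits R _ mu mu_ge0 mu_sum1 'I_n A (hits w A) k.
  by rewrite /Pr card_ord; apply: le_trans; apply: Ex_le => // w' _; rewrite nbhd_mix.
have h0 : 0 <= 1 - hit_prob w A by rewrite subr_ge0.
have h1 : 0 <= 1 + n%:R * hit_prob w A by rewrite addr_ge0 // mulr_ge0.
have h2 : hit_prob w A <= #|A|%:R * a := hit_prob_le A wK.
apply: ler_pM; rewrite ?exprn_ge0 //; apply: lerXn2r; rewrite ?nnegrE //.
- by rewrite addr_ge0 // mulr_ge0 // mulr_ge0 // ltW.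
- by rewrite lerD2l ler_wpM2l.
- by rewrite subr_ge0 (le_trans Qh).
- by rewrite lerD2l lerN2.
Qed.

(* Second moment bound for the number of vertices of A adjacent to a fresh vertex. *)
Lemma hit_prob_ge w A (q0 E : R) : (forall u, #|w u| = K) -> (0 < #|A|)%N -> 0 < q0 -> 0 <= E ->
  (forall S : {set 'I_P}, #|S| = K -> q0 <= E1 (fun T => (hit s S T)%:R)) ->
  {in A, forall u, \sum_(v in A | v != u) Z (w u) (w v) <= a * E} ->
  #|A|%:R * q0 ^+ 2 / a / (1 + #|A|%:R * a + E) <= hit_prob w A.
Proof.
move=> wK A0 q00 E0 q0le hZ.
set r : R := #|A|%:R; have r0 : 0 < r by rewrite ltr0n.
pose X T : R := \sum_(u in A) (hit s (w u) T)%:R.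
pose V := r * (a * (1 + r * a + E)).
have ra0 : 0 <= r * a by rewrite mulr_ge0 // ltW.
have V1 : 0 < 1 + r * a + E by lra.
have V0 : 0 < V by apply: mulr_gt0 => //; apply: mulr_gt0.
have -> : r * q0 ^+ 2 / a / (1 + r * a + E) = (r * q0) ^+ 2 / V.
  by rewrite /V; field; rewrite !gt_eqF //; lra.
apply: le_trans (second_moment mu_ge0 (X := X) _ _ V0 _) _.
- by rewrite mulr_gt0.
- rewrite Ex1_sum /r mulr_natl -sumr_const; apply: ler_sum => u _; exact: q0le.
- have -> : E1 (fun T => X T ^+ 2) =
     \sum_(u in A) \sum_(v in A) E1 (fun T => (hit s (w u) T && hit s (w v) T)%:R).
    under eq_bigr do rewrite -Ex1_sum.
    rewrite -Ex1_sum; apply: eq_Ex1 => T _; rewrite expr2 /X mulr_suml.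
    apply: eq_bigr => u _; rewrite mulr_sumr; apply: eq_bigr => v _.
    by rewrite -natrM mulnb.
  rewrite /V mulr_natl -sumr_const; apply: ler_sum => u uA.
  rewrite (bigD1 u) //= !mulrDr mulr1 -addrA lerD //.
    by under eq_Ex1 do rewrite andbb; apply: hit_le.
  apply: (@le_trans _ _ (\sum_(v in A | v != u) (a ^+ 2 + Z (w u) (w v)))).
    by apply: ler_sum => v _; apply: pair_hit_le.
  rewrite big_split /= lerD //; last exact: hZ.
  rewrite sumr_const mulrCA -expr2 -[_ *+ _]mulr_natl ler_wpM2r ?exprn_ge0 ?(ltW a_gt0) //.
  rewrite ler_nat; apply: subset_leq_card; apply/subsetP => v; rewrite unfold_in => /andP[].
  by [].
apply: Ex1_le => // T _; rewrite ler_nat /hits.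
case: (boolP [exists _ in _, _]) => [|/exists_inPn h]; first by case: (_ != _).
rewrite [X T](_ : _ = 0) ?eqxx // /X big1 // => u /h.
by case: (hit s (w u) T).
Qed.

Definition inter_le (M : nat) A w :=
  [forall u in A, forall v in A, (u != v) ==> (#|w u :&: w v| <= M)%N].

Lemma inter_leP M A w : reflect {in A &, forall u v, u != v -> #|w u :&: w v| <= M}%N (inter_le M A w).
Proof.
apply: (iffP forall_inP) => h u.
  by move=> v uA vA uv; have /forall_inP/(_ v vA)/implyP := h u uA; apply.
by move=> uA; apply/forall_inP => v vA; apply/implyP; apply: h.
Qed.

Lemma inter_Zsum M w A u : (forall u, #|w u| = K) -> inter_le M A w -> u \in A ->
  \sum_(v in A | v != u) Z (w u) (w v) <= a * (#|A|%:R * (M%:R * (s%:R / K%:R))).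
Proof.
move=> wK /inter_leP h1 uA.
have sa : 0 <= s%:R / K%:R * a by apply: mulr_ge0; [apply: divr_ge0 | apply: ltW].
apply: (@le_trans _ _ (\sum_(v in A | v != u) (M%:R * (s%:R / K%:R * a)))).
  apply: ler_sum => v /andP[vA vu].
  apply: le_trans (Zint_le R KP s1 sK _ (wK u)) _; rewrite ler_wpM2r // ler_nat.
  by apply: h1; rewrite // eq_sym.
have -> : a * (#|A|%:R * (M%:R * (s%:R / K%:R))) = #|A|%:R * (M%:R * (s%:R / K%:R * a)) by ring.
rewrite sumr_const -[_ *+ _]mulr_natl ler_wpM2r //; first exact: mulr_ge0.
rewrite ler_nat; apply: subset_leq_card; apply/subsetP => v; rewrite unfold_in => /andP[].
by [].
Qed.

(** Inherited by subsets ([good_sub]), so that one event about all vertices controls every candidate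
    cut; for each [A] it depends only on the item sets of [A]. *)
Definition good (M : nat) (D : R) w A :=
  inter_le M A w && [forall u in A, \sum_(v in A | v != u) Z (w u) (w v) <= a * D].

(** The second bound, which follows from the pairwise intersections alone, is the better one for
    small sets. *)
Definition Emin (M : nat) (D : R) (r : nat) : R := Num.min D (r%:R * (M%:R * (s%:R / K%:R))).

Lemma good_sub M D w (A B : {set 'I_n}) : A \subset B -> good M D w B -> good M D w A.
Proof.
move=> /subsetP AB /andP[/inter_leP h1 /forall_inP h2]; apply/andP; split.
  by apply/inter_leP => u v /AB uB /AB vB; apply: h1.
apply/forall_inP => u uA; apply: le_trans (h2 u (AB u uA)).
rewrite [leRHS](bigID (fun v => v \in A)) /= -[leLHS]addr0 lerD //.
  apply: eq_ler; apply: eq_bigl => v.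
  by case: (boolP (v \in A)) => [/AB ->|]; rewrite ?andbF ?andbT.
by apply: sumr_ge0 => *; apply: Zint_ge0.
Qed.

Lemma good_Emin M D w A u : (forall u, #|w u| = K) -> good M D w A -> u \in A ->
  \sum_(v in A | v != u) Z (w u) (w v) <= a * Emin M D #|A|.
Proof.
move=> wK /andP[h1 /forall_inP h2] uA; rewrite /Emin.
by case: (leP D) => _; [apply: h2 | apply: inter_Zsum].
Qed.

Lemma inter_le_mix M A w w' : inter_le M A (mix A w w') = inter_le M A w.
Proof.
apply: eq_forallb => u; case: (boolP (u \in A)) => //= uA; apply: eq_forallb => v.
by case: (boolP (v \in A)) => //= vA; rewrite !mix_in.
Qed.

Lemma good_mix M D A w w' : good M D (mix A w w') A = good M D w A.
Proof.
rewrite /good inter_le_mix; congr (_ && _); apply: eq_forallb => u.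
case: (boolP (u \in A)) => //= uA.
by congr (_ <= _); apply: eq_bigr => v /andP[vA _]; rewrite !mix_in.
Qed.

Definition Qlow (q0 : R) M D r := r%:R * q0 ^+ 2 / a / (1 + r%:R * a + Emin M D r).

(** The hypothesis on [mix] says that [F] depends only on the coordinates in [A]; [c] bounds the
    conditional probability of [G] given these. *)
Lemma Pr_cond_le A (F G : pred config) (c : R) :
  (forall w w', F (mix A w w') = F w) ->
  (forall w, (forall u, #|w u| = K) -> F w -> Pr mu (fun w' => G (mix A w w')) <= c) ->
  Pr mu (fun w => F w && G w) <= Pr mu F * c.
Proof.
move=> Fmix h; rewrite /Pr (Ex_mix mu_sum1 A) mulrC -ExZ; apply: Ex_le => // w wmu.
under (eq_Ex mu_ge0) => w' _ do rewrite Fmix.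
have wK u : #|w u| = K by apply: unif_neq0 (wmu u).
by have := h w wK; case: (F w) => [|_]; [rewrite mulr1; apply | rewrite mulr0 Ex_le_const].
Qed.

Lemma Pr_cond_ge A (F G : pred config) (c : R) :
  (forall w w', F (mix A w w') = F w) ->
  (forall w, (forall u, #|w u| = K) -> F w -> c <= Pr mu (fun w' => G (mix A w w'))) ->
  Pr mu F * c <= Pr mu (fun w => F w && G w).
Proof.
move=> Fmix h; rewrite /Pr [leRHS](Ex_mix mu_sum1 A) mulrC -ExZ; apply: Ex_le => // w wmu.
under [leRHS](eq_Ex mu_ge0) => w' _ do rewrite Fmix.
have wK u : #|w u| = K by apply: unif_neq0 (wmu u).
by have := h w wK; case: (F w) => [|_]; [rewrite mulr1; apply | rewrite mulr0 Ex_ge0].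
Qed.

Lemma hit_lower_le_a q0 :
  (forall S : {set 'I_P}, #|S| = K -> q0 <= E1 (fun T => (hit s S T)%:R)) -> q0 <= a.
Proof.
move=> q0le; rewrite -[q0](Ex1_const mu_sum1) -[leRHS](Ex1_const mu_sum1).
apply: Ex1_le => // S /unif_neq0 SK.
by apply: le_trans (q0le S SK) (hit_le R KP s SK).
Qed.

Lemma hit_lower_frac q0 E r : 0 <= E -> 0 < q0 -> q0 <= a ->
  0 <= r%:R * q0 ^+ 2 / a / (1 + r%:R * a + E) <= 1.
Proof.
move=> E0 q00 qa; have ra0 : 0 <= r%:R * a by rewrite mulr_ge0 // ltW.
have V1 : 0 < 1 + r%:R * a + E by lra.
apply/andP; split; first by rewrite !mulr_ge0 ?invr_ge0 ?exprn_ge0 ?(ltW a_gt0) ?(ltW q00) ?(ltW V1).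
rewrite ler_pdivrMr // mul1r ler_pdivrMr //.
apply: (@le_trans _ _ (r%:R * a * a)); last by rewrite ler_wpM2r ?(ltW a_gt0) //; lra.
by rewrite -mulrA ler_wpM2l // -expr2 lerXn2r ?nnegrE ?(ltW a_gt0) ?(ltW q00).
Qed.

(** * Union bounds over the candidate cuts of a given size *)

Section Cut.
Variables (k M : nat) (D q0 : R).
Hypotheses (D0 : 0 <= D) (q00 : 0 < q0).
Hypothesis q0le : forall S : {set 'I_P}, #|S| = K -> q0 <= E1 (fun T => (hit s S T)%:R).

Definition cut_bound r := few_bound r (Qlow q0 M D r) k.

Definition sparse w A := good M D w A && (#|nbhd (isg_adj s w) A| <= k)%N.

Lemma Emin_ge0 r : 0 <= Emin M D r.
Proof. by rewrite /Emin le_min D0 /= !mulr_ge0 // invr_ge0. Qed.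

Lemma Qlow_le1 r : Qlow q0 M D r <= 1.
Proof. by have /andP[] := hit_lower_frac r (Emin_ge0 r) q00 (hit_lower_le_a q0le). Qed.

Lemma cut_bound_ge0 r : 0 <= cut_bound r.
Proof.
have ra0 : 0 <= r%:R * a by rewrite mulr_ge0 // ltW.
apply: mulr_ge0; apply: exprn_ge0; last by rewrite subr_ge0 Qlow_le1.
by rewrite addr_ge0 // mulr_ge0.
Qed.

(* Conditioning on the item sets of A. *)
Lemma sparse_prob A (F : config -> bool) : (0 < #|A|)%N ->
  (forall w w', F (mix A w w') = F w) ->
  Pr mu (fun w => F w && sparse w A) <= Pr mu F * cut_bound #|A|.
Proof.
move=> A0 Fmix; apply: (@le_trans _ _ (Pr mu (fun w => F w && good M D w A) * cut_bound #|A|)).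
  apply: (@le_trans _ _ (Pr mu (fun w => F w && good M D w A && (#|nbhd (isg_adj s w) A| <= k)%N))).
    by apply: Pr_le => // w _; rewrite /sparse andbA.
  apply: (Pr_cond_le (A := A)) => [w w'|w wK /andP[_ g]]; first by rewrite Fmix good_mix.
  apply: few_nbhd => //; apply: hit_prob_ge => //; first exact: Emin_ge0.
  by move=> u uA; apply: good_Emin.
rewrite ler_wpM2r ?cut_bound_ge0 //.
by apply: Pr_le => // w _ /andP[].
Qed.

(** Induction on the last vertex: it occurs in no other edge, so, given all other item sets, it is
    joined to its parent with probability at most [a]. *)
Lemma tree_prob m (vtx : nat -> 'I_n) (par : nat -> nat) :
  {in gtn m.+1 &, injective vtx} -> (forall i, (i < m)%N -> (par i <= i)%N) ->
  Pr mu (fun w => all (fun i => hit s (w (vtx (par i))) (w (vtx i.+1))) (iota 0 m)) <= a ^+ m.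
Proof.
elim: m => [|m IH] inj lt; first by rewrite expr0 Pr_le1.
rewrite exprSr mulrC.
apply: le_trans (ler_wpM2l (ltW a_gt0) (IH _ _)); first last.
- by move=> i im; apply: lt; apply: ltnW.
- by move=> i j im jm; apply: inj; apply: ltnW.
rewrite /Pr (Ex_upd mu_ge0 mu_sum1 (vtx m.+1)) -ExZ; apply: Ex_le => // w wmu.
have wK u : #|w u| = K by apply: unif_neq0 (wmu u).
have updE T i : (i <= m)%N -> upd w (vtx m.+1) T (vtx i) = w (vtx i).
  move=> im; rewrite ffunE; case: eqP => // e.
  have : i = m.+1 by apply: inj e; rewrite inE; lia.
  lia.
have -> : E1 (fun T => (all (fun i => hit s (upd w (vtx m.+1) T (vtx (par i)))
    (upd w (vtx m.+1) T (vtx i.+1))) (iota 0 m.+1))%:R) =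
   (all (fun i => hit s (w (vtx (par i))) (w (vtx i.+1))) (iota 0 m))%:R *
     E1 (fun T => (hit s (w (vtx (par m))) T)%:R).
  rewrite -Ex1Z; apply: eq_Ex1 => T _; rewrite -natrM mulnb -[X in iota _ X]addn1 iotaD all_cat /= andbT add0n.
  congr (_ && _)%:R; last by rewrite updE ?lt // ffunE eqxx.
  apply: eq_in_all => i; rewrite mem_iota => /andP[_ im].
  by rewrite !updE //; apply: leq_trans (lt i _) _; lia.
by rewrite mulrC ler_wpM2r // hit_le.
Qed.

(** Union bound over breadth-first data: the listed vertices and the sorted parent positions. The
    tree event depends only on the item sets of the cut, hence multiplies the conditional bound of
    [sparse_prob]. *)
Lemma connected_cut_prob r : (0 < r)%N ->
  Pr mu (fun w => [exists A : {set 'I_n}, [&& #|A| == r, connected_on (isg_adj s w) A & sparse w A]])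
  <= (4 ^ r.-1)%:R * n%:R ^+ r * a ^+ r.-1 * cut_bound r.
Proof.
case: r => // m _.
pose J := (m.+1.-tuple 'I_n * m.-tuple 'I_m.+1)%type.
pose Q (j : J) := [&& uniq j.1, sorted leq (map val j.2) &
   [forall i : 'I_m, tnth j.2 i <= i]%N].
pose tree (j : J) w := [forall i : 'I_m, hit s (w (tnth j.1 (tnth j.2 i))) (w (tnth j.1 (lift ord0 i)))].
pose F (j : J) w := tree j w && sparse w [set u in j.1].
apply: le_trans (_ : _ <= \sum_(j | Q j) Pr mu (F j)) _.
  apply: Pr_exists => // w _ /existsP[A /and3P[/eqP Am Ac As]].
  have [x0 x0A] : exists x0, x0 \in A by apply/card_gt0P; rewrite Am.
  have [v [p [vA uv sz so h]]] := bfs_order Ac x0A.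
  have szv : size v = m.+1 by rewrite -Am -(card_uniqP uv); apply: eq_card.
  have szp : size p = m by move: szv; rewrite sz => -[].
  have pim i : (i < size p)%N -> (nth 0%N p i < m.+1)%N.
    by move=> ip; have [pi _] := h i ip; apply: leq_ltn_trans pi _; rewrite ltnS -szp ltnW.
  have szv' : size v == m.+1 by rewrite szv.
  have szp' : size (map (@inord m) p) == m by rewrite size_map szp.
  have valp : map val (map (@inord m) p) = p.
    rewrite -map_comp map_id_in // => y /nthP - /(_ 0%N)[i ip <-] /=.
    by rewrite inordK // pim.
  exists (Tuple szv', Tuple szp').
    apply/and3P; split; rewrite //= ?valp //; apply/forallP => i.
    have ip : (i < size p)%N by rewrite szp.
    by rewrite (tnth_nth ord0) /= (nth_map 0%N) // inordK ?pim //; have [] := h i ip.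
  have eA : [set u in v] = A by apply/setP => u; rewrite inE vA.
  rewrite /F /= eA As andbT; apply/forallP => i.
  have ip : (i < size p)%N by rewrite szp.
  have [pi] := h i ip; rewrite /isg_adj => /andP[_].
  by rewrite !(tnth_nth x0) /= (tnth_nth ord0) /= (nth_map 0%N) // inordK ?pim.
have PrF j : Q j -> Pr mu (F j) <= a ^+ m * cut_bound m.+1.
  move=> /and3P[uj so /forallP lt].
  have cA : #|[set u in j.1]| = m.+1 by rewrite cardsE (card_uniqP uj) size_tuple.
  rewrite -cA; apply: le_trans (sparse_prob _ _) _; first by rewrite cA.
    move=> w w'; apply: eq_forallb => i.
    by rewrite !mix_in // inE mem_tnth.
  rewrite ler_wpM2r ?cut_bound_ge0 //.
  pose x0 := tnth j.1 ord0.
  apply: le_trans (tree_prob (vtx := nth x0 j.1) (par := nth 0%N (map val j.2)) (m := m) _ _).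
  - apply: Pr_le => // w _ /forallP h; apply/allP => i; rewrite mem_iota add0n => /andP[_ im].
    have := h (Ordinal im); rewrite !(tnth_nth x0) /= (tnth_nth ord0) /=.
    by rewrite (nth_map ord0) ?size_tuple.
  - move=> i i' im im' e; apply/eqP; rewrite -(nth_uniq x0 _ _ uj) ?size_tuple //.
    exact/eqP.
  - move=> i im; have := lt (Ordinal im); rewrite (tnth_nth ord0) /=.
    by rewrite (nth_map ord0) ?size_tuple.
apply: le_trans (ler_sum _ PrF) _.
rewrite sumr_const -[_ *+ _]mulr_natl -[leRHS]mulrA ler_wpM2r //.
  by rewrite mulr_ge0 ?cut_bound_ge0 // exprn_ge0 // ltW.
rewrite -natrX -natrM ler_nat.
apply: (@leq_trans #|setX [set: m.+1.-tuple 'I_n] [set t : m.-tuple 'I_m.+1 | sorted leq (map val t)]|).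
  apply: subset_leq_card; apply/subsetP => -[v p]; rewrite unfold_in => /and3P[_ so _].
  by rewrite !inE.
(* There are C(2m, m) sorted parent tuples, at most the number 4^m of subsets of a set of size
   2m. *)
rewrite cardsX cardsT card_tuple card_ord card_sorted_tuples mulnC leq_mul2r.
apply/orP; right; rewrite (_ : 4 = 2 ^ 2)%N // -expnM mul2n -addnn.
by rewrite -[X in 'C(X, _)]card_ord -card_draws -[X in (_ <= 2 ^ X)%N]card_ord -cardsT -card_powerset subset_leq_card //;
  apply/subsetP => B _; rewrite powersetE subsetT.
Qed.

(** For large sets the conditional bound is strong enough to forgo connectivity and sum over all
    subsets. *)
Lemma cut_prob r : (0 < r)%N ->
  Pr mu (fun w => [exists A : {set 'I_n}, (#|A| == r) && sparse w A])
  <= (2 ^ n)%:R * cut_bound r.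
Proof.
move=> r0.
apply: le_trans (_ : _ <= \sum_(A : {set 'I_n} | #|A| == r) Pr mu (fun w => sparse w A)) _.
  by apply: Pr_exists => // w _ /existsP[A /andP[Ar As]]; exists A.
apply: le_trans (_ : _ <= \sum_(A : {set 'I_n} | #|A| == r) cut_bound r) _.
  apply: ler_sum => A /eqP Ar; rewrite -Ar.
  have := @sparse_prob A xpredT; rewrite Ar => /(_ r0 (fun _ _ => erefl)) h.
  apply: le_trans h _; rewrite -[leRHS]mul1r ler_wpM2r ?cut_bound_ge0 //; exact: Pr_le1.
rewrite sumr_const -[_ *+ _]mulr_natl ler_wpM2r ?cut_bound_ge0 // ler_nat.
rewrite -[X in (_ <= 2 ^ X)%N]card_ord -cardsT -card_powerset subset_leq_card //.
by apply/subsetP => B _; rewrite powersetE subsetT.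
Qed.

End Cut.
End Isg.

(** * Vertices of small degree *)

Section MinDegree.
Variables (R : realFieldType) (n P K s : nat).
Hypotheses (KP : (K <= P)%N) (s1 : (1 <= s)%N) (sK : (s <= K)%N).
Local Notation config := {ffun 'I_n -> {set 'I_P}}.
Implicit Types (w : config) (A U : {set 'I_n}) (T : {set 'I_P}).
Local Notation mu := (unif_subset R K).
Local Notation E1 := (Ex1 mu).
Local Notation a := (edge_rate R P K s).
Local Notation x := (K%:R ^+ 2 / P%:R : R).
Local Notation Z := (Zint R K s).
Local Notation few_bound := (few_bound n P K s).

Let mu_ge0 := @unif_ge0 R P K.
Let mu_sum1 := unif_sum1 R KP.
Let a_gt0 : 0 < a := edge_rate_gt0 R KP s1 sK.
Let x_ge0 : 0 <= x. Proof. by rewrite divr_ge0 ?exprn_ge0. Qed.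

Lemma pair_inter_prob u v i : u != v -> Pr mu (fun w => (i <= #|w u :&: w v|)%N) <= x ^+ i.
Proof.
move=> uv; rewrite /Pr (Ex_coord2 mu_ge0 mu_sum1 (fun S T => (i <= #|S :&: T|)%:R) uv).
apply: Ex1_le_const => // S /unif_neq0 SK.
apply: (@le_trans _ _ (x ^+ i / i`!%:R)).
  by apply: le_trans (inter_card_tail_le R KP i SK); apply: Ex1_le => // T _; rewrite setIC.
rewrite ler_pdivrMr ?ltr0n ?fact_gt0 // ler_peMr ?exprn_ge0 //.
by rewrite ler1n fact_gt0.
Qed.

Lemma inter_le_prob M U : Pr mu (fun w => ~~ inter_le M U w) <= (#|U| ^ 2)%:R * x ^+ M.+1.
Proof.
apply: (@le_trans _ _ (\sum_(p in setX U U | p.1 != p.2) Pr mu (fun w => (M < #|w p.1 :&: w p.2|)%N))).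
  apply: Pr_exists => // w _; rewrite negb_forall_in => /exists_inP[u uU].
  rewrite negb_forall_in => /exists_inP[v vU]; rewrite negb_imply -ltnNge => /andP[uv h].
  by exists (u, v); rewrite // inE uU vU.
apply: (@le_trans _ _ (\sum_(p in setX U U | p.1 != p.2) x ^+ M.+1)).
  by apply: ler_sum => p /andP[_ uv]; apply: pair_inter_prob.
rewrite sumr_const -[_ *+ _]mulr_natl ler_wpM2r ?exprn_ge0 // ler_nat -mulnn -cardsX.
apply: subset_leq_card; apply/subsetP => p; rewrite unfold_in => /andP[].
by [].
Qed.

Definition low_deg m w u := (#|[set v | isg_adj s w u v]| <= m)%N.

(** Edges inside [U] are ignored, which makes the conditional law given the item sets of [U] a
    product. When these sets are disjoint there are no such edges and nothing is lost. *)
Definition few_out m U w := [forall u in U, (#|[set v in ~: U | hit s (w u) (w v)]| <= m)%N].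

Lemma low_deg_few_out m U w : [forall u in U, low_deg m w u] -> few_out m U w.
Proof.
move=> /forall_inP h; apply/forall_inP => u uU; apply: leq_trans (h u uU).
apply: subset_leq_card; apply/subsetP => v; rewrite !inE => /andP[vU uv].
by rewrite /isg_adj; move: uv; rewrite /hit => ->; rewrite andbT; apply: contraNneq vU => <-.
Qed.

Lemma few_out_nbhd m U w : few_out m U w -> (#|nbhd (isg_adj s w) U| <= #|U| * m)%N.
Proof.
move=> /forall_inP h.
apply: (@leq_trans #|\bigcup_(u in U) [set v in ~: U | hit s (w u) (w v)]|).
  apply: subset_leq_card; apply/subsetP => v; rewrite !inE => /andP[vU /exists_inP[u uU uv]].
  apply/bigcupP; exists u => //; rewrite !inE vU.
  by case/andP: uv.
rewrite -sum_nat_const.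
elim/big_rec2: _ => [|u y B uU le]; first by rewrite cards0.
by rewrite cardsU; apply: leq_trans (leq_subr _ _) _; rewrite leq_add // h.
Qed.

(* Lower bound for the hitting probability of r sets whose pairwise intersections have at most M elements. *)
Definition Qint (q0 : R) M r := r%:R * q0 ^+ 2 / a / (1 + r%:R * a + r%:R * (M%:R * (s%:R / K%:R))).

(** * Low degree at all vertices of a fixed set *)

Section Fixed.
Variables (q0 : R) (U : {set 'I_n}).
Hypothesis q00 : 0 < q0.
Hypothesis q0le : forall S : {set 'I_P}, #|S| = K -> q0 <= E1 (fun T => (hit s S T)%:R).
Hypothesis U0 : (0 < #|U|)%N.
Local Notation j := #|U|.

Lemma Qint_le w M : (forall u, #|w u| = K) -> inter_le M U w -> Qint q0 M j <= hit_prob R K s w U.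
Proof.
move=> wK wM; apply: hit_prob_ge => //; first by rewrite !mulr_ge0 ?invr_ge0.
by move=> u uU; apply: inter_Zsum.
Qed.

Definition vtx (i : 'I_#|U|) := enum_val i.

Lemma hitsE w T : hits s w U T = [exists i, hit s (w (vtx i)) T].
Proof.
apply/exists_inP/existsP => [[u uU h]|[i h]].
  by exists (enum_rank_in uU u); rewrite /vtx enum_rankK_in.
by exists (vtx i); rewrite ?enum_valP.
Qed.

Lemma few_outE m w w' : few_out m U (mix U w w') =
  [forall i, (#|[set v in ~: U | hit s (w (vtx i)) (w' v)]| <= m)%N].
Proof.
have e u : u \in U -> [set v in ~: U | hit s (mix U w w' u) (mix U w w' v)] =
    [set v in ~: U | hit s (w u) (w' v)].
  move=> uU; apply/setP => v; rewrite !inE; case: (boolP (v \in U)) => //= vU.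
  by rewrite mix_in // mix_out.
apply/forall_inP/forallP => h.
  by move=> i; rewrite -e ?enum_valP //; apply: h; apply: enum_valP.
move=> u uU; rewrite e //.
by have := h (enum_rank_in uU u); rewrite /vtx enum_rankK_in.
Qed.

Lemma vtx_disjoint w : inter_le 0 U w ->
  {in [set: 'I_#|U|] &, forall i i', i != i' -> [disjoint w (vtx i) & w (vtx i')]}.
Proof.
move=> /inter_leP h i i' _ _ ii'; rewrite -setI_eq0 -cards_eq0 -leqn0.
by apply: h; rewrite ?enum_valP // (inj_eq enum_val_inj).
Qed.

(** Union bound over the exact outside neighbourhoods [B i], each of size at most [m]. By
    disjointness a vertex in several [B i] costs one factor [a] for each; a vertex outside their
    union [C] hits nothing, with probability at most 1 - Q, and [C] has at most j m elements. The
    sum over [B] then factors over [U]. *)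
Lemma few_out_prob m w Q : (forall u, #|w u| = K) -> inter_le 0 U w -> 0 <= Q -> Q <= hit_prob R K s w U ->
  Pr mu (fun w' => few_out m U (mix U w w')) <=
    (\sum_(d < m.+1) (n%:R * a) ^+ d / d`!%:R) ^+ j * (1 - Q) ^+ (n - j - j * m).
Proof.
move=> wK dis Q0 hQ.
have /andP[h0 h1] := hit_prob01 R s KP w U.
have Q1 : 0 <= 1 - Q by rewrite subr_ge0 (le_trans hQ).
have Q2 : 1 - hit_prob R K s w U <= 1 - Q by rewrite lerD2l lerN2.
pose F (B : {ffun 'I_#|U| -> {set 'I_n}}) (w' : config) :=
  [forall v in ~: U, [forall i, hit s (w (vtx i)) (w' v) == (v \in B i)]].
pose ok (B : {ffun 'I_#|U| -> {set 'I_n}}) := [forall i, (B i \subset ~: U) && (#|B i| <= m)%N].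
apply: (@le_trans _ _ (\sum_(B | ok B) Pr mu (F B))).
  apply: Pr_exists => // w' _; rewrite few_outE => /forallP h.
  exists [ffun i => [set v in ~: U | hit s (w (vtx i)) (w' v)]].
    apply/forallP => i; rewrite ffunE h andbT.
    by apply/subsetP => v; rewrite !inE => /andP[].
  by apply/forall_inP => v vU; apply/forallP => i; rewrite ffunE inE vU.
have PrF B : ok B -> Pr mu (F B) <= (\prod_i a ^+ #|B i|) * (1 - Q) ^+ (n - j - j * m).
  move=> /forallP okB.
  have BU i : B i \subset ~: U by have /andP[] := okB i.
  rewrite (Pr_forall_in mu_ge0 mu_sum1 _ (fun v T => [forall i, hit s (w (vtx i)) T == (v \in B i)])).
  pose C := \bigcup_i B i.
  have CU : C \subset ~: U by apply/bigcupsP => i _.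
  apply: (@le_trans _ _ (\prod_(v in ~: U) (\prod_i (if v \in B i then a else 1) * (if v \in C then 1 else 1 - Q)))).
    apply: ler_prod => v vU; apply/andP; split; first exact: Ex1_ge0.
    case: (boolP (v \in C)) => vC.
      rewrite mulr1 -big_mkcond -[X in _ <= X](_ : a ^+ #|[set i | v \in B i]| = _); last first.
        by rewrite -prodr_const; apply: eq_bigl => i; rewrite inE.
      apply: le_trans (hit_family_le R KP s (X := [set i | v \in B i]) (S := fun i => w (vtx i)) _ _).
      - apply: Ex1_le => // T _; rewrite ler_nat.
        case: (boolP [forall i, _]) => //= /forallP hT.
        by rewrite lt0b; apply/forall_inP => i; rewrite inE => vi; have := hT i; rewrite vi eqb_id.
      - by move=> i _; rewrite wK.
      - by move=> i i' _ _; apply: vtx_disjoint.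
    rewrite big1 => [|i _]; last by rewrite ifN //; apply: contra vC => vi; apply/bigcupP; exists i.
    rewrite mul1r; apply: le_trans Q2; rewrite -[X in X - _](Ex1_const mu_sum1) -Ex1B.
    apply: Ex1_le => // T _; rewrite hitsE.
    case: (boolP [forall i, _]) => [/forallP hT|_]; last by rewrite subr_ge0 lern1 leq_b1.
    case: (boolP [exists i, _]) => [/existsP[i hi]|_]; last by rewrite subr0.
    have := hT i; rewrite hi eq_sym eqb_id => vi.
    by case/negP: vC; apply/bigcupP; exists i.
  rewrite big_split /=; apply: ler_pM.
  - by apply: prodr_ge0 => v _; apply: prodr_ge0 => i _; case: ifP => // _; apply: ltW.
  - by apply: prodr_ge0 => v _; case: ifP.
  - rewrite exchange_big /=; apply: eq_ler; apply: eq_bigr => i _.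
    rewrite -big_mkcondr -prodr_const; apply: eq_bigl => v.
    by case: (boolP (v \in B i)) => [/(subsetP (BU i)) ->|]; rewrite ?andbF.
  - rewrite (eq_bigr (fun v => if v \notin C then 1 - Q else 1)); last by move=> v _; case: (v \in C).
    rewrite -big_mkcondr (eq_bigl (mem (~: U :\: C))); last by move=> v; rewrite !inE andbC.
    rewrite prodr_const; apply: ler_wiXn2l => //; first by rewrite lerBlDr lerDl.
    rewrite cardsD (setIidPr CU) cardsCs setCK card_ord leq_sub2l //.
    rewrite -[X in (_ <= X * _)%N]card_ord -sum_nat_const /C.
    elim/big_rec2: _ => [|i y D _ le]; first by rewrite cards0.
    rewrite cardsU; apply: leq_trans (leq_subr _ _) _; rewrite leq_add //.
    by have /andP[] := okB i.
apply: le_trans (ler_sum _ PrF) _.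
rewrite -mulr_suml ler_wpM2r ?exprn_ge0 //.
apply: (@le_trans _ _ (\sum_(B in ffun_on (fun S : {set 'I_n} => (#|S| <= m)%N)) \prod_(i < j) a ^+ #|B i|)).
  rewrite [leRHS]big_mkcond [leLHS]big_mkcond; apply: ler_sum => B _.
  have pr0 : 0 <= \prod_i a ^+ #|B i| by apply: prodr_ge0 => i _; rewrite exprn_ge0 // ltW.
  case: ifP => [/forallP hB|_]; last by case: ifP.
  by rewrite ifT //; apply/ffun_onP => i; have /andP[] := hB i.
rewrite -(bigA_distr_big (fun S : {set 'I_n} => (#|S| <= m)%N) (fun _ S => a ^+ #|S|)).
rewrite prodr_const card_ord lerXn2r ?nnegrE //.
- by apply: sumr_ge0 => S _; rewrite exprn_ge0 // ltW.
- by apply: sumr_ge0 => d _; rewrite divr_ge0 // exprn_ge0 // mulr_ge0 // ltW.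
rewrite sum_small_sets card_ord; apply: ler_sum => d _.
rewrite ler_pdivlMr ?ltr0n ?fact_gt0 // mulrAC -natrM bin_ffact [leRHS]exprMn ler_wpM2r ?exprn_ge0 ?(ltW a_gt0) //.
by rewrite -natrX ler_nat ffact_leq_expn.
Qed.

(** Only configurations with pairwise disjoint outside neighbourhoods of size exactly [m] are
    counted. An injection [f] labels them: [f (i, l)] hits the item set of [vtx i] and no other, and
    vertices outside the image hit none. *)
Lemma few_out_prob_ge m w : (forall u, #|w u| = K) -> inter_le 0 U w ->
  0 <= q0 - j%:R * a ^+ 2 -> j%:R * a <= 1 ->
  ((n - j) ^_ (j * m))%:R / (m`! ^ j)%:R * (q0 - j%:R * a ^+ 2) ^+ (j * m) * (1 - j%:R * a) ^+ n
  <= Pr mu (fun w' => few_out m U (mix U w w')).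
Proof.
move=> wK dis q1 ja1.
have /andP[h0 h1] := hit_prob01 R s KP w U.
have j0 : 0 <= 1 - j%:R * a by rewrite subr_ge0.
pose J := {ffun 'I_#|U| * 'I_m -> 'I_n}.
pose F (f : J) (w' : config) :=
  [forall v in ~: U, [forall i, hit s (w (vtx i)) (w' v) == [exists l, f (i, l) == v]]].
pose ok := [set f : J in ffun_on (mem (~: U)) | injectiveb f].
have card_ok : #|ok| = ((n - j) ^_ (j * m))%N.
  have cU : #|~: U| = (n - j)%N by rewrite cardsCs setCK card_ord.
  by rewrite card_inj_ffuns_on card_prod !card_ord cU.
(* The neighbourhoods [N i] determine [f] up to a permutation of each, so a configuration is counted
   at most m!^j times. *)
have upper : \sum_(f in ok) Pr mu (F f) <= (m`! ^ j)%:R * Pr mu (fun w' => few_out m U (mix U w w')).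
  rewrite -Ex_sum -ExZ; apply: Ex_le => // w' _.
  rewrite -natr_sum -natrM ler_nat few_outE.
  pose N i := [set v in ~: U | hit s (w (vtx i)) (w' v)].
  pose S := [set f in ok | F f w'].
  have -> : (\sum_(f in ok) F f w')%N = #|S|.
    rewrite -[RHS]sum1_card big_mkcond [RHS]big_mkcond; apply: eq_bigr => f _.
    by rewrite [f \in S]inE; case: (f \in ok); case: (F f w').
  have SN f : f \in S -> forall i, N i = [set f (i, l) | l : 'I_m].
    rewrite !inE => /andP[/andP[/ffun_onP fU _] /forall_inP Ff] i; apply/setP => v.
    rewrite !inE; apply/andP/imsetP => [[vU]|[l _ ->]].
      have /forallP/(_ i)/eqP -> := Ff v (ltac:(by rewrite inE)).
      by case/existsP => l /eqP <-; exists l.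
    have vU := fU (i, l); rewrite inE in vU; split=> //.
    have /forallP/(_ i)/eqP -> := Ff _ (fU (i, l)).
    by apply/existsP; exists l.
  have finj f : f \in S -> injective f by rewrite !inE => /andP[/andP[_ /injectiveP]].
  have [->|/set0Pn[f0 f0S]] := eqVneq S set0; first by rewrite cards0.
  have cardN i : #|N i| = m.
    rewrite (SN f0 f0S) card_imset ?card_ord // => l l' /(finj _ f0S) [] //.
  have -> : [forall i, (#|N i| <= m)%N] by apply/forallP => i; rewrite cardN.
  rewrite muln1.
  pose cur (f : J) : {ffun 'I_#|U| -> {ffun 'I_m -> 'I_n}} := [ffun i => [ffun l => f (i, l)]].
  have cur_inj : injective cur.
    move=> f g /ffunP e; apply/ffunP => -[i l].
    by have /ffunP/(_ l) := e i; rewrite !ffunE.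
  pose QQ i : pred {ffun 'I_m -> 'I_n} := fun g => g \in [set g in ffun_on (mem (N i)) | injectiveb g].
  rewrite -(card_imset _ cur_inj).
  apply: (@leq_trans #|family QQ|).
    apply: subset_leq_card; apply/subsetP => g /imsetP[f fS ->].
    apply/familyP => i; rewrite /QQ unfold_in inE ffunE; apply/andP; split.
      by apply/ffun_onP => l; rewrite ffunE /= (SN f fS); apply: imset_f.
    by apply/injectiveP => l l'; rewrite !ffunE => /(finj _ fS) [].
  rewrite -[X in (X <= _)%N]sum1_card (eq_bigr (fun g : {ffun 'I_#|U| -> {ffun 'I_m -> 'I_n}} => \prod_(i < j) 1)%N); last by move=> g _; rewrite big1.
  rewrite -(bigA_distr_big_dep QQ (fun _ _ => 1%N)).
  rewrite (eq_bigr (fun=> m`!)) ?prod_nat_const ?card_ord // => i _.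
  by rewrite sum1_card /QQ card_inj_ffuns_on card_ord cardN ffactnn.
have lower f : f \in ok -> (q0 - j%:R * a ^+ 2) ^+ (j * m) * (1 - j%:R * a) ^+ n <= Pr mu (F f).
  rewrite inE => /andP[/ffun_onP fU /injectiveP finj].
  rewrite (Pr_forall_in mu_ge0 mu_sum1 _ (fun v T => [forall i, hit s (w (vtx i)) T == [exists l, f (i, l) == v]])).
  pose C := [set f p | p in [set: 'I_#|U| * 'I_m]].
  have CU : C \subset ~: U by apply/subsetP => v /imsetP[p _ ->]; apply: fU.
  have cC : #|C| = (j * m)%N by rewrite card_imset // cardsT card_prod !card_ord.
  apply: (@le_trans _ _ (\prod_(v in ~: U) (if v \in C then q0 - j%:R * a ^+ 2 else 1 - j%:R * a))).
    rewrite (bigID (mem C)) /=.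
    rewrite (eq_bigl (mem C)) => [|v]; last first.
      by apply/andP/idP => [[]//|vC]; split => //; apply: (subsetP CU).
    rewrite (eq_bigr (fun=> q0 - j%:R * a ^+ 2)); last by move=> v /= ->.
    rewrite prodr_const cC ler_wpM2l ?exprn_ge0 //.
    rewrite (eq_bigl (mem (~: U :\: C))); last by move=> v; rewrite !inE andbC.
    rewrite (eq_bigr (fun=> 1 - j%:R * a)); last by move=> v; rewrite !inE => /andP[/negbTE ->].
    rewrite prodr_const; apply: ler_wiXn2l => //.
      by rewrite lerBlDr lerDl mulr_ge0 // ltW.
    by rewrite -[leqRHS]card_ord max_card.
  apply: ler_prod => v vU; apply/andP; split; first by case: ifP.
  (* From the event of hitting [vtx i0] the double hits are subtracted; each costs at most a^2, as
     [Zint] vanishes for disjoint item sets. *)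
  case: (boolP (v \in C)) => [/imsetP[[i0 l0] _ vE]|vC].
    have ex i : [exists l, f (i, l) == v] = (i == i0).
      apply/existsP/eqP => [[l /eqP]|->]; last by exists l0; rewrite vE.
      by rewrite vE => /finj [].
    apply: (@le_trans _ _ (E1 (fun T => (hit s (w (vtx i0)) T)%:R) -
        \sum_(i | i != i0) E1 (fun T => (hit s (w (vtx i)) T && hit s (w (vtx i0)) T)%:R))).
      apply: lerB; first exact: q0le.
      apply: (@le_trans _ _ (\sum_(i | i != i0) a ^+ 2)).
        apply: ler_sum => i ii0; apply: le_trans (pair_hit_le R KP s (wK _) (wK _)) _.
        rewrite gerDl; apply: le_trans (Zint_le R KP s1 sK _ (wK _)) _.
        have /eqP : #|w (vtx i) :&: w (vtx i0)| == 0%N.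
          by rewrite cards_eq0 setI_eq0 vtx_disjoint ?inE.
        by move=> ->; rewrite mul0r.
      rewrite sumr_const -[_ *+ _]mulr_natl ler_wpM2r ?exprn_ge0 ?(ltW a_gt0) // ler_nat.
      by rewrite -[leqRHS]card_ord max_card.
    rewrite -Ex1_sum -Ex1B; apply: Ex1_le => // T _.
    case: (boolP (hit s (w (vtx i0)) T)) => h /=; last first.
      by apply: (@le_trans _ _ 0); rewrite // sub0r oppr_le0 sumr_ge0.
    case: (boolP [forall i, _]) => [_|]; first by rewrite lerBlDr lerDl sumr_ge0.
    rewrite negb_forall => /existsP[i]; rewrite ex.
    have [->|ii0] := eqVneq i i0; first by rewrite h.
    rewrite eqbF_neg negbK => hi; rewrite (bigD1 i) //= hi /=.
    by rewrite opprD addrA subrr sub0r oppr_le0 sumr_ge0.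
  have ex i : [exists l, f (i, l) == v] = false.
    apply/existsP => -[l /eqP e]; case/negP: vC; apply/imsetP; exists (i, l) => //.
  apply: (@le_trans _ _ (1 - hit_prob R K s w U)).
    by rewrite lerD2l lerN2 hit_prob_le.
  rewrite -[X in X - _](Ex1_const mu_sum1) -Ex1B; apply: Ex1_le => // T _; rewrite hitsE.
  case: (boolP [exists i, _]) => [_|/existsPn h]; first by rewrite subrr.
  by rewrite subr0 ler1n lt0b; apply/forallP => i; rewrite ex eqbF_neg h.
set c : R := (_ ^_ _)%:R; set d : R := (_ ^ _)%:R; set y := _ ^+ (_ * _); set z := _ ^+ n.
have -> : c / d * y * z = c * (y * z) / d by ring.
rewrite ler_pdivrMr ?ltr0n ?expn_gt0 ?fact_gt0 // [_ * d]mulrC.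
apply: le_trans upper; rewrite /c -card_ok mulr_natl -sumr_const.
exact: ler_sum.
Qed.

(** The three terms: some two item sets in [U] share more than [M] items; they intersect, but in at
    most [M] items; they are disjoint. The last one is the main term. In the second the hitting
    probability is known less precisely, and the factor x compensates. *)
Theorem low_deg_prob_le m M :
  Pr mu (fun w => [forall u in U, low_deg m w u]) <=
   (j ^ 2)%:R * x ^+ M.+1 + (j ^ 2)%:R * x * few_bound j (Qint q0 M j) (j * m)
   + (\sum_(d < m.+1) (n%:R * a) ^+ d / d`!%:R) ^+ j * (1 - Qint q0 0 j) ^+ (n - j - j * m).
Proof.
have sK0 : 0 <= M%:R * (s%:R / K%:R) :> R by rewrite mulr_ge0 // divr_ge0.
have /andP[QM0 QM1] : 0 <= Qint q0 M j <= 1.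
  by apply: hit_lower_frac => //; [rewrite mulr_ge0 | apply: (hit_lower_le_a KP q0le)].
have /andP[Q00 Q01] : 0 <= Qint q0 0 j <= 1.
  apply: hit_lower_frac => //; [by rewrite mul0r mulr0 | exact: (hit_lower_le_a KP q0le)].
apply: (@le_trans _ _ (Pr mu (fun w => ~~ inter_le M U w) +
   Pr mu (fun w => (inter_le M U w && ~~ inter_le 0 U w) && few_out m U w) +
   Pr mu (fun w => inter_le 0 U w && few_out m U w))).
  rewrite /Pr -!ExD; apply: Ex_le => // w _; rewrite -!natrD ler_nat.
  have := @low_deg_few_out m U w.
  case: [forall _ in _, _] => // /(_ isT) ->.
  by case: (inter_le M U w); case: (inter_le 0 U w).
apply: lerD; first apply: lerD; first exact: inter_le_prob.
- apply: (@le_trans _ _ (Pr mu (fun w => inter_le M U w && ~~ inter_le 0 U w) * few_bound j (Qint q0 M j) (j * m))).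
    apply: (Pr_cond_le KP (A := U)) => [w w'|w wK /andP[wM _]]; first by rewrite !inter_le_mix.
    apply: le_trans (few_nbhd KP s1 sK _ wK (Qint_le wK wM)).
    by apply: Pr_le => // w' _; apply: few_out_nbhd.
  rewrite ler_wpM2r //.
    have ja0 : 0 <= j%:R * a by rewrite mulr_ge0 // ltW.
    by rewrite /few_bound mulr_ge0 ?exprn_ge0 ?subr_ge0 // addr_ge0 // mulr_ge0.
  rewrite -[x]expr1; apply: le_trans (inter_le_prob 0 U).
  by apply: Pr_le => // w _ /andP[].
- set c := (X in _ <= X); have c0 : 0 <= c.
    rewrite mulr_ge0 ?exprn_ge0 ?subr_ge0 //.
    by apply: sumr_ge0 => d _; rewrite divr_ge0 // exprn_ge0 // mulr_ge0 // ltW.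
  apply: le_trans (Pr_cond_le KP (A := U) (G := few_out m U) (c := c) _ _) _.
  - exact: inter_le_mix.
  - by move=> w wK w0; apply: few_out_prob => //; apply: Qint_le.
  - by rewrite ler_piMl // Pr_le1.
Qed.

(** Only disjoint item sets on [U] are counted; then [few_out] is the same as low degree. *)
Theorem low_deg_prob_ge m :
  0 <= q0 - j%:R * a ^+ 2 -> j%:R * a <= 1 ->
  (1 - (j ^ 2)%:R * x) * (((n - j) ^_ (j * m))%:R / (m`! ^ j)%:R * (q0 - j%:R * a ^+ 2) ^+ (j * m) * (1 - j%:R * a) ^+ n)
  <= Pr mu (fun w => [forall u in U, low_deg m w u]).
Proof.
move=> q1 ja1; set h := (X in _ * X).
have h0 : 0 <= h.
  by rewrite /h !mulr_ge0 ?invr_ge0 ?exprn_ge0 // subr_ge0.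
apply: (@le_trans _ _ (Pr mu (fun w => inter_le 0 U w && few_out m U w))); last first.
  apply: Pr_le => // w wmu /andP[/inter_leP w0 /forall_inP few]; apply/forall_inP => u uU.
  apply: leq_trans (few u uU); apply: subset_leq_card; apply/subsetP => v.
  rewrite !inE => /andP[uv huv]; rewrite /hit huv andbT; apply/negP => vU.
  by have := w0 u v uU vU uv; rewrite leqNgt (leq_trans s1 huv).
apply: le_trans (Pr_cond_ge KP (A := U) (c := h) _ _).
- rewrite ler_wpM2r //.
  have := inter_le_prob 0 U; rewrite (PrC mu_ge0 mu_sum1) expr1; lra.
- exact: inter_le_mix.
- by move=> w wK w0; apply: few_out_prob_ge.
Qed.

End Fixed.
End MinDegree.

(** * Bounds at fixed n *)

From mathcomp Require Import reals sequences exp.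

(** * Bonferroni's inequalities *)

Lemma alternating_bin (R : pzRingType) w N :
  \sum_(i < N.+1) (-1) ^+ i * 'C(w.+1, i)%:R = (-1) ^+ N * 'C(w, N)%:R :> R.
Proof.
elim: N => [|N IH]; first by rewrite big_ord1 !bin0.
by rewrite big_ord_recr /= IH binS natrD mulrDr !exprS !mulN1r !mulNr [- _ - _]addrC addNKr.
Qed.

Lemma bonferroni (R : numDomainType) w N :
  `|(w == 0)%:R - \sum_(i < N) (-1) ^+ i * 'C(w, i)%:R| <= 'C(w, N)%:R :> R.
Proof.
case: N => [|N]; first by rewrite big_ord0 subr0 bin0 ger0_norm // lern1 leq_b1.
case: w => [|w].
  rewrite big_ord_recl big1 => [|i _]; last by rewrite bin0n mulr0.
  by rewrite bin0 mulr1 addr0 expr0 eqxx subrr normr0.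
rewrite alternating_bin sub0r normrN normrM normrX normrN1 expr1n mul1r.
by rewrite normr_nat ler_nat binS leq_addl.
Qed.

Section Model.
Variables (R : realType) (n P K s : nat).
Hypotheses (KP : (K <= P)%N) (s1 : (1 <= s)%N) (sK : (s <= K)%N).
Local Notation config := {ffun 'I_n -> {set 'I_P}}.
Implicit Types (w : config) (A U : {set 'I_n}) (T : {set 'I_P}).
Local Notation mu := (unif_subset R K).
Local Notation E1 := (Ex1 mu).
Local Notation a := (edge_rate R P K s).
Local Notation x := (K%:R ^+ 2 / P%:R : R).
Local Notation Z := (Zint R K s).

Let mu_ge0 := @unif_ge0 R P K.
Let mu_sum1 := unif_sum1 R KP.
Let a_gt0 : 0 < a := edge_rate_gt0 R KP s1 sK.

(** The number of valid configurations is not counted directly: it is read off from the total mass 1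
    of the product measure. *)
Lemma isg_probE (E : pred config) : isg_prob R n P K E = Pr mu E.
Proof.
have wtE w : \prod_i mu (w i) = (valid_config K w)%:R / ('C(P, K)%:R ^+ n) :> R.
  rewrite /unif_subset big_split /= prodr_const card_ord exprVn; congr (_ / _).
  rewrite /valid_config; case: forallP => [h|h].
    by rewrite big1 // => i _; rewrite h.
  have /existsP[i /negbTE hi] : [exists i, #|w i| != K] by rewrite -negb_forall; apply/forallP.
  by rewrite (bigD1 i) //= hi mul0r.
have sumE (F : pred config) : \sum_(w : config) (\prod_i mu (w i)) * (F w)%:R =
    #|[set w | valid_config K w && F w]|%:R / ('C(P, K)%:R ^+ n).
  rewrite -sum_natr_pred mulr_suml; apply: eq_bigr => w _.
  by rewrite wtE mulrAC -natrM mulnb.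
have c0 : 'C(P, K)%:R ^+ n != 0 :> R by rewrite expf_neq0 // pnatr_eq0 -lt0n bin_gt0.
have := @Ex_const _ _ _ mu_sum1 'I_n 1; rewrite /Ex.
have -> : \sum_(w : config) (\prod_i mu (w i)) * 1 = \sum_(w : config) (\prod_i mu (w i)) * (xpredT w)%:R by [].
rewrite sumE => /eqP; rewrite -(inj_eq (mulIf c0)) mulfVK // mul1r => /eqP e.
rewrite /Pr /Ex sumE /isg_prob -e; congr (_ / _%:R).
by apply: eq_card => w; rewrite !inE andbT.
Qed.

Lemma expR_half_le (y : R) : 0 <= y -> y <= 1 -> expR (y / 2) <= 1 + y.
Proof.
move=> y0 y1; have h : 0 < 1 - y / 2 by lra.
have : 1 - y / 2 <= (expR (y / 2))^-1 by rewrite -expRN; apply: expR_ge1Dx.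
rewrite -[X in X <= _]invrK lef_pV2 ?posrE ?expR_gt0 ?invr_gt0 // => /le_trans; apply.
rewrite -[X in X <= _]mul1r ler_pdivrMr //.
have : 0 <= y * (1 - y) by rewrite mulr_ge0 // subr_ge0.
lra.
Qed.

(** Exponential Markov inequality. Given [w u], the variables [y (w u) (w v)] are independent for v
    <> u: [Z] is divided by its maximum [b] on pairs sharing at most [M] items and set to 0 on other
    pairs. They lie in [0, 1] with mean at most s a / M, and exp (y / 2) <= 1 + y bounds the
    exponential moment by a product of the terms 1 + y. *)
Lemma Zsum_prob (M : nat) (D : R) u : (1 <= M)%N -> 0 <= D ->
  Pr mu (fun w => inter_le M setT w && (a * D < \sum_(v | v != u) Z (w u) (w v)))
   <= expR (n%:R * (s%:R * a / M%:R)) * expR (- (D * K%:R / (2 * M%:R * s%:R))).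
Proof.
move=> M1 D0.
have K0 : 0 < K%:R :> R by rewrite ltr0n (leq_trans s1).
have s0 : 0 < s%:R :> R by rewrite ltr0n.
have M0 : 0 < M%:R :> R by rewrite ltr0n.
pose b := M%:R * (s%:R / K%:R * a).
have b0 : 0 < b by apply: mulr_gt0 => //; apply: mulr_gt0 => //; apply: divr_gt0.
pose y (S T : {set 'I_P}) := if (#|S :&: T| <= M)%N then Z S T / b else 0.
have y0 S T : 0 <= y S T by rewrite /y; case: ifP => // _; rewrite divr_ge0 ?Zint_ge0 // ltW.
have y1 (S T : {set 'I_P}) : #|S| = K -> y S T <= 1.
  move=> SK; rewrite /y; case: ifP => // le; rewrite ler_pdivrMr // mul1r.
  apply: le_trans (Zint_le R KP s1 sK _ SK) _; rewrite ler_wpM2r ?ler_nat //.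
  by apply: mulr_ge0; [apply: divr_ge0 | apply: ltW].
have ymean (S : {set 'I_P}) : #|S| = K -> E1 (y S) <= s%:R * a / M%:R.
  move=> SK; apply: (@le_trans _ _ (E1 (fun T => b^-1 * Z S T))).
    apply: Ex1_le => // T _; rewrite /y mulrC; case: ifP => // _.
    by rewrite mulr_ge0 ?invr_ge0 ?Zint_ge0 ?(ltW b0).
  rewrite Ex1Z; apply: le_trans (_ : _ <= b^-1 * (s%:R ^+ 2 / K%:R * a ^+ 2)) _.
    by rewrite ler_wpM2l ?invr_ge0 ?(ltW b0) //; apply: Zint_mean.
  apply: eq_ler; rewrite /b; field.
  by rewrite !gt_eqF.
set c := D * K%:R / _.
pose G w : R := \prod_(v in [set~ u]) (1 + y (w u) (w v)).
apply: (@le_trans _ _ (Ex mu (fun w => expR (- c) * G w))).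
  apply: Ex_le => // w wmu; have wK v : #|w v| = K by apply: unif_neq0 (wmu v).
  have G0 : 0 <= G w by apply: prodr_ge0 => v _; rewrite addr_ge0.
  case: andP => [[/inter_leP w0 lt]|_]; last by rewrite mulr_ge0 // expR_ge0.
  rewrite expRN mulrC ler_pdivlMr ?expR_gt0 // mul1r.
  apply: (@le_trans _ _ (\prod_(v in [set~ u]) expR (y (w u) (w v) / 2))); last first.
    apply: ler_prod => v _; rewrite expR_ge0 /=; apply: expR_half_le => //; exact: y1.
  rewrite -expR_sum ler_expR -mulr_suml.
  have -> : \sum_(v in [set~ u]) y (w u) (w v) = (\sum_(v | v != u) Z (w u) (w v)) / b.
    rewrite mulr_suml; apply: eq_big => v; first by rewrite !inE.
    rewrite !inE => vu; rewrite /y w0 ?inE // eq_sym //.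
  have -> : c = a * D / b / 2.
    rewrite /c /b; field; rewrite !gt_eqF //.
  by rewrite !ler_wpM2r ?invr_ge0 // ?(ltW b0) // ltW.
rewrite ExZ mulrC ler_wpM2r ?expR_ge0 //.
rewrite (Ex_mix mu_sum1 [set u]); apply: Ex_le_const => // w wmu.
have wK v : #|w v| = K by apply: unif_neq0 (wmu v).
have -> : Ex mu (fun w' => G (mix [set u] w w')) =
   Ex mu (fun w' => \prod_(v in [set~ u]) (1 + y (w u) (w' v))).
  apply: eq_Ex => // w' _; apply: eq_bigr => v; rewrite inE => vu.
  by rewrite mix_in ?inE // mix_out.
rewrite (Ex_prod_in mu_ge0 mu_sum1 _ (fun _ T => 1 + y (w u) T)) prodr_const.
apply: (@le_trans _ _ (expR (s%:R * a / M%:R) ^+ #|[set~ u]|)).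
  rewrite lerXn2r ?nnegrE ?expR_ge0 //; first by apply: Ex1_ge0 => // T _; rewrite addr_ge0.
  rewrite Ex1D Ex1_const //; apply: le_trans (expR_ge1Dx _).
  by rewrite lerD2l; apply: ymean.
rewrite -expRM_natl ler_expR ler_wpM2r //.
  by apply: divr_ge0 => //; apply: mulr_ge0 => //; apply: ltW.
by rewrite ler_nat -[leqRHS]card_ord max_card.
Qed.

Lemma not_good_prob (M : nat) (D : R) : (1 <= M)%N -> 0 <= D ->
  Pr mu (fun w => ~~ good K s M D w setT) <=
    n%:R ^+ 2 * x ^+ M.+1 + n%:R * (expR (n%:R * (s%:R * a / M%:R)) * expR (- (D * K%:R / (2 * M%:R * s%:R)))).
Proof.
move=> M1 D0; set c := expR _ * _.
apply: (@le_trans _ _ (Pr mu (fun w => ~~ inter_le M setT w) +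
  Pr mu (fun w => [exists u, inter_le M setT w && (a * D < \sum_(v | v != u) Z (w u) (w v))]))).
  apply: Pr_sub2 => // w _; rewrite /good negb_and => /orP[->//|].
  case: (inter_le M setT w) => //= /forall_inPn[u _ h]; apply/existsP; exists u.
  rewrite ltNge; apply: contra h => h; apply: le_trans h.
  by apply: eq_ler; apply: eq_bigl => v; rewrite inE.
apply: lerD.
  have := inter_le_prob R KP M (setT : {set 'I_n}).
  by rewrite cardsT card_ord natrX.
apply: (@le_trans _ _ (\sum_(u : 'I_n) c)); last first.
  by rewrite sumr_const card_ord mulr_natl.
apply: le_trans (_ : _ <= \sum_(u | xpredT u) Pr mu (fun w => inter_le M setT w && (a * D < \sum_(v | v != u) Z (w u) (w v)))) _.
  by apply: Pr_exists => // w _ /existsP[u]; exists u.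
by apply: ler_sum => u _; apply: Zsum_prob.
Qed.

Definition cut_prob_total k := Pr mu (fun w => [exists A : {set 'I_n}, small_cut (isg_adj s w) k A]).

(* The minimum bounds the expected number of spanning trees of candidate sets of size r, or their number. *)
Definition cut_term m M D q0 r : R :=
  Num.min ((4 ^ r.-1)%:R * n%:R ^+ r * a ^+ r.-1) (2 ^ n)%:R * cut_bound n P K s m M D q0 r.

Lemma cut_prob_total_le k M D q0 : 0 <= D -> 0 < q0 ->
  (forall S : {set 'I_P}, #|S| = K -> q0 <= E1 (fun T => (hit s S T)%:R)) ->
  cut_prob_total k <= Pr mu (fun w => ~~ good K s M D w setT) +
    \sum_(r < n.+1 | (1 < r)%N && (r.*2 <= n)%N) cut_term k.-1 M D q0 r.
Proof.
move=> D0 q00 q0le.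
pose F (r : 'I_n.+1) w := [exists A : {set 'I_n}, [&& #|A| == r, connected_on (isg_adj s w) A & sparse K s k.-1 M D w A]].
apply: (@le_trans _ _ (Pr mu (fun w => ~~ good K s M D w setT) +
   Pr mu (fun w => [exists (r : 'I_n.+1 | (1 < r)%N && (r.*2 <= n)%N), F r w]))).
  apply: Pr_sub2 => // w _ /existsP[A /and4P[A1 A2 Ac An]].
  case: (boolP (good K s M D w setT)) => //= g; apply/exists_inP.
  have rn : (#|A| < n.+1)%N by rewrite ltnS -[leqRHS]card_ord max_card.
  exists (Ordinal rn); first by rewrite /= A1 -[X in (_ <= X)%N]card_ord.
  apply/existsP; exists A; rewrite eqxx Ac /sparse An andbT /=.
  by apply: good_sub g; apply: subsetT.
rewrite lerD2l; apply: le_trans (_ : _ <= \sum_(r < n.+1 | (1 < r)%N && (r.*2 <= n)%N) Pr mu (F r)) _.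
  by apply: Pr_exists => // w _ /exists_inP[r hr]; exists r.
apply: ler_sum => r /andP[r1 _]; have r0 : (0 < r)%N by apply: ltnW.
rewrite /cut_term /Num.min; case: ifP => _.
  exact: connected_cut_prob.
apply: le_trans (_ : _ <= Pr mu (fun w => [exists A : {set 'I_n}, (#|A| == r) && sparse K s k.-1 M D w A])) _; last exact: cut_prob.
apply: Pr_le => // w _.
by case/existsP => A /and3P[Ar _ As]; apply/existsP; exists A; rewrite Ar.
Qed.

(** The [j]-th factorial moment of the number of vertices of degree at most [m], divided by j!; [m]
    stands for k - 1. *)
Definition low_moment m j := Ex mu (fun w => 'C(#|[set u | low_deg s m w u]|, j)%:R).

Lemma low_momentE m j :
  low_moment m j = \sum_(U : {set 'I_n} | #|U| == j) Pr mu (fun w => [forall u in U, low_deg s m w u]).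
Proof.
rewrite -Ex_sum; apply: eq_Ex => // w _.
rewrite -cards_draws -sum1dep_card natr_sum big_mkcond [RHS]big_mkcond /=.
apply: eq_bigr => U _; rewrite andbC; case: (_ == j) => //=.
have -> : (U \subset [set u | low_deg s m w u]) = [forall u in U, low_deg s m w u].
  apply/subsetP/forall_inP => h u uU; first by have := h u uU; rewrite inE.
  by rewrite inE; apply: h.
by case: [forall u in U, low_deg s m w u].
Qed.

Lemma low_moment_bounds m j (lo hi : R) :
  (forall U, #|U| = j -> lo <= Pr mu (fun w => [forall u in U, low_deg s m w u]) <= hi) ->
  'C(n, j)%:R * lo <= low_moment m j <= 'C(n, j)%:R * hi.
Proof.
move=> h; rewrite low_momentE.
have cE (c : R) : 'C(n, j)%:R * c = \sum_(U : {set 'I_n} | #|U| == j) c.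
  rewrite -[X in 'C(X, _)]card_ord -card_draws mulr_natl -sumr_const.
  by apply: eq_bigl => U; rewrite inE.
by rewrite !cE; apply/andP; split; apply: ler_sum => U /eqP /h /andP[].
Qed.

Lemma min_degreeE m w :
  min_degree_ge m.+1 (isg_adj s w) = (#|[set u | low_deg s m w u]| == 0)%N.
Proof.
rewrite cards_eq0; apply/forallP/eqP => [h|/setP h u].
  by apply/setP => u; rewrite !inE /low_deg leqNgt h.
by have := h u; rewrite !inE /low_deg leqNgt => /negbFE.
Qed.

Lemma min_degree_bonferroni m N :
  `|Pr mu (fun w => min_degree_ge m.+1 (isg_adj s w)) - \sum_(i < N) (-1) ^+ i * low_moment m i|
    <= low_moment m N.
Proof.
have -> : \sum_(i < N) (-1) ^+ i * low_moment m i =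
   Ex mu (fun w => \sum_(i < N) (-1) ^+ i * 'C(#|[set u | low_deg s m w u]|, i)%:R).
  by rewrite Ex_sum; apply: eq_bigr => i _; rewrite ExZ.
rewrite /Pr -ExB ler_norml; apply/andP; split.
  rewrite -[X in X <= _]mulN1r /low_moment -ExZ; apply: Ex_le => // w _; rewrite mulN1r min_degreeE.
  by have := bonferroni R #|[set u | low_deg s m w u]| N; rewrite ler_norml => /andP[].
apply: Ex_le => // w _; rewrite min_degreeE.
by have := bonferroni R #|[set u | low_deg s m w u]| N; rewrite ler_norml => /andP[].
Qed.

(** Chebyshev's inequality: where no vertex has low degree, the squared deviation equals the squared
    mean, and the right-hand side is the variance. It serves alpha tending to minus infinity, where
    the mean is unbounded. *)
Lemma min_degree_second_moment m :
  Pr mu (fun w => min_degree_ge m.+1 (isg_adj s w)) * low_moment m 1 ^+ 2 <=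
    2 * low_moment m 2 + low_moment m 1 - low_moment m 1 ^+ 2.
Proof.
have varE c : Ex mu (fun w => (#|[set u | low_deg s m w u]|%:R - c) ^+ 2) =
    2 * low_moment m 2 + (1 - 2 * c) * low_moment m 1 + c ^+ 2.
  rewrite /low_moment -!ExZ -[X in _ + X](@Ex_const _ _ _ mu_sum1 'I_n) -!ExD.
  apply: eq_Ex => // w _; set W := #|_|.
  have -> : 2 * 'C(W, 2)%:R = W%:R ^+ 2 - W%:R :> R.
    rewrite -natrM mul2n bin2 -natrX.
    have -> : (W * W.-1)./2.*2 = (W * W.-1)%N.
      rewrite -[RHS]odd_double_half; case: (W) => //= w'; rewrite oddM /=; by case: (odd w').
    by case: (W) => [|w'] /=; rewrite ?mul0n ?expr0n ?subrr // natrM natrX -[w'.+1%:R]natr1; ring.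
  by rewrite bin1; ring.
set l1 := low_moment m 1.
have -> : 2 * low_moment m 2 + l1 - l1 ^+ 2 = 2 * low_moment m 2 + (1 - 2 * l1) * l1 + l1 ^+ 2 by ring.
rewrite -varE.
rewrite mulrC -ExZ; apply: Ex_le => // w _; rewrite min_degreeE.
case: eqP => [->|_]; first by rewrite mulr1 sub0r sqrrN.
by rewrite mulr0 sqr_ge0.
Qed.

Lemma vertex_connected_prob k : (1 <= k)%N -> (k < n)%N ->
  Pr mu (fun w => min_degree_ge k (isg_adj s w)) - cut_prob_total k
    <= Pr mu (fun w => k_vertex_connected k (isg_adj s w))
    <= Pr mu (fun w => min_degree_ge k (isg_adj s w)).
Proof.
move=> k1 kn; apply/andP; split.
  rewrite lerBlDr; apply: Pr_sub2 => // w _ md.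
  case: (boolP (k_vertex_connected k (isg_adj s w))) => //= nc.
  by apply/existsP; apply: (not_vertex_connected (@isg_adj_sym _ _ s w) (@isg_adj_irr _ _ s w) k1 md nc).
apply: Pr_le => // w _; apply: (vertex_connected_min_degree (@isg_adj_irr _ _ s w)) => //.
by rewrite card_ord.
Qed.

Lemma edge_connected_prob k : (1 <= k)%N -> (1 < n)%N ->
  Pr mu (fun w => min_degree_ge k (isg_adj s w)) - cut_prob_total k
    <= Pr mu (fun w => k_edge_connected k (isg_adj s w))
    <= Pr mu (fun w => min_degree_ge k (isg_adj s w)).
Proof.
move=> k1 kn; apply/andP; split.
  rewrite lerBlDr; apply: Pr_sub2 => // w _ md.
  case: (boolP (k_edge_connected k (isg_adj s w))) => //= nc.
  by apply/existsP; apply: (not_edge_connected (@isg_adj_sym _ _ s w) (@isg_adj_irr _ _ s w) k1 md nc).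
apply: Pr_le => // w _; apply: edge_connected_min_degree => //.
by rewrite card_ord.
Qed.

End Model.

(* A uniform K-subset of a uniform K'-set is a uniform K-set. *)
Lemma isg_prob_mono (R : realType) n P K K' (E : pred {ffun 'I_n -> {set 'I_P}}) :
  (K <= K')%N -> (K' <= P)%N ->
  (forall w w' : {ffun 'I_n -> {set 'I_P}}, E w -> (forall i, w i \subset w' i) -> E w') ->
  isg_prob R n P K E <= isg_prob R n P K' E.
Proof.
move=> KK' K'P h.
rewrite (isg_probE R (leq_trans KK' K'P)) (isg_probE R K'P).
pose nu (S T : {set 'I_P}) : R := [&& #|S| == K, #|T| == K' & S \subset T]%:R / ('C(P, K')%:R * 'C(K', K)%:R).
have c0 : ('C(P, K')%:R != 0 :> R) by rewrite pnatr_eq0 -lt0n bin_gt0.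
have c1 : ('C(K', K)%:R != 0 :> R) by rewrite pnatr_eq0 -lt0n bin_gt0.
have c2 : ('C(P, K)%:R != 0 :> R) by rewrite pnatr_eq0 -lt0n bin_gt0 (leq_trans KK').
apply: (Pr_coupling (nu := nu)).
- by move=> S T; rewrite divr_ge0 // mulr_ge0.
- move=> S; rewrite -mulr_suml sum_natr_pred /unif_subset.
  have [SK|SK] := eqVneq #|S| K; last first.
    by rewrite eq_card0 ?mul0r // => T; rewrite inE.
  have -> : #|[set T : {set 'I_P} | true && ((#|T| == K') && (S \subset T))]| = 'C(P - K, K' - K).
    rewrite -SK -card_supsets ?SK //; by apply: eq_card => T; rewrite !inE /= andbC.
  apply/eqP; rewrite eqr_div ?mulf_neq0 // mul1r -!natrM eqr_nat.
  have e1 := bin_fact (leq_trans KK' K'P); have e2 := bin_fact K'P; have e3 := bin_fact KK'.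
  have e4 := bin_fact (leq_sub2r K K'P).
  have e5 : (P - K - (K' - K) = P - K')%N by rewrite subnBA // subnK // (leq_trans KK').
  rewrite e5 in e4.
  have : (0 < K`! * ((K' - K)`! * (P - K')`!))%N by rewrite !muln_gt0 !fact_gt0.
  move=> pos; rewrite -(eqn_pmul2r pos); apply/eqP.
  transitivity P`!.
    by rewrite -e1 -e4; ring.
  by rewrite -e2 -e3; ring.
- move=> T; rewrite -mulr_suml sum_natr_pred /unif_subset.
  have [TK|TK] := eqVneq #|T| K'; last first.
    by rewrite eq_card0 ?mul0r // => S; rewrite inE andbF.
  have -> : #|[set S : {set 'I_P} | (#|S| == K) && (true && (S \subset T))]| = 'C(K', K).
    by rewrite -TK -cards_draws; apply: eq_card => S; rewrite !inE andbC.
  by rewrite invfM mulrCA mulfV // mulr1 (_ : true%:R = 1) // mul1r.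
- move=> w w' Ew ww'; apply: h Ew _ => i; have := ww' i.
  by rewrite /nu; case: and3P => [[]//|_]; rewrite mul0r eqxx.
Qed.

(** * The three properties increase with the item sets *)

Section Monotone.
Variables (n P s : nat).
Implicit Types w : {ffun 'I_n -> {set 'I_P}}.

Lemma isg_adj_mono (w w' : {ffun 'I_n -> {set 'I_P}}) : (forall i, w i \subset w' i) -> subrel (isg_adj s w) (isg_adj s w').
Proof.
move=> h u v /andP[uv]; rewrite /isg_adj uv /= => /leq_trans; apply.
by apply: subset_leq_card; apply: setISS.
Qed.

Lemma connected_on_mono (V : finType) (e e' : rel V) (A : {set V}) : subrel e e' ->
  connected_on e A -> connected_on e' A.
Proof.
move=> ee' /forall_inP h; apply/forall_inP => u uA; apply/forall_inP => v vA.
have /forall_inP/(_ v vA) := h u uA; apply: connect_sub => y z /and3P[yA zA yz].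
by apply: connect1; rewrite yA zA ee'.
Qed.

Lemma vertex_connected_mono (V : finType) (e e' : rel V) k : subrel e e' ->
  k_vertex_connected k e -> k_vertex_connected k e'.
Proof.
move=> ee' /forallP h; apply/forallP => D; apply/implyP => Dk.
by have /implyP/(_ Dk) := h D; apply: connected_on_mono.
Qed.

Lemma edge_connected_mono (V : finType) (e e' : rel V) k : subrel e e' ->
  k_edge_connected k e -> k_edge_connected k e'.
Proof.
move=> ee' /forallP h; apply/forallP => F; apply/implyP => Fk.
have /implyP/(_ Fk) := h F; apply: connected_on_mono => u v /and3P[/ee' uv -> ->].
by rewrite uv.
Qed.

Lemma min_degree_mono (V : finType) (e e' : rel V) k : subrel e e' ->
  min_degree_ge k e -> min_degree_ge k e'.
Proof.
move=> ee' /forallP h; apply/forallP => v; apply: leq_trans (h v) _.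
by apply: subset_leq_card; apply/subsetP => u; rewrite !inE; apply: ee'.
Qed.

End Monotone.

(** * Asymptotics *)

From mathcomp Require Import all_classical all_reals all_analysis.
Import numFieldNormedType.Exports.
Import Order.TTheory GRing.Theory Num.Theory.
Local Open Scope classical_set_scope.
Local Open Scope ring_scope.

Lemma expR_ge_sqr (R : realType) (y : R) : 0 <= y -> y ^+ 2 <= expR (2 * y).
Proof.
move=> y0; rewrite expRM_natl lerXn2r ?nnegrE ?expR_ge0 //.
by apply: le_trans (expR_ge1Dx y); rewrite lerDr.
Qed.

Lemma ler_expN (R : realType) (y e : R) : 0 < e -> e^-1 <= y -> expR (- y) <= e.
Proof.
move=> e0 ey; have y0 : 0 < y by apply: lt_le_trans ey; rewrite invr_gt0.
rewrite expRN -[leRHS]invrK lef_pV2 ?posrE ?expR_gt0 ?invr_gt0 //.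
by apply: le_trans ey _; apply: le_trans (expR_ge1Dx y); rewrite lerDr.
Qed.

(** * The scale sqrt(ln n) *)

Section Scale.
Variable R : realType.

(** Writing t for this, n = exp (t^2), logarithmic powers become polynomials in t, and [K] is at
    least a multiple of t. *)
Definition sqln (n : nat) : R := Num.sqrt (ln n%:R).
Local Notation t := sqln.

Lemma sqln_ge0 n : 0 <= t n.
Proof. exact: sqrtr_ge0. Qed.

Lemma sqln_large (C : R) : \forall n \near \oo, C <= t n.
Proof.
near=> n; have hn : expR (C ^+ 2) <= n%:R by near: n; exact: nbhs_infty_ger.
apply: le_trans (ler_norm C) _; rewrite -sqrtr_sqr ler_wsqrtr //.
by rewrite -[leLHS]expRK ler_ln ?posrE ?expR_gt0 // (lt_le_trans _ hn) ?expR_gt0.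
Unshelve. all: by end_near.
Qed.

Lemma sqlnK n : 1 <= t n -> t n ^+ 2 = ln n%:R /\ n%:R = expR (t n ^+ 2).
Proof.
move=> t1; have h : 0 < ln (n%:R : R).
  by rewrite ltNge; apply/negP => /ler0_sqrtr h; move: t1; rewrite /t h ler10.
have n0 : 0 < n%:R :> R by rewrite ltNge; apply/negP => /ln0 h'; rewrite h' ltxx in h.
have e : t n ^+ 2 = ln n%:R by rewrite /t sqr_sqrtr // ltW.
by rewrite e lnK ?posrE.
Qed.

(** The common form of the error terms: any negative power of n beats exp (C sqrt(ln n)). *)
Lemma exp_sqln_small (C b e : R) : 0 < b -> 0 < e ->
  \forall n \near \oo, expR (C * t n - b * t n ^+ 2) <= e.
Proof.
move=> b0 e0; near=> n.
have h1 : e^-1 <= t n by near: n; exact: sqln_large.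
have h2 : (C + 1) / b <= t n by near: n; exact: sqln_large.
apply: le_trans (ler_expN e0 h1); rewrite ler_expR.
have t0 := sqln_ge0 n.
move: h2; rewrite ler_pdivrMr // => h2; have := ler_wpM2r t0 h2.
by rewrite expr2; lra.
Unshelve. all: by end_near.
Qed.

End Scale.

(** * Size of the parameters when alpha is at most (ln n)/20 in absolute value *)

Section Regime.
Variables (R : realType) (s k : nat) (c : R).
Hypotheses (s1 : (1 <= s)%N) (c0 : 0 < c).
Local Notation t := (@sqln R).

Definition scaled_degree n K P : R := n%:R * edge_rate R P K s.
Local Notation A := scaled_degree.

Definition alpha_of n K P : R := A n K P - ln n%:R - k.-1%:R * ln (ln n%:R).

(** A condition on numbers, not on sequences: the estimates are uniform over it, so that [K] may be
    replaced separately for each [n]. *)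
Definition regime n K P := [/\ (s <= K)%N, (K <= P)%N, c * n%:R <= P%:R
   & `|alpha_of n K P| <= ln n%:R / 20].

Definition ratio (K P : nat) : R := K%:R ^+ 2 / P%:R.
Local Notation x := ratio.

(* A lower bound for the edge probability. *)
Definition edge_low K P : R := edge_rate R P K s * (1 - 2 * ((s * s.-1)%:R / K%:R) - x K P).

Lemma lnln_small (e : R) : 0 < e -> \forall n \near \oo,
  0 <= ln (ln n%:R) :> R /\ k.-1%:R * ln (ln n%:R) <= e * t n ^+ 2.
Proof.
move=> e0; near=> n.
have t1 : 1 <= t n by near: n; exact: sqln_large.
have [tE nE] := sqlnK t1.
have h : 2 * k.-1%:R / e <= t n by near: n; exact: sqln_large.
rewrite -tE lnXn ?(lt_le_trans ltr01) //; split.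
  by rewrite mulrn_wge0 // ln_ge0.
have l1 : ln (t n) <= t n by rewrite ltW // ln_sublinear // (lt_le_trans ltr01).
move: h; rewrite ler_pdivrMr // => h; have := ler_wpM2r (sqln_ge0 R n) h.
have := ler_wpM2l (ler0n R k.-1) l1; rewrite expr2 -mulr_natl; lra.
Unshelve. all: by end_near.
Qed.

(** Of the tolerance 1/10, one half is the bound on alpha and the other half absorbs the iterated
    logarithm. *)
Lemma regime_degree : \forall n \near \oo, forall K P, regime n K P ->
  9 / 10 * t n ^+ 2 <= A n K P <= 11 / 10 * t n ^+ 2.
Proof.
near=> n => K P [_ _ _].
have t1 : 1 <= t n by near: n; exact: sqln_large.
have [tE nE] := sqlnK t1.
have [l0 l1] : 0 <= ln (ln (n%:R : R)) /\ k.-1%:R * ln (ln n%:R) <= (1 / 20) * t n ^+ 2.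
  by near: n; apply: lnln_small; lra.
have h : 0 <= k.-1%:R * ln (ln (n%:R : R)) by rewrite mulr_ge0.
have t2 : 0 <= t n ^+ 2 by rewrite sqr_ge0.
rewrite /alpha_of -tE ler_norml => /andP[]; move: l1 h; rewrite -tE.
move=> l1 h h1 h2; apply/andP; split; lra.
Unshelve. all: by end_near.
Qed.

Section Facts.
Variables n K P : nat.
Hypotheses (sK : (s <= K)%N) (KP : (K <= P)%N) (cP : c * n%:R <= P%:R) (t1 : 1 <= t n).
Hypothesis hA : 9 / 10 * t n ^+ 2 <= A n K P <= 11 / 10 * t n ^+ 2.

Let n0 : 0 < n%:R :> R. Proof. by have [_ ->] := sqlnK t1; rewrite expR_gt0. Qed.
Let K0 : 0 < K%:R :> R. Proof. by rewrite ltr0n (leq_trans s1). Qed.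
Let P0 : 0 < P%:R :> R. Proof. by rewrite ltr0n (leq_trans s1) // (leq_trans sK). Qed.

Lemma t2_ge1 : 1 <= t n ^+ 2.
Proof. by rewrite exprn_ege1. Qed.

Lemma degree_ge : 9 / 10 <= A n K P.
Proof. by have /andP[h _] := hA; have := t2_ge1; lra. Qed.

Lemma degree_le_exp : A n K P <= 2 * expR (2 * t n).
Proof.
have /andP[_ h] := hA; have := expR_ge_sqr (sqln_ge0 R n); have := t2_ge1; lra.
Qed.

Lemma edge_rate_degree : edge_rate R P K s = A n K P * expR (- t n ^+ 2).
Proof. by have [_ e] := sqlnK t1; rewrite expRN -e /A mulrAC mulfV ?mul1r // gt_eqF. Qed.

Lemma ratio_gt0 : 0 < x K P.
Proof. by rewrite /x divr_gt0 // exprn_gt0. Qed.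

Lemma ratio_pow : x K P ^+ s = s`!%:R * (A n K P * expR (- t n ^+ 2)).
Proof. by rewrite -edge_rate_degree edge_rateE // mulrCA mulfV ?mulr1 // pnatr_eq0 -lt0n fact_gt0. Qed.

Lemma K_pow : K%:R ^+ (2 * s) = s`!%:R * (A n K P * expR (- t n ^+ 2)) * P%:R ^+ s.
Proof. by rewrite -ratio_pow -exprMn /x mulfVK ?gt_eqF // exprM. Qed.

Lemma n_ge_t2 : t n ^+ 2 <= n%:R.
Proof. by have [_ ->] := sqlnK t1; apply: le_trans (expR_ge1Dx _); rewrite lerDr. Qed.

(** By the definition of the rate, K^(2s) = s! (A / n) P^s; now P >= c n. For s = 1 this leaves only
    K^2 of order ln n, while for s > 1 it is a positive power of n. *)
Lemma K_pow_ge : 9 / 10 * t n ^+ 2 <= A n K P ->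
  9 / 10 * t n ^+ 2 * c ^+ s * n%:R ^+ s.-1 <= K%:R ^+ (2 * s).
Proof.
move=> h; rewrite K_pow; have [_ e] := sqlnK t1.
have h1 : c ^+ s * n%:R ^+ s <= P%:R ^+ s.
  by rewrite -exprMn lerXn2r ?nnegrE // ?ltW // mulr_gt0.
have h2 : 0 <= 9 / 10 * t n ^+ 2 by have := t2_ge1; lra.
have h3 : 9 / 10 * t n ^+ 2 * expR (- t n ^+ 2) <= s`!%:R * (A n K P * expR (- t n ^+ 2)).
  rewrite -[leLHS]mul1r ler_pM // ?ler1n ?fact_gt0 //.
    by rewrite mulr_ge0 // expR_ge0.
  by rewrite ler_wpM2r // expR_ge0.
apply: le_trans (_ : _ <= 9 / 10 * t n ^+ 2 * expR (- t n ^+ 2) * (c ^+ s * n%:R ^+ s)) _.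
  have -> : n%:R ^+ s = n%:R * n%:R ^+ s.-1 :> R by rewrite -exprS prednK.
  rewrite expRN -e; apply: eq_ler; field.
  by rewrite gt_eqF.
apply: ler_pM => //.
- by rewrite mulr_ge0 // expR_ge0.
- by rewrite mulr_ge0 // exprn_ge0 // ltW.
Qed.

Lemma K_ge : 9 / 10 * t n ^+ 2 <= A n K P -> Num.sqrt (9 / 10 * c) * t n <= K%:R.
Proof.
move=> hAl; have c90 : 0 <= 9 / 10 * c by rewrite mulr_ge0 ?ltW //; lra.
rewrite -(@ler_pXn2r _ 2) ?nnegrE ?(ltW K0) ?mulr_ge0 ?sqrtr_ge0 ?sqln_ge0 //.
rewrite exprMn sqr_sqrtr // -(@ler_pXn2r _ s) ?nnegrE ?sqr_ge0 //; last first.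
  by rewrite mulr_ge0 ?sqr_ge0.
rewrite -[leRHS]exprM; apply: le_trans (K_pow_ge hAl).
have -> : (9 / 10 * c * t n ^+ 2) ^+ s = (9 / 10) ^+ s * c ^+ s * (t n ^+ 2) ^+ s by rewrite !exprMn.
have -> : (t n ^+ 2) ^+ s = t n ^+ 2 * (t n ^+ 2) ^+ s.-1 by rewrite -exprS prednK.
have -> : (9 / 10) ^+ s * c ^+ s * (t n ^+ 2 * (t n ^+ 2) ^+ s.-1) =
  (9 / 10) ^+ s * (t n ^+ 2 * c ^+ s * (t n ^+ 2) ^+ s.-1) by ring.
have -> : 9 / 10 * t n ^+ 2 * c ^+ s * n%:R ^+ s.-1 = 9 / 10 * (t n ^+ 2 * c ^+ s * n%:R ^+ s.-1) by ring.
have cs0 : 0 <= c ^+ s by rewrite exprn_ge0 // ltW.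
apply: ler_pM.
- by rewrite exprn_ge0 //; lra.
- by apply: mulr_ge0; [apply: mulr_ge0 => //; apply: sqr_ge0 | apply: exprn_ge0; apply: sqr_ge0].
- by rewrite -[leRHS]expr1; apply: ler_wiXn2l => //; lra.
- apply: ler_wpM2l; first by apply: mulr_ge0; [apply: sqr_ge0 |].
  by apply: lerXn2r; rewrite ?nnegrE ?sqr_ge0 ?(ltW n0) // n_ge_t2.
Qed.

End Facts.

(** The ratio has x^s = s! A / n, so it decays like a power of n. *)
Lemma ratio_small (C e : R) : 0 < e -> \forall n \near \oo, forall K P, regime n K P ->
  x K P * expR (C * t n) <= e.
Proof.
move=> e0; near=> n => K P reg.
have t1 : 1 <= t n by near: n; exact: sqln_large.
have hA : 9 / 10 * t n ^+ 2 <= A n K P <= 11 / 10 * t n ^+ 2.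
  by move: K P reg; near: n; exact: regime_degree.
have [sK KP cP _] := reg.
rewrite -(@ler_pXn2r _ s) ?nnegrE ?(ltW e0) ?mulr_ge0 ?expR_ge0 ?(ltW (ratio_gt0 sK KP)) //.
rewrite exprMn (ratio_pow _ _ t1) -expRM_natl.
have h : expR ((s%:R * C + 2) * t n - 1 * t n ^+ 2) <= e ^+ s / (2 * s`!%:R).
  near: n; apply: exp_sqln_small => //.
  by rewrite divr_gt0 ?exprn_gt0 // mulr_gt0 // ltr0n fact_gt0.
move: h; rewrite ler_pdivlMr ?mulr_gt0 ?ltr0n ?fact_gt0 //; apply: le_trans.
have -> : expR ((s%:R * C + 2) * t n - 1 * t n ^+ 2) = expR (2 * t n) * (expR (- t n ^+ 2) * expR (s%:R * (C * t n))).
  by rewrite -!expRD; congr expR; ring.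
have -> : s`!%:R * (A n K P * expR (- t n ^+ 2)) * expR (s%:R * (C * t n)) =
   A n K P * (s`!%:R * (expR (- t n ^+ 2) * expR (s%:R * (C * t n)))) by ring.
have -> : expR (2 * t n) * (expR (- t n ^+ 2) * expR (s%:R * (C * t n))) * (2 * s`!%:R) =
  (2 * expR (2 * t n)) * (s`!%:R * (expR (- t n ^+ 2) * expR (s%:R * (C * t n)))) by ring.
rewrite ler_wpM2r ?mulr_ge0 ?expR_ge0 //.
exact: degree_le_exp.
Unshelve. all: by end_near.
Qed.

(** For s = 1, [K] may be of order sqrt(ln n) and the quotient unbounded; for s > 1 [K] grows like a
    power of n at least. *)
Lemma degree_over_K (e : R) : (1 < s)%N -> 0 < e -> \forall n \near \oo, forall K P, regime n K P ->
  A n K P / K%:R <= e.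
Proof.
move=> s2 e0; near=> n => K P reg.
have t1 : 1 <= t n by near: n; exact: sqln_large.
have hA : 9 / 10 * t n ^+ 2 <= A n K P <= 11 / 10 * t n ^+ 2.
  by move: K P reg; near: n; exact: regime_degree.
have [sK KP cP _] := reg.
have K0 : 0 < K%:R :> R by rewrite ltr0n (leq_trans s1).
have A0 : 0 <= A n K P by have := degree_ge t1 hA; lra.
have cs0 : 0 < c ^+ s by rewrite exprn_gt0.
have s20 : (0 < 2 * s)%N by rewrite muln_gt0.
rewrite -(@ler_pXn2r _ (2 * s)) ?nnegrE ?(ltW e0) ?divr_ge0 ?(ltW K0) //.
rewrite expr_div_n ler_pdivrMr ?exprn_gt0 //.
have h : expR ((4 * s%:R) * t n - 1 * t n ^+ 2) <= e ^+ (2 * s) * (9 / 10 * c ^+ s) / 2 ^+ (2 * s).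
  near: n; apply: exp_sqln_small => //.
  apply: divr_gt0; last by apply: exprn_gt0.
  by apply: mulr_gt0; [apply: exprn_gt0 | apply: mulr_gt0; [lra | apply: exprn_gt0]].
have [_ nE] := sqlnK t1.
apply: (@le_trans _ _ (e ^+ (2 * s) * (9 / 10 * c ^+ s * n%:R))).
  apply: (@le_trans _ _ ((2 * expR (2 * t n)) ^+ (2 * s))).
    by rewrite lerXn2r ?nnegrE ?mulr_ge0 ?expR_ge0 //; apply: degree_le_exp.
  move: h; rewrite ler_pdivlMr ?exprn_gt0 // => h.
  rewrite exprMn -expRM_natl.
  have -> : expR ((2 * s)%:R * (2 * t n)) = expR (4 * s%:R * t n - 1 * t n ^+ 2) * n%:R.
    by rewrite nE -expRD natrM; congr expR; ring.
  by rewrite mulrA [_ * expR _]mulrC [leRHS]mulrA ler_wpM2r.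
rewrite ler_wpM2l ?exprn_ge0 ?(ltW e0) //.
apply: le_trans (K_pow_ge sK KP cP t1 (proj1 (andP hA))).
have n1 : 1 <= n%:R :> R by rewrite nE; apply: le_trans (expR_ge1Dx _); rewrite lerDl sqr_ge0.
have -> : 9 / 10 * t n ^+ 2 * c ^+ s * n%:R ^+ s.-1 = 9 / 10 * c ^+ s * (t n ^+ 2 * n%:R ^+ s.-1) by ring.
apply: ler_wpM2l; first by apply: mulr_ge0; [lra | apply: ltW].
rewrite -[leLHS]mul1r ler_pM //; first exact: t2_ge1.
by rewrite -[leLHS]expr1 ler_weXn2l // -ltnS prednK.
Unshelve. all: by end_near.
Qed.

(** The left-hand side is 2 s (s - 1) A / K + A x. Its first term is absent for s = 1, the case in
    which A / K is not controlled. *)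
Lemma edge_gap_small (e : R) : 0 < e -> \forall n \near \oo, forall K P, regime n K P ->
  n%:R * (edge_rate R P K s - edge_low K P) <= e.
Proof.
move=> e0.
have ev : \forall n \near \oo, forall K P, regime n K P ->
    2 * (s * s.-1)%:R * (A n K P / K%:R) <= e / 2.
  move: (s1); rewrite leq_eqVlt => /predU1P[<-|s2].
    by near=> n => K P _; rewrite muln0 mulr0 mul0r; lra.
  have S0 : 0 < 2 * (s * s.-1)%:R :> R by rewrite mulr_gt0 // ltr0n muln_gt0 s1 -subn1 subn_gt0.
  have e1 : 0 < e / 2 / (2 * (s * s.-1)%:R) by apply: divr_gt0 => //; lra.
  near=> n => K P reg; rewrite mulrC -ler_pdivlMr //.
  by move: K P reg; near: n; exact: degree_over_K.
near=> n => K P reg.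
have t1 : 1 <= t n by near: n; exact: sqln_large.
have hA : 9 / 10 * t n ^+ 2 <= A n K P <= 11 / 10 * t n ^+ 2.
  by move: K P reg; near: n; exact: regime_degree.
have [sK KP cP _] := reg.
have h1 : x K P * expR (2 * t n) <= e / 4.
  by move: K P reg {hA sK KP cP}; near: n; apply: ratio_small; lra.
have h2 : 2 * (s * s.-1)%:R * (A n K P / K%:R) <= e / 2.
  by move: K P reg {hA sK KP cP h1}; near: n.
have -> : n%:R * (edge_rate R P K s - edge_low K P) = 2 * (s * s.-1)%:R * (A n K P / K%:R) + A n K P * x K P.
  by rewrite /edge_low /A; ring.
have h3 : A n K P * x K P <= 2 * expR (2 * t n) * x K P.
  by rewrite ler_wpM2r ?(ltW (ratio_gt0 sK KP)) //; apply: degree_le_exp.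
lra.
Unshelve. all: by end_near.
Qed.

End Regime.

Lemma one_sub_exp (R : realType) (Q : R) N : 0 <= Q -> Q <= 1 -> (1 - Q) ^+ N <= expR (- (Q * N%:R)).
Proof.
move=> Q0 Q1; rewrite -mulNr expRM_natr lerXn2r ?nnegrE ?expR_ge0 ?subr_ge0 //.
exact: expR_ge1Dx.
Qed.

Lemma exp_one_sub (R : realType) (y : R) : 0 <= y -> y <= 1 / 2 -> expR (- (2 * y)) <= 1 - y.
Proof.
move=> y0 y1; rewrite expRN -[leRHS]invrK lef_pV2 ?posrE ?expR_gt0 ?invr_gt0 //; last lra.
apply: le_trans (expR_ge1Dx _).
have h : 0 < 1 - y by lra.
rewrite -[leLHS]mul1r ler_pdivrMr //.
have : 0 <= y * (1 - 2 * y) by rewrite mulr_ge0 //; lra.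
lra.
Qed.

Lemma ffact_ge_expn n i : ((n - i) ^ i <= n ^_ i)%N.
Proof.
elim: i => [|i IH]; first by rewrite ffactn0 expn0.
rewrite ffactnSr expnSr leq_mul //; last by lia.
apply: leq_trans IH; case: (posnP i) => [->|i0]; first by rewrite !expn0.
by rewrite leq_exp2r //; lia.
Qed.

Lemma ler_natrB (R : realType) (i l : nat) : i%:R - l%:R <= (i - l)%:R :> R.
Proof. by rewrite lerBlDr -natrD ler_nat; lia. Qed.

(* Otherwise rewriting with lemmas on products unfolds these. *)
Opaque edge_rate edge_low.

(** * Comparison of low degree probabilities with Poisson weights *)

Section MomentBounds.
Variables (R : realType) (s : nat).
Variables (n K P j m : nat).
Hypotheses (s1 : (1 <= s)%N) (sK : (s <= K)%N) (KP : (K <= P)%N) (n0 : (0 < n)%N) (j0 : (0 < j)%N).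
Local Notation a := (edge_rate R P K s).
Local Notation A := (scaled_degree R s n K P).
Local Notation x := (ratio R K P).
Local Notation q0 := (edge_low R s K P).
Local Notation mu := (unif_subset R K).
Variable d : R.
Hypotheses (d0 : 0 <= d) (gap : n%:R * (a - q0) <= d) (aad : A * a <= d) (ad : a <= d)
  (A1 : 1 <= A) (Ad : A^-1 <= d) (d12 : d <= 1 / 2).

(** The mass at [m] of the Poisson law of mean [z]. As the mean degree tends to infinity, degree at
    most [m] is asymptotically as likely as degree exactly [m]. The number [d] bounds all small
    quantities, so that errors appear as exp (O(d)). *)
Definition poisson_weight (z : R) : R := z ^+ m * expR (- z) / m`!%:R.
Local Notation p := (poisson_weight A).

Let a0 : 0 < a := edge_rate_gt0 R KP s1 sK.
Let nR : 0 < n%:R :> R. Proof. by rewrite ltr0n. Qed.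
Let A0 : 0 < A. Proof. exact: lt_le_trans ltr01 A1. Qed.
Let mf : 0 < m`!%:R :> R. Proof. by rewrite ltr0n fact_gt0. Qed.

Lemma edge_low_le (S : {set 'I_P}) : #|S| = K -> q0 <= Ex1 mu (fun T : {set 'I_P} => (hit s S T)%:R).
Proof. exact: hit_ge. Qed.

Lemma edge_low_le_a : q0 <= a.
Proof. exact: hit_lower_le_a edge_low_le. Qed.

Lemma edge_low_gt0 : 0 < q0.
Proof.
have : 0 < n%:R * q0.
  have -> : n%:R * q0 = A - n%:R * (a - q0) by rewrite mulrBr opprB addrC subrK.
  by rewrite subr_gt0; apply: le_lt_trans gap _; apply: le_lt_trans d12 _; apply: lt_le_trans A1; lra.
by rewrite pmulr_rgt0.
Qed.

Lemma poisson_weight_gt0 : 0 < p.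
Proof. by rewrite /poisson_weight divr_gt0 // mulr_gt0 ?exprn_gt0 ?expR_gt0. Qed.

Lemma degree_q0 : A - 2 * d <= n%:R * (q0 ^+ 2 / a).
Proof.
have e : n%:R * (q0 ^+ 2 / a) = A - 2 * (n%:R * (a - q0)) + n%:R * (a - q0) ^+ 2 / a.
  by rewrite /scaled_degree; field; rewrite gt_eqF.
have h : 0 <= n%:R * (a - q0) ^+ 2 / a by apply: divr_ge0 (ltW a0); apply: mulr_ge0 => //; apply: sqr_ge0.
rewrite e; move: (gap); lra.
Qed.

Lemma degree_q0_le : n%:R * (q0 ^+ 2 / a) <= A.
Proof.
rewrite /scaled_degree ler_wpM2l // ler_pdivrMr // -expr2.
by rewrite lerXn2r ?nnegrE ?(ltW a0) ?(ltW edge_low_gt0) ?edge_low_le_a.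
Qed.

Lemma Qint_bounds M : 0 <= Qint P K s q0 M j <= 1.
Proof.
apply: (hit_lower_frac KP s1 sK); first by rewrite !mulr_ge0 ?invr_ge0.
  exact: edge_low_gt0.
exact: edge_low_le_a.
Qed.

(** With y = j a + j M s / K, 1 / (1 + y) >= 1 - y. The errors are 2 j d from [degree_q0], j^2 d and
    j^2 B from the two parts of y, and the last multiple of d from the j + j m vertices missing in
    the exponent. *)
Lemma Qint_exp M (B : R) : A * (M%:R * (s%:R / K%:R)) <= B ->
  (1 - Qint P K s q0 M j) ^+ (n - j - j * m) <=
  expR (- (j%:R * A) + ((2 * j%:R + j%:R ^+ 2 + (j + j * m)%:R * j%:R) * d + j%:R ^+ 2 * B)).
Proof.
move=> hB; set Q := Qint _ _ _ _ _ _; have /andP[Q0 Q1] : 0 <= Q <= 1 := Qint_bounds M.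
apply: le_trans (one_sub_exp _ Q0 Q1) _; rewrite ler_expR.
have jR : 1 <= j%:R :> R by rewrite ler1n.
pose y := j%:R * a + j%:R * (M%:R * (s%:R / K%:R)).
have MK : 0 <= M%:R * (s%:R / K%:R) :> R by rewrite mulr_ge0 // divr_ge0.
have y0 : 0 <= y by rewrite addr_ge0 ?mulr_ge0 // ltW.
have b0 : 0 <= q0 ^+ 2 / a by rewrite divr_ge0 ?sqr_ge0 ?ltW.
have QE : Q = j%:R * (q0 ^+ 2 / a) / (1 + y).
  rewrite /Q /Qint /y; congr (_ * _^-1); last by rewrite addrA.
  by rewrite mulrA.
have Qle : Q <= j%:R * a.
  rewrite QE ler_pdivrMr; last lra.
  have h : q0 ^+ 2 / a <= a.
    rewrite ler_pdivrMr // -expr2.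
    by rewrite lerXn2r ?nnegrE ?(ltW a0) ?(ltW edge_low_gt0) ?edge_low_le_a.
  apply: (@le_trans _ _ (j%:R * a)); first by rewrite ler_wpM2l.
  by rewrite ler_peMr ?mulr_ge0 ?(ltW a0) //; lra.
have Qge : j%:R * (q0 ^+ 2 / a) * (1 - y) <= Q.
  rewrite QE; apply: ler_wpM2l; first by rewrite mulr_ge0.
  rewrite -[leRHS]mul1r ler_pdivlMr; last lra.
  have : 0 <= y ^+ 2 by rewrite sqr_ge0.
  lra.
have nQ : j%:R * A - (2 * j%:R + j%:R ^+ 2) * d - j%:R ^+ 2 * B <= n%:R * Q.
  apply: le_trans (ler_wpM2l (ltW nR) Qge).
  have -> : n%:R * (j%:R * (q0 ^+ 2 / a) * (1 - y)) =
     j%:R * (n%:R * (q0 ^+ 2 / a)) - j%:R * (n%:R * (q0 ^+ 2 / a)) * y by ring.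
  have h1 := ler_wpM2l (ltW (lt_le_trans ltr01 jR)) degree_q0.
  have h2 : j%:R * (n%:R * (q0 ^+ 2 / a)) * y <= j%:R * A * y.
    by rewrite ler_wpM2r // ler_wpM2l // degree_q0_le.
  have h3 : j%:R * A * y = j%:R ^+ 2 * (A * a) + j%:R ^+ 2 * (A * (M%:R * (s%:R / K%:R))).
    by rewrite /y; ring.
  have j2 : 0 <= j%:R ^+ 2 :> R by rewrite sqr_ge0.
  have h4 := ler_wpM2l j2 aad; have h5 := ler_wpM2l j2 hB.
  lra.
have hN : n%:R - (j + j * m)%:R <= (n - j - j * m)%:R :> R.
  by rewrite -subnDA ler_natrB.
have h6 := ler_wpM2l Q0 hN.
have h7 : Q * (j + j * m)%:R <= (j + j * m)%:R * j%:R * d.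
  rewrite mulrC -mulrA ler_wpM2l //; apply: le_trans Qle _.
  by rewrite ler_wpM2l.
move: h6; rewrite mulrBr [Q * n%:R]mulrC; lra.
Qed.

(** The last term dominates: each of the others is at most A^(m-1) <= A^m d. *)
Lemma exp_sum_le : \sum_(i < m.+1) A ^+ i / i`!%:R <= A ^+ m / m`!%:R * expR ((m * m`!)%:R * d).
Proof.
apply: (@le_trans _ _ (A ^+ m / m`!%:R * (1 + (m * m`!)%:R * d))); last first.
  by rewrite ler_wpM2l ?expR_ge1Dx // divr_ge0 // exprn_ge0 // ltW.
rewrite big_ord_recr /= addrC mulrDr mulr1 lerD2l.
have -> : A ^+ m / m`!%:R * ((m * m`!)%:R * d) = \sum_(i < m) A ^+ m * d.
  by rewrite sumr_const card_ord natrM -[_ *+ m]mulr_natl; field; rewrite gt_eqF.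
apply: ler_sum => i _.
apply: (@le_trans _ _ (A ^+ i)).
  by rewrite ler_pdivrMr ?ltr0n ?fact_gt0 // ler_peMr ?exprn_ge0 ?(ltW A0) // ler1n fact_gt0.
apply: (@le_trans _ _ (A ^+ m * A^-1)).
  rewrite ler_pdivlMr // -exprSr; apply: ler_weXn2l => //; exact: ltn_ord.
by rewrite ler_wpM2l // exprn_ge0 // ltW.
Qed.

(** [B] will be of order sqrt(ln n); the resulting factor exp (j^2 B) is harmless because it is
    multiplied by x. *)
Lemma low_deg_upper (U : {set 'I_n}) M (B : R) : #|U| = j -> A * (M%:R * (s%:R / K%:R)) <= B ->
  Pr mu (fun w : {ffun 'I_n -> {set 'I_P}} => [forall u in U, low_deg s m w u]) <=
    p ^+ j * (expR ((j%:R * (m * m`!)%:R + (2 * j%:R + j%:R ^+ 2 + (j + j * m)%:R * j%:R)) * d)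
      + j%:R ^+ 2 * x * (1 + j%:R) ^+ (j * m) * m`!%:R ^+ j *
        expR ((2 * j%:R + j%:R ^+ 2 + (j + j * m)%:R * j%:R) * d + j%:R ^+ 2 * B))
    + j%:R ^+ 2 * x ^+ M.+1.
Proof.
move=> Uj hB.
have U0 : (0 < #|U|)%N by rewrite Uj.
have := low_deg_prob_le KP s1 sK (U := U) edge_low_gt0 edge_low_le U0 m M.
rewrite Uj => /le_trans; apply.
have x0 : 0 <= x by rewrite /ratio divr_ge0 ?exprn_ge0.
set C := 2 * _ + _ + _.
have h0 := Qint_exp (M := 0) (B := 0); rewrite mul0r mulr0 in h0.
have {}h0 := h0 (lexx _); rewrite mulr0 addr0 -/C in h0.
have hM := Qint_exp hB; rewrite -/C in hM.
have pj : p ^+ j = A ^+ (j * m) * expR (- (j%:R * A)) / m`!%:R ^+ j.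
  by rewrite /poisson_weight expr_div_n exprMn -exprM mulnC -expRM_natl mulrN.
rewrite natrX mulrDr -addrA [leRHS]addrC lerD2l [leRHS]addrC lerD //.
  rewrite /few_bound -/(scaled_degree R s n K P).
  have -> : p ^+ j * (j%:R ^+ 2 * x * (1 + j%:R) ^+ (j * m) * m`!%:R ^+ j * expR (C * d + j%:R ^+ 2 * B))
     = j%:R ^+ 2 * x * ((1 + j%:R) * A) ^+ (j * m) * expR (- (j%:R * A) + (C * d + j%:R ^+ 2 * B)).
    have cancel (u w y z E F : R) : w != 0 -> y * E / w * (z * u * w * F) = z * (u * y) * (E * F).
      by move=> w0; field.
    rewrite pj [expR (- _ + _)]expRD [((1 + _) * _) ^+ _]exprMn; apply: cancel; apply: expf_neq0; exact: lt0r_neq0.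
  rewrite -[leRHS]mulrA; apply: ler_wpM2l; first by apply: mulr_ge0 => //; apply: sqr_ge0.
  apply: ler_pM => //.
  - by rewrite exprn_ge0 // addr_ge0 // !mulr_ge0 // ltW.
  - by rewrite exprn_ge0 // subr_ge0; have /andP[] := Qint_bounds M.
  - apply: lerXn2r; rewrite ?nnegrE.
    + by rewrite addr_ge0 // !mulr_ge0 // ltW.
    + by rewrite mulr_ge0 ?(ltW A0) // addr_ge0.
    + by rewrite mulrCA mulrDl mul1r lerD2r.
have -> : p ^+ j * expR ((j%:R * (m * m`!)%:R + C) * d) =
   (A ^+ m / m`!%:R * expR ((m * m`!)%:R * d)) ^+ j * expR (- (j%:R * A) + C * d).
  have -> : (j%:R * (m * m`!)%:R + C) * d = j%:R * ((m * m`!)%:R * d) + C * d by ring.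
  have e (z y : R) : p ^+ j * expR (j%:R * z + y) =
      (A ^+ m / m`!%:R * expR z) ^+ j * expR (- (j%:R * A) + y).
    rewrite !expRD -mulrN !expRM_natl /poisson_weight -[A ^+ m * _ / _]mulrAC.
    by rewrite !(@exprMn R j (A ^+ m / m`!%:R)); ring.
  exact: e.
apply: ler_pM => //.
- by rewrite exprn_ge0 //; apply: sumr_ge0 => i _; rewrite divr_ge0 // exprn_ge0 // ltW.
- by rewrite exprn_ge0 // subr_ge0; have /andP[] := Qint_bounds 0.
apply: lerXn2r; rewrite ?nnegrE; last exact: exp_sum_le.
- by apply: sumr_ge0 => i _; rewrite divr_ge0 // exprn_ge0 // ltW.
- by rewrite mulr_ge0 ?expR_ge0 // divr_ge0 // exprn_ge0 // ltW.
Qed.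

(** Every factor of [low_deg_prob_ge] is its leading value times some 1 - u with 0 <= u <= 1/2,
    hence at least that value times exp (- 2 u). Only the power with exponent n needs the sharper
    second-order bound. *)
Lemma low_deg_lower (U : {set 'I_n}) : #|U| = j ->
  x <= d -> n%:R^-1 <= d -> (j * j + j + j * m + (1 + j))%:R * d <= 1 / 2 ->
  p ^+ j * expR (- ((2 * (j * j) + 2 * (j * m) * ((j + j * m) + (1 + j)) + 2 * (j * j))%:R * d)) <=
  Pr mu (fun w : {ffun 'I_n -> {set 'I_P}} => [forall u in U, low_deg s m w u]).
Proof.
move=> Uj xd nd Cd.
have U0 : (0 < #|U|)%N by rewrite Uj.
have jR : 1 <= j%:R :> R by rewrite ler1n.
have x0 : 0 <= x by rewrite /ratio divr_ge0 ?exprn_ge0.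
have Cle (i : nat) : (i <= j * j + j + j * m + (1 + j))%N -> i%:R * d <= 1 / 2.
  by move=> hi; apply: le_trans Cd; rewrite ler_wpM2r // ler_nat.
have ja : j%:R * a <= 1 / 2.
  have hj : (j <= j * j + j + j * m + (1 + j))%N by apply: leq_trans (leq_addl 1 j) _; apply: leq_addl.
  by apply: le_trans (Cle j hj); rewrite ler_wpM2l.
(* The relative loss per factor in the falling factorial. *)
pose u1 : R := (j + j * m)%:R / n%:R.
have u10 : 0 <= u1 by rewrite divr_ge0.
have u1d : u1 <= (j + j * m)%:R * d by rewrite ler_wpM2l.
have u12 : u1 <= 1 / 2.
  apply: le_trans u1d _; apply: Cle.
  apply: leq_trans (leq_addr (1 + j) _); rewrite -addnA; exact: leq_addl.
(* The relative loss in replacing [a] by q0 - j a^2. *)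
pose u2 : R := (1 + j%:R) * d.
have u20 : 0 <= u2 by rewrite mulr_ge0 // addr_ge0.
have u22 : u2 <= 1 / 2.
  have -> : u2 = (1 + j)%:R * d by rewrite /u2 natrD.
  by apply: Cle; exact: leq_addl.
have q1 : a * (1 - u2) <= q0 - j%:R * a ^+ 2.
  have h1 : a - q0 <= a * d.
    rewrite -(ler_pM2l nR); apply: le_trans gap _.
    by rewrite mulrA -/(scaled_degree R s n K P) ler_peMl.
  have h2 : j%:R * a ^+ 2 <= j%:R * (a * d) by rewrite ler_wpM2l // expr2 ler_wpM2l // ltW.
  rewrite /u2; lra.
have q1_0 : 0 <= q0 - j%:R * a ^+ 2.
  by apply: le_trans q1; rewrite mulr_ge0 ?(ltW a0) //; lra.
have ja1 : j%:R * a <= 1 by lra.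
have := low_deg_prob_ge KP s1 sK (U := U) edge_low_le m; rewrite Uj.
move=> /(_ q1_0 ja1); apply: le_trans.
have hx : expR (- (2 * (j * j)%:R * d)) <= 1 - (j ^ 2)%:R * x.
  have e1 : (j ^ 2)%:R * x <= (j * j)%:R * d by rewrite -mulnn ler_wpM2l.
  apply: le_trans (exp_one_sub _ _).
  - by rewrite ler_expR lerN2 mulrA ler_wpM2l // -mulnn.
  - by rewrite mulr_ge0.
  - by apply: le_trans e1 _; apply: Cle; rewrite -!addnA leq_addr.
have hff : (n%:R * (1 - u1)) ^+ (j * m) <= ((n - j) ^_ (j * m))%:R.
  apply: (@le_trans _ _ (((n - j - j * m) ^ (j * m))%:R)); last by rewrite ler_nat ffact_ge_expn.
  rewrite natrX; apply: lerXn2r; rewrite ?nnegrE //.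
    by rewrite mulr_ge0 //; lra.
  have -> : n%:R * (1 - u1) = n%:R - (j + j * m)%:R by rewrite /u1; field; rewrite gt_eqF.
  by rewrite -subnDA ler_natrB.
have hq : (a * (1 - u2)) ^+ (j * m) <= (q0 - j%:R * a ^+ 2) ^+ (j * m).
  by apply: lerXn2r; rewrite ?nnegrE // mulr_ge0 ?(ltW a0) //; lra.
have he : expR (- (j%:R * A) - 2 * (j * j)%:R * d) <= (1 - j%:R * a) ^+ n.
  (* [1 - y >= exp (- y - 2 y^2)] on [0, 1/2] keeps the error at n a^2. *)
  pose y := j%:R * a.
  have y0 : 0 <= y by rewrite mulr_ge0 // ltW.
  have hy : expR (- y - 2 * y ^+ 2) <= 1 - y.
    rewrite -opprD expRN -[leRHS]invrK lef_pV2 ?posrE ?expR_gt0 ?invr_gt0 //; last by rewrite /y; lra.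
    apply: le_trans (expR_ge1Dx _).
    have h : 0 < 1 - y by rewrite /y; lra.
    rewrite -[leLHS]mul1r ler_pdivrMr //.
    have : 0 <= y ^+ 2 * (1 - 2 * y) by rewrite mulr_ge0 ?sqr_ge0 // /y; lra.
    rewrite expr2; lra.
  apply: (@le_trans _ _ (expR (- y - 2 * y ^+ 2) ^+ n)).
    rewrite -expRM_natl ler_expR mulrBr /scaled_degree.
    have -> : n%:R * (2 * y ^+ 2) = 2 * (j * j)%:R * (n%:R * a * a) by rewrite /y natrM; ring.
    have -> : n%:R * - y = - (j%:R * (n%:R * a)) by rewrite /y; ring.
    by rewrite lerD2l lerN2 ler_wpM2l // mulr_ge0.
  by apply: lerXn2r; rewrite ?nnegrE ?expR_ge0 // subr_ge0 /y; lra.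
have hu1 := exp_one_sub u10 u12; have hu2 := exp_one_sub u20 u22.
have hu : expR (- (2 * ((j + j * m)%:R + (1 + j)%:R) * d)) <= (1 - u1) * (1 - u2).
  apply: le_trans (ler_pM (expR_ge0 _) (expR_ge0 _) hu1 hu2).
  by rewrite -expRD ler_expR /u2; rewrite natrD; lra.
have pj : p ^+ j = A ^+ (j * m) * expR (- (j%:R * A)) / m`!%:R ^+ j.
  by rewrite /poisson_weight expr_div_n exprMn -exprM mulnC -expRM_natl mulrN.
set hh := (X in _ <= _ * X).
have hhe : p ^+ j * expR (- (2 * ((j + j * m)%:R + (1 + j)%:R) * d)) ^+ (j * m) * expR (- (2 * (j * j)%:R * d)) <= hh.
  have -> : p ^+ j * expR (- (2 * ((j + j * m)%:R + (1 + j)%:R) * d)) ^+ (j * m) * expR (- (2 * (j * j)%:R * d)) =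
     (A ^+ (j * m) * expR (- (2 * ((j + j * m)%:R + (1 + j)%:R) * d)) ^+ (j * m)) / m`!%:R ^+ j * expR (- (j%:R * A) - 2 * (j * j)%:R * d).
    by rewrite pj expRD; ring.
  rewrite /hh natrX.
  apply: ler_pM => //; rewrite ?expR_ge0 //.
    by rewrite divr_ge0 ?exprn_ge0 // mulr_ge0 ?exprn_ge0 ?expR_ge0 // ltW.
  rewrite [leRHS]mulrAC ler_wpM2r ?invr_ge0 ?exprn_ge0 //.
  apply: le_trans (ler_pM _ _ hff hq).
  - rewrite -!exprMn; apply: lerXn2r; rewrite ?nnegrE ?mulr_ge0 ?expR_ge0 ?(ltW A0) ?(ltW a0) //; try lra.
    have -> : n%:R * (1 - u1) * (a * (1 - u2)) = A * ((1 - u1) * (1 - u2)) by rewrite /scaled_degree; ring.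
    by rewrite ler_wpM2l // ltW.
  - by rewrite exprn_ge0 // mulr_ge0 //; lra.
  - by rewrite exprn_ge0 // mulr_ge0 ?(ltW a0) //; lra.
have p0 := ltW poisson_weight_gt0.
apply: le_trans (ler_pM (expR_ge0 _) _ hx hhe); last first.
  by rewrite !mulr_ge0 ?exprn_ge0 ?expR_ge0.
have rot (E F G : R) : E * (p ^+ j * F * G) = p ^+ j * (E * F * G) by rewrite !mulrA [E * _]mulrC.
rewrite rot ler_wpM2l ?exprn_ge0 // -expRM_natl -!expRD ler_expR.
apply: eq_ler.
by rewrite !natrD !natrM; ring.
Qed.

End MomentBounds.

(** * Asymptotics of the moments, uniformly in the regime *)

Section LowMoment.
Variables (R : realType) (s k : nat) (c : R).
Hypotheses (s1 : (1 <= s)%N) (c0 : 0 < c).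
Local Notation t := (@sqln R).
Local Notation A := (scaled_degree R s).
Local Notation a := (fun K P : nat => edge_rate R P K s).
Local Notation regime := (regime s k c).
Local Notation m := k.-1.

Lemma degree_ge1 : \forall n \near \oo, forall K P, regime n K P -> 1 <= A n K P.
Proof.
near=> n => K P reg.
have t2 : 2 <= t n by near: n; exact: sqln_large.
have /andP[h _] : 9 / 10 * t n ^+ 2 <= A n K P <= 11 / 10 * t n ^+ 2.
  by move: K P reg; near: n; exact: regime_degree.
apply: le_trans h; have : 2 ^+ 2 <= t n ^+ 2 by apply: lerXn2r; rewrite ?nnegrE ?sqln_ge0.
lra.
Unshelve. all: by end_near.
Qed.

Lemma regime_facts (d : R) : 0 < d -> \forall n \near \oo, forall K P, regime n K P ->
  [/\ n%:R * (a K P - edge_low R s K P) <= d, A n K P * a K P <= d, a K P <= d,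
      1 <= A n K P & (A n K P)^-1 <= d] /\ ratio R K P <= d.
Proof.
move=> d0; near=> n => K P reg.
have t1 : 1 <= t n by near: n; exact: sqln_large.
have t2 : 2 <= t n by near: n; exact: sqln_large.
have hA : 9 / 10 * t n ^+ 2 <= A n K P <= 11 / 10 * t n ^+ 2.
  by move: K P reg; near: n; exact: regime_degree.
have h1 : n%:R * (a K P - edge_low R s K P) <= d.
  by move: K P reg {hA}; near: n; exact: edge_gap_small.
have h2 : ratio R K P * expR (0 * t n) <= d.
  by move: K P reg {h1 hA}; near: n; exact: ratio_small.
have h3 : expR (4 * t n - 1 * t n ^+ 2) <= d / 4.
  by near: n; apply: exp_sqln_small => //; lra.
have h4 : d^-1 * 2 <= t n by near: n; exact: sqln_large.
have A1 : 1 <= A n K P by move: K P reg {h1 h2 hA}; near: n; exact: degree_ge1.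
have [sK KP cP _] := reg.
have A0 : 0 < A n K P by apply: lt_le_trans A1.
have Aa : A n K P * a K P <= d.
  rewrite (edge_rate_degree _ _ _ t1) mulrA -expr2.
  have := degree_le_exp t1 hA => hAe.
  apply: (@le_trans _ _ ((2 * expR (2 * t n)) ^+ 2 * expR (- t n ^+ 2))).
    rewrite ler_wpM2r ?expR_ge0 //; apply: lerXn2r => //; rewrite nnegrE ?mulr_ge0 ?expR_ge0 // ltW.
  have -> : (2 * expR (2 * t n)) ^+ 2 * expR (- t n ^+ 2) = 4 * expR (4 * t n - 1 * t n ^+ 2).
    have -> : 4 * t n - 1 * t n ^+ 2 = 2 * t n + 2 * t n + - t n ^+ 2 by ring.
    by rewrite !expRD; ring.
  by lra.
split; last by move: h2; rewrite mul0r expR0 mulr1.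
split => //.
  by apply: le_trans Aa; rewrite ler_peMl // ltW // edge_rate_gt0.
rewrite -[leRHS]invrK lef_pV2 ?posrE ?invr_gt0 //.
have d1 : 0 <= d^-1 by rewrite invr_ge0 ltW.
have /andP[h _] := hA; apply: le_trans h.
have := ler_pM _ _ h4 t2; rewrite expr2 => h; have := h _ _; lra.
Unshelve. all: by end_near.
Qed.

(** The left-hand side is n^(-2) up to logarithms, whereas the weight is at least exp (- A) / m!,
    and A <= (11/10) ln n. *)
Lemma ratio_pow_small (e : R) : 0 < e -> \forall n \near \oo, forall K P, regime n K P ->
  ratio R K P ^+ (2 * s) <= e * poisson_weight m (A n K P).
Proof.
move=> e0; near=> n => K P reg.
have t1 : 1 <= t n by near: n; exact: sqln_large.
have hA : 9 / 10 * t n ^+ 2 <= A n K P <= 11 / 10 * t n ^+ 2.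
  by move: K P reg; near: n; exact: regime_degree.
have A1 : 1 <= A n K P.
  by move: K P reg {hA}; near: n; exact: degree_ge1.
have [sK KP cP _] := reg.
have mf : 0 < m`!%:R :> R by rewrite ltr0n fact_gt0.
have sf : 0 < s`!%:R :> R by rewrite ltr0n fact_gt0.
have h : expR (4 * t n - 9 / 10 * t n ^+ 2) <= e / (4 * s`!%:R ^+ 2 * m`!%:R).
  near: n; apply: exp_sqln_small; first lra.
  by rewrite divr_gt0 // !mulr_gt0 ?exprn_gt0.
rewrite mulnC exprM (ratio_pow s K P t1) exprMn.
move: h; rewrite ler_pdivlMr ?mulr_gt0 ?exprn_gt0 // => h.
have hAe := degree_le_exp t1 hA.
have A2 : (A n K P * expR (- t n ^+ 2)) ^+ 2 <= 4 * expR (4 * t n - 9 / 10 * t n ^+ 2) * expR (- A n K P).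
  apply: (@le_trans _ _ ((2 * expR (2 * t n) * expR (- t n ^+ 2)) ^+ 2)).
    apply: lerXn2r; rewrite ?nnegrE ?mulr_ge0 ?expR_ge0 ?(le_trans ler01 A1) //.
    by rewrite ler_wpM2r ?expR_ge0.
  have -> : (2 * expR (2 * t n) * expR (- t n ^+ 2)) ^+ 2 = 4 * expR (4 * t n - 2 * t n ^+ 2).
    have -> : 4 * t n - 2 * t n ^+ 2 = 2 * t n + 2 * t n + (- t n ^+ 2) + - t n ^+ 2 by ring.
    by rewrite !expRD; ring.
  rewrite -mulrA ler_pM2l // -expRD ler_expR; have /andP[_] := hA; lra.
have pw : expR (- A n K P) / m`!%:R <= poisson_weight m (A n K P).
  rewrite /poisson_weight ler_wpM2r ?invr_ge0 ?(ltW mf) // ler_peMl ?expR_ge0 //.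
  by rewrite exprn_ege1.
apply: le_trans (ler_wpM2l (ltW e0) pw).
apply: le_trans (ler_wpM2l (sqr_ge0 _) A2) _.
rewrite [leRHS]mulrA ler_pdivlMr // [leRHS]mulrC; apply: le_trans (ler_wpM2l (expR_ge0 _) h).
by apply: eq_ler; ring.
Unshelve. all: by end_near.
Qed.

Lemma low_deg_asymp j (e : R) : (0 < j)%N -> 0 < e -> \forall n \near \oo, forall K P, regime n K P ->
  forall U : {set 'I_n}, #|U| = j ->
  poisson_weight m (A n K P) ^+ j * (1 - e) <=
    Pr (unif_subset R K) (fun w : {ffun 'I_n -> {set 'I_P}} => [forall u in U, low_deg s m w u]) <=
  poisson_weight m (A n K P) ^+ j * (1 + e).
Proof.
move=> j0 e0.
pose C1 : R := j%:R * (m * m`!)%:R + (2 * j%:R + j%:R ^+ 2 + (j + j * m)%:R * j%:R).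
pose C2 : R := (2 * (j * j) + 2 * (j * m) * ((j + j * m) + (1 + j)) + 2 * (j * j))%:R.
pose C3 : R := 2 * j%:R + j%:R ^+ 2 + (j + j * m)%:R * j%:R.
pose C4 : R := (j * j + j + j * m + (1 + j))%:R.
pose C5 : R := j%:R ^+ 2 * (1 + j%:R) ^+ (j * m) * m`!%:R ^+ j.
have C10 : 0 <= C1 by rewrite /C1 !addr_ge0 ?mulr_ge0 ?sqr_ge0.
have C20 : 0 <= C2 by rewrite ler0n.
have C30 : 0 <= C3 by rewrite /C3 !addr_ge0 ?mulr_ge0 ?sqr_ge0.
have C40 : 0 <= C4 by rewrite ler0n.
have C50 : 0 <= C5 by rewrite /C5 !mulr_ge0 ?exprn_ge0 ?addr_ge0.
(* [W] bounds each constant multiplying [d], so that with [d] below every such product is at most e'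
   / 6. *)
pose W := 1 + C1 + C2 + C3 + C4.
have W0 : 1 <= W by rewrite /W; lra.
pose e' := Num.min e 1.
have e'0 : 0 < e' by rewrite lt_min e0 ltr01.
have [e'e e'1] : e' <= e /\ e' <= 1 by rewrite !ge_min !lexx orbT.
pose d := e' / (6 * W).
have d0 : 0 < d by rewrite divr_gt0 // mulr_gt0 // (lt_le_trans ltr01).
have Wd : W * d = e' / 6 by rewrite /d; field; rewrite gt_eqF // (lt_le_trans ltr01).
have Cd (C : R) : C <= W -> C * d <= e' / 6 by move=> h; rewrite -Wd ler_wpM2r // ltW.
have C1d : C1 * d <= e' / 6 by apply: Cd; rewrite /W; lra.
have C2d : C2 * d <= e' / 6 by apply: Cd; rewrite /W; lra.
have C3d : C3 * d <= e' / 6 by apply: Cd; rewrite /W; lra.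
have C4d : C4 * d <= e' / 6 by apply: Cd; rewrite /W; lra.
have d12 : d <= 1 / 2 by have := Cd 1 W0; lra.
(* Thus x^(M+1) is the [j]-th power of x^(2s) and is negligible against the [j]-th power of the
   Poisson weight. *)
pose M := (2 * j * s).-1.
have MS : M.+1 = (2 * s * j)%N.
  have js0 : (0 < 2 * j * s)%N by rewrite !muln_gt0 j0 s1.
  by rewrite /M (prednK js0) -!mulnA [(j * s)%N]mulnC.
pose b := Num.sqrt (9 / 10 * c).
have b0 : 0 < b by rewrite sqrtr_gt0 mulr_gt0 //; lra.
(* From A <= (11/10) t^2 and K >= b t one gets A M s / K <= CB t. *)
pose CB := 11 / 10 * (M%:R * s%:R) / b.
pose e1 := e' / (6 * (C5 + 1)).
have e10 : 0 < e1 by rewrite divr_gt0 // mulr_gt0 // ltr_wpDl.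
pose e2 := Num.min 1 (e' / (6 * j%:R ^+ 2)).
have e20 : 0 < e2.
  by rewrite lt_min ltr01 divr_gt0 // mulr_gt0 // exprn_gt0 // ltr0n.
near=> n => K P reg.
have t1 : 1 <= t n by near: n; exact: sqln_large.
have hA : 9 / 10 * t n ^+ 2 <= A n K P <= 11 / 10 * t n ^+ 2.
  by move: K P reg; near: n; exact: regime_degree.
have [[gap aad ad A1 Ad] xd] : [/\ n%:R * (a K P - edge_low R s K P) <= d, A n K P * a K P <= d, a K P <= d,
      1 <= A n K P & (A n K P)^-1 <= d] /\ ratio R K P <= d.
  by move: K P reg {hA}; near: n; exact: regime_facts.
have hx : ratio R K P * expR ((j%:R ^+ 2 * CB) * t n) <= e1 / 3.
  by move: K P reg {gap aad ad A1 Ad xd hA}; near: n; apply: ratio_small => //; rewrite divr_gt0.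
have hxs : ratio R K P ^+ (2 * s) <= e2 * poisson_weight m (A n K P).
  by move: K P reg {gap aad ad A1 Ad xd hA hx}; near: n; exact: ratio_pow_small.
have nd : n%:R^-1 <= d.
  rewrite -[leRHS]invrK lef_pV2 ?posrE ?invr_gt0 //; last by have [_ ->] := sqlnK t1; apply: expR_gt0.
  by near: n; exact: nbhs_infty_ger.
have n0 : (0 < n)%N by near: n; exact: nbhs_infty_gt.
have [sK KP cP _] := reg.
have K0 : 0 < K%:R :> R by rewrite ltr0n (leq_trans s1).
have p0 : 0 < poisson_weight m (A n K P) by apply: poisson_weight_gt0 A1.
have p1 : 0 < poisson_weight m (A n K P) ^+ j by rewrite exprn_gt0.
move=> U Uj; apply/andP; split.
  have h4 : C4 * d <= 1 / 2 by clear -s1 c0 k C4d e'1; lra.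
  apply: le_trans (low_deg_lower s1 sK KP n0 j0 (m := m) (ltW d0) gap aad ad A1 Uj xd nd h4).
  rewrite -/C2.
  rewrite ler_pM2l //; apply: le_trans (expR_ge1Dx _); clear -s1 c0 k C2d e'e e'0; lra.
pose B := CB * t n.
have hB : A n K P * (M%:R * (s%:R / K%:R)) <= B.
  have -> : A n K P * (M%:R * (s%:R / K%:R)) = A n K P * (M%:R * s%:R) / K%:R by ring.
  rewrite ler_pdivrMr //.
  have Kb : b * t n <= K%:R by apply: K_ge (proj1 (andP hA)).
  apply: le_trans (_ : _ <= 11 / 10 * t n ^+ 2 * (M%:R * s%:R)) _.
    by rewrite ler_wpM2r ?mulr_ge0 //; have /andP[] := hA.
  have -> : 11 / 10 * t n ^+ 2 * (M%:R * s%:R) = B * (b * t n).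
    by rewrite /B /CB; field; rewrite gt_eqF.
  apply: ler_wpM2l => //; rewrite /B /CB mulr_ge0 ?sqln_ge0 // divr_ge0 ?(ltW b0) // !mulr_ge0 //; lra.
apply: le_trans (low_deg_upper m s1 sK KP n0 j0 gap aad ad A1 Ad d12 Uj hB) _.
rewrite -/C1 -/C3.
have y0 := C10; have ex y : 0 <= y -> y <= e' / 6 -> expR y <= 1 + e' / 3.
  move=> z0 z1; have -> : y = (2 * y) / 2 by field.
  apply: le_trans (expR_half_le _ _) _; clear -s1 c0 k z0 z1 e'1; lra.
have E1 : expR (C1 * d) <= 1 + e' / 3 by apply: ex => //; rewrite mulr_ge0 // ltW.
have E2 : j%:R ^+ 2 * ratio R K P * (1 + j%:R) ^+ (j * m) * m`!%:R ^+ j * expR (C3 * d + j%:R ^+ 2 * B) <= e' / 6.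
  have -> : j%:R ^+ 2 * ratio R K P * (1 + j%:R) ^+ (j * m) * m`!%:R ^+ j * expR (C3 * d + j%:R ^+ 2 * B) =
    C5 * (ratio R K P * expR (j%:R ^+ 2 * CB * t n)) * expR (C3 * d).
    have -> : C3 * d + j%:R ^+ 2 * B = j%:R ^+ 2 * CB * t n + C3 * d by rewrite /B addrC mulrA.
    have regroup (u v w z E F : R) : u * v * w * z * (E * F) = u * w * z * (v * E) * F by ring.
    by rewrite expRD regroup.
  have E3 : expR (C3 * d) <= 2.
    by apply: le_trans (ex _ _ C3d) _; [rewrite mulr_ge0 // ltW | clear -s1 c0 k e'1; lra].
  apply: (@le_trans _ _ (C5 * (e1 / 3) * 2)).
    apply: ler_pM => //; try exact: expR_ge0.
      by apply: mulr_ge0 => //; apply: mulr_ge0; [exact: ltW (ratio_gt0 _ s1 sK KP) | exact: expR_ge0].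
    by rewrite ler_wpM2l.
  have -> : C5 * (e1 / 3) * 2 = e' / 6 * (C5 / (C5 + 1) * (2 / 3)).
    by rewrite /e1; field; rewrite gt_eqF // ltr_wpDl.
  rewrite -[leRHS]mulr1 ler_pM2l ?divr_gt0 //.
  apply: (@le_trans _ _ (1 * (2 / 3))); last by clear -s1 c0 k; lra.
  by rewrite ler_wpM2r ?divr_ge0 // ler_pdivrMr ?ltr_wpDl // mul1r lerDl.
have E4 : j%:R ^+ 2 * ratio R K P ^+ M.+1 <= poisson_weight m (A n K P) ^+ j * (e' / 6).
  rewrite MS exprM.
  apply: (@le_trans _ _ (j%:R ^+ 2 * (e2 * poisson_weight m (A n K P)) ^+ j)).
    rewrite ler_wpM2l ?sqr_ge0 //; apply: lerXn2r; rewrite ?nnegrE //.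
      by rewrite exprn_ge0 // ltW // (ratio_gt0 _ s1 sK KP).
    by rewrite mulr_ge0 // ltW.
  rewrite exprMn mulrA mulrC ler_pM2l //.
  have h1 : e2 ^+ j <= e2.
    by rewrite -[leRHS]expr1; apply: ler_wiXn2l => //; [exact: ltW | rewrite ge_min lexx].
  apply: le_trans (ler_wpM2l (sqr_ge0 _) h1) _.
  have h2 : e2 <= e' / (6 * j%:R ^+ 2) by rewrite ge_min lexx orbT.
  apply: le_trans (ler_wpM2l (sqr_ge0 _) h2) _.
  by apply: eq_ler; field; rewrite pnatr_eq0 -lt0n.
apply: le_trans (lerD (ler_wpM2l (ltW p1) (lerD E1 E2)) E4) _.
rewrite -mulrDr ler_pM2l //; clear -s1 c0 k e'e e'0; lra.
Unshelve. all: by end_near.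
Qed.

Definition low_mean n K P : R := n%:R * poisson_weight m (A n K P).

Lemma low_moment0 n K P : (K <= P)%N -> low_moment R n P K s m 0 = 1.
Proof.
move=> KP; rewrite /low_moment; under (eq_Ex (@unif_ge0 R P K)) => w _ do rewrite bin0.
exact: (Ex_const (unif_sum1 R KP)).
Qed.

Lemma low_moment_asymp j (e : R) : 0 < e -> \forall n \near \oo, forall K P, regime n K P ->
  `|low_moment R n P K s m j - low_mean n K P ^+ j / j`!%:R| <= e * low_mean n K P ^+ j.
Proof.
move=> e0; case: j => [|j].
  near=> n => K P [sK KP _ _].
  by rewrite low_moment0 // !expr0 fact0 divr1 subrr normr0 mulr1 ltW.
set l := j.+1; pose e' := Num.min (e / 2) 1.
have e'0 : 0 < e' by rewrite lt_min ltr01 divr_gt0.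
have [e'e e'1] : e' <= e / 2 /\ e' <= 1 by rewrite !ge_min !lexx orbT.
near=> n => K P reg.
have lowd : forall U : {set 'I_n}, #|U| = l ->
  poisson_weight m (A n K P) ^+ l * (1 - e') <=
    Pr (unif_subset R K) (fun w : {ffun 'I_n -> {set 'I_P}} => [forall u in U, low_deg s m w u]) <=
  poisson_weight m (A n K P) ^+ l * (1 + e').
  by move: K P reg; near: n; exact: low_deg_asymp.
have A1 : 1 <= A n K P by move: K P reg {lowd}; near: n; exact: degree_ge1.
have n0 : 0 < n%:R :> R by near: n; exact: nbhs_infty_gtr.
have hn : 2 * (l%:R * l%:R) / e' <= n%:R by near: n; exact: nbhs_infty_ger.
have p0 : 0 < poisson_weight m (A n K P) by apply: poisson_weight_gt0 A1.
have /andP[lo hi] := low_moment_bounds lowd.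
have lf : 0 < l`!%:R :> R by rewrite ltr0n fact_gt0.
have binE : 'C(n, l)%:R = (n ^_ l)%:R / l`!%:R :> R.
  by rewrite -bin_ffact natrM mulfK // gt_eqF.
have ub : (n ^_ l)%:R <= n%:R ^+ l :> R by rewrite -natrX ler_nat ffact_leq_expn.
have lb : n%:R ^+ l * (1 - e') <= (n ^_ l)%:R :> R.
  apply: (@le_trans _ _ ((n%:R - l%:R) ^+ l)); last first.
    apply: (@le_trans _ _ ((n - l) ^ l)%:R); last by rewrite ler_nat ffact_ge_expn.
    rewrite natrX; apply: lerXn2r; rewrite ?nnegrE ?ler_natrB //.
    rewrite subr_ge0; apply: le_trans hn; rewrite ler_pdivlMr //.
    apply: (@le_trans _ _ l%:R); first by rewrite ler_piMr.
    have : 1 <= l%:R :> R by rewrite ler1n.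
    move=> l1; have := ler_wpM2r (ler0n R l) l1; lra.
  pose y := l%:R / n%:R : R.
  have -> : n%:R - l%:R = n%:R * (1 - y) by rewrite /y; field; rewrite gt_eqF.
  rewrite exprMn ler_wpM2l ?exprn_ge0 //.
  have ly : 2 * l%:R * y <= e'.
    have hl (z : R) : 2 * (z * z) / e' <= n%:R -> 2 * z * (z / n%:R) <= e'.
      by rewrite [_ * (_ / _)]mulrA !ler_pdivrMr //; lra.
    exact: hl.
  have y0 : 0 <= y by rewrite divr_ge0.
  have y1 : y <= 1 / 2.
    have l1 : 1 <= l%:R :> R by rewrite ler1n.
    have := ler_wpM2r y0 l1; lra.
  apply: (@le_trans _ _ (expR (- (2 * y)) ^+ l)); last first.
    by apply: lerXn2r; rewrite ?nnegrE ?expR_ge0 ?exp_one_sub //; lra.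
  by rewrite -expRM_natl; apply: le_trans (expR_ge1Dx _); lra.
have lam : low_mean n K P ^+ l = n%:R ^+ l * poisson_weight m (A n K P) ^+ l by rewrite exprMn.
set pl := poisson_weight _ _ ^+ l in lo hi lam *.
have pl0 : 0 < pl by rewrite exprn_gt0.
set L := _ ^+ l in lam *.
have L0 : 0 <= L by rewrite lam mulr_ge0 ?exprn_ge0 // ltW.
have hi' : low_moment R n P K s m l <= L / l`!%:R * (1 + e').
  apply: le_trans hi _; rewrite mulrA ler_wpM2r //; first by rewrite addr_ge0 // ltW.
  rewrite binE lam mulrAC ler_wpM2r ?invr_ge0 ?(ltW lf) //.
  by rewrite ler_wpM2r // ltW.
have lo' : L / l`!%:R * (1 - e') ^+ 2 <= low_moment R n P K s m l.
  apply: le_trans lo; rewrite expr2 !mulrA ler_wpM2r ?subr_ge0 //.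
  rewrite binE lam [leRHS]mulrAC [leLHS]mulrAC ler_wpM2r ?invr_ge0 ?(ltW lf) //.
  by rewrite mulrAC ler_wpM2r // ltW.
have LL : L / l`!%:R <= L by rewrite ler_pdivrMr // ler_peMr // ler1n fact_gt0.
have LL0 : 0 <= L / l`!%:R by rewrite divr_ge0 // ltW.
have h1 : L / l`!%:R * e' <= L * (e / 2) by apply: ler_pM => //; exact: ltW.
have h2 : 0 <= L / l`!%:R * e' ^+ 2 by rewrite mulr_ge0 ?sqr_ge0.
rewrite ler_norml; apply/andP; split.
  move: lo'; rewrite expr2; move: h2; rewrite expr2; lra.
by move: hi'; have := mulr_ge0 L0 (ltW e0); lra.
Unshelve. all: by end_near.
Qed.

End LowMoment.

(* r b is a multiple of the probability that an outside vertex sees the cut, and its denominator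
   accounts for vertices seeing it twice: either the denominator is close to 1, or r dl > 1/100 and
   the factor r cancels against r dl, or r is of order n / L at least. *)
Lemma cut_exponent (R : realType) (n r m L A a b D dl H N : R) :
  0 < n -> 1 <= L -> 9 / 10 * L <= A <= 11 / 10 * L -> A = n * a -> 89 / 100 * L <= n * b ->
  2 <= r -> 2 * r <= n -> 0 <= m -> 200 * m <= n -> 0 <= D -> 0 <= dl -> 150 * dl <= 1 ->
  1 + r * a + D <= H -> 600 * L * H <= n -> n - r - m <= N ->
  12 / 10 * L <= r * b / (1 + r * a + Num.min D (r * dl)) * N /\
  43 / 100 * (L / H) * r <= r * b / (1 + r * a + Num.min D (r * dl)) * N.
Proof.
move=> n0 L1 /andP[A1 A2] Aa nb r2 rn m0 mn D0 dl0 dl1 HD nH hN.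
set E := Num.min _ _; set V := 1 + _ + E.
have rd0 : 0 <= r * dl by rewrite mulr_ge0 //; lra.
have [ED Er E0] : [/\ E <= D, E <= r * dl & 0 <= E] by rewrite /E !ge_min !lexx orbT le_min D0.
have a0 : 0 < a by rewrite -(pmulr_rgt0 _ n0) -Aa; clear -A1 L1; lra.
have ra0 : 0 <= r * a by rewrite mulr_ge0 ?(ltW a0) //; lra.
have V0 : 0 < V by rewrite /V; clear -ra0 E0; lra.
have VH : V <= H by rewrite /V; clear -ED HD; lra.
have H0 : 0 < H by apply: lt_le_trans VH.
have b0 : 0 < b by rewrite -(pmulr_rgt0 _ n0); clear -nb L1; lra.
have N1 : 99 / 200 * n <= N by clear -rn mn hN; lra.
have bN : 44 / 100 * L <= b * N.
  have := ler_wpM2l (ltW b0) N1; clear -nb L1; lra.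
have QE : r * b / V * N = r * (b * N) / V by rewrite mulrAC mulrA.
have r0 : 0 < r := lt_le_trans (ltr0Sn _ 1) r2.
have second : 44 / 100 * (L / H) * r <= r * b / V * N.
  rewrite QE ler_pdivlMr //.
  have h1 : 44 / 100 * (L / H) * r * V <= 44 / 100 * L * r.
    have -> : 44 / 100 * L * r = 44 / 100 * (L / H) * r * H by field; rewrite gt_eqF.
    by rewrite ler_wpM2l // !mulr_ge0 ?invr_ge0 ?(ltW H0) ?(ltW r0) //; clear -L1; lra.
  apply: le_trans h1 _; rewrite [leRHS]mulrC ler_wpM2r //; exact: ltW.
have LH0 : 0 <= L / H * r by rewrite !mulr_ge0 ?invr_ge0 ?(ltW H0) ?(ltW r0) // (le_trans ler01).
split; last by clear -LH0 second; lra.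
(* If [r] is at least of order n / L, the bound linear in [r] already implies the constant one. *)
have big : 5 / 1000 * n <= L * r -> 12 / 10 * L <= r * b / V * N.
  move=> h; apply: le_trans second.
  have -> : 44 / 100 * (L / H) * r = 44 / 100 * (L * r) / H by ring.
  rewrite ler_pdivlMr //; clear -n0 h nH; lra.
case: (lerP (r * a) (1 / 100)) => h1; last first.
  apply: big; have : n / 100 <= r * A.
    rewrite Aa mulrCA; have := ler_wpM2l (ltW n0) (ltW h1); clear; lra.
  have := ler_wpM2l (ltW r0) A2; clear -n0; lra.
case: (lerP (r + m) (n / 100)) => h2; last first.
  apply: big; have := ler_wpM2r (ltW r0) L1; clear -h2 mn; lra.
have bN' : 88 / 100 * L <= b * N.
  have N2 : 99 / 100 * n <= N by clear -h2 hN; lra.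
  have := ler_wpM2l (ltW b0) N2; clear -nb L1; lra.
have rbN := ler_wpM2l (ltW r0) bN'.
have L0 : 0 <= L := le_trans ler01 L1.
have Lr : 2 * L <= L * r by rewrite mulrC ler_wpM2l.
rewrite QE ler_pdivlMr //; apply: le_trans rbN.
(* Here r b N >= 0.88 L r. Either V <= 1.02 and r >= 2 suffices, or V <= 102 r dl, where 150 dl <= 1
   gives 1.2 V <= 0.816 r. *)
case: (lerP (r * dl) (1 / 100)) => h3.
  have V1 : V <= 102 / 100 by rewrite /V; clear -h1 h3 Er; lra.
  have := ler_wpM2l L0 V1; clear -Lr L0; lra.
have V1 : V <= 102 * (r * dl) by rewrite /V; clear -h1 h3 Er; lra.
have := ler_wpM2l L0 V1; have := ler_wpM2l (mulr_ge0 L0 (ltW r0)) dl1; clear -Lr L0; lra.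
Qed.

Lemma bernoulli_le (R : realDomainType) (y : R) r : 0 <= y -> 1 + r%:R * y <= (1 + y) ^+ r.
Proof.
move=> y0; elim: r => [|r IH]; first by rewrite mul0r addr0.
have h : 1 <= (1 + y) ^+ r by apply: exprn_ege1; rewrite lerDl.
rewrite exprSr; apply: le_trans (ler_wpM2r _ IH); last by rewrite addr_ge0.
have : 0 <= r%:R * y * y by rewrite !mulr_ge0.
rewrite -natr1; lra.
Qed.

(** * A single term of the sum over cut sizes *)

Section CutTerm.
Variables (R : realType) (s n K P m M r : nat) (D q0 L : R).
Hypotheses (s1 : (1 <= s)%N) (sK : (s <= K)%N) (KP : (K <= P)%N).
Local Notation a := (edge_rate R P K s).
Local Notation A := (scaled_degree R s n K P).
Local Notation dl := (M%:R * (s%:R / K%:R) : R).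
Hypotheses (nE : n%:R = expR L) (L1 : 1 <= L) (hA : 9 / 10 * L <= A <= 11 / 10 * L)
  (nb : 89 / 100 * L <= n%:R * (q0 ^+ 2 / a)) (q00 : 0 < q0) (q0a : q0 <= a)
  (r2 : (1 < r)%N) (rn : (r.*2 <= n)%N) (mn : 200 * m%:R <= n%:R :> R) (D0 : 0 <= D).

Let a0 : 0 < a := edge_rate_gt0 R KP s1 sK.
Let n0 : 0 < n%:R :> R. Proof. by rewrite nE expR_gt0. Qed.
Let A0 : 0 < A. Proof. by have /andP[h _] := hA; have := L1; lra. Qed.
Let rR : 2 <= r%:R :> R. Proof. by rewrite ler_nat. Qed.
Let rnR : 2 * r%:R <= n%:R :> R. Proof. by rewrite -natrM ler_nat mul2n. Qed.
Let rA0 : 0 <= 1 + r%:R * A. Proof. by rewrite addr_ge0 // mulr_ge0 // ltW. Qed.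
Let A10 : 0 <= 1 + A. Proof. by rewrite addr_ge0 // ltW. Qed.
Let dl0 : 0 <= dl. Proof. by rewrite mulr_ge0 // divr_ge0. Qed.
Let NR : n%:R - r%:R - m%:R <= (n - r - m)%:R :> R.
Proof. by apply: le_trans (ler_natrB _ _ _); rewrite lerB // ler_natrB. Qed.

Local Notation Q := (Qlow P K s q0 M D r).
Let Q01 : 0 <= Q <= 1.
Proof.
apply: (hit_lower_frac KP s1 sK) => //; rewrite /Emin le_min D0 /= mulr_ge0 //.
Qed.

Lemma cut_boundE : cut_bound n P K s m M D q0 r = (1 + r%:R * A) ^+ m * (1 - Q) ^+ (n - r - m).
Proof. by rewrite /cut_bound /few_bound [n%:R * (r%:R * _)]mulrCA. Qed.

Let cut_bound0 : 0 <= cut_bound n P K s m M D q0 r.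
Proof.
have /andP[_ Q1] := Q01.
rewrite cut_boundE; apply: mulr_ge0; apply: exprn_ge0; last by rewrite subr_ge0.
exact: rA0.
Qed.

Lemma tree_countE : (4 ^ r.-1)%:R * n%:R ^+ r * a ^+ r.-1 = n%:R * (4 * A) ^+ r.-1.
Proof.
have -> : r = r.-1.+1 by rewrite prednK // ltnW.
rewrite /= natrX exprS; set i := r.-1; have -> : 4 * A = 4 * n%:R * a by rewrite /scaled_degree mulrA.
by rewrite !exprMn; ring.
Qed.

(** Let X be the exponent Q (n - r - m). The bound X >= 1.2 L spends at most 5/6 of X on the leading
    factor n = exp L, and X >= 0.43 (L / H) r spends at most a tenth on r (g + y), where exp g
    covers the tree and neighbourhood factors per vertex. *)
Lemma cut_term_sparse (H g y : R) : 150 * dl <= 1 -> 1 + r%:R * a + D <= H -> 600 * L * H <= n%:R ->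
  4 * A * (1 + A) ^+ m <= expR g -> 0 <= g -> g + y <= 43 / 1000 * (L / H) ->
  cut_term n P K s m M D q0 r <= expR (- y) ^+ r.
Proof.
move=> dl1 HD nH Gg g0 gy.
have [e1 e2] : 12 / 10 * L <= Q * (n - r - m)%:R /\ 43 / 100 * (L / H) * r%:R <= Q * (n - r - m)%:R.
  have := @cut_exponent R n%:R r%:R m%:R L A a (q0 ^+ 2 / a) D dl H (n - r - m)%:R
    n0 L1 hA (erefl _) nb rR rnR (ler0n _ _) mn D0 dl0 dl1 HD nH NR.
  by rewrite /Qlow /Emin -[r%:R * q0 ^+ 2 / a]mulrA.
have /andP[Q0 Q1] := Q01.
rewrite /cut_term; apply: (@le_trans _ _ (n%:R * (4 * A) ^+ r.-1 * cut_bound n P K s m M D q0 r)).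
  by rewrite ler_wpM2r // -tree_countE ge_min lexx.
rewrite cut_boundE.
have A40 : 1 <= 4 * A by have /andP[] := hA; have := L1; lra.
have h1 : (4 * A) ^+ r.-1 <= (4 * A) ^+ r by apply: ler_weXn2l => //; apply: leq_pred.
(* Bernoulli's inequality turns the neighbourhood factor into a cost per vertex of the cut. *)
have h2 : (1 + r%:R * A) ^+ m <= (1 + A) ^+ (r * m).
  rewrite exprM; apply: lerXn2r; rewrite ?nnegrE.
  - exact: rA0.
  - exact: exprn_ge0.
  - by apply: bernoulli_le; apply: ltW.
have h3 := one_sub_exp (n - r - m) Q0 Q1.
have h12 : (4 * A) ^+ r.-1 * (1 + r%:R * A) ^+ m <= expR (r%:R * g).
  apply: le_trans (_ : _ <= (4 * A * (1 + A) ^+ m) ^+ r) _; last first.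
    rewrite expRM_natl; apply: lerXn2r; rewrite ?nnegrE ?expR_ge0 //.
    apply: mulr_ge0; first by lra.
    exact: exprn_ge0.
  rewrite [leRHS]exprMn -exprM [(m * r)%N]mulnC; apply: ler_pM => //; apply: exprn_ge0; first by lra.
  exact: rA0.
apply: (@le_trans _ _ (expR L * expR (r%:R * g) * expR (- (Q * (n - r - m)%:R)))).
  have -> : n%:R * (4 * A) ^+ r.-1 * ((1 + r%:R * A) ^+ m * (1 - Q) ^+ (n - r - m)) =
    expR L * ((4 * A) ^+ r.-1 * (1 + r%:R * A) ^+ m) * (1 - Q) ^+ (n - r - m).
    by rewrite -nE !mulrA.
  apply: ler_pM => //; last by rewrite ler_wpM2l // expR_ge0.
  - apply: mulr_ge0; first exact: expR_ge0.
    apply: mulr_ge0; apply: exprn_ge0; first by lra.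
    exact: rA0.
  - by apply: exprn_ge0; rewrite subr_ge0.
rewrite -!expRD -expRM_natl ler_expR.
have r0 : 0 <= r%:R :> R by rewrite ler0n.
have := ler_wpM2l r0 gy; have := L1; lra.
Qed.

(** When r a dominates 2 + D, a fresh set misses the cut with probability at most 1/32, and the
    number 2^n of candidate sets is affordable. *)
Lemma cut_term_dense (d : R) : n%:R * (a - q0) <= d -> d <= 1 / 1000 -> 64 * (2 + D) < r%:R * a ->
  1 <= A -> cut_term n P K s m M D q0 r <= expR (m%:R * (2 * L + 1) - n%:R / 5).
Proof.
move=> gap d1 ra A1.
have /andP[Q0 Q1] := Q01.
have hQ : 1 - Q <= 1 / 32.
  rewrite lerBlDr addrC -lerBlDr.
  have E0 : 0 <= Emin K s M D r by rewrite /Emin le_min D0 /= mulr_ge0 //.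
  have ED : Emin K s M D r <= D by rewrite /Emin ge_min lexx.
  have V0 : 0 < 1 + r%:R * a + Emin K s M D r by have := D0; lra.
  rewrite /Qlow ler_pdivlMr //.
  have d0 : 0 <= d by apply: le_trans gap; rewrite mulr_ge0 ?(ltW n0) // subr_ge0.
  have q0d : a * (1 - d) <= q0.
    have : n%:R * (a - q0) <= n%:R * (a * d).
      apply: le_trans gap _; rewrite mulrA -/(scaled_degree R s n K P) ler_peMl //.
    by rewrite ler_pM2l //; lra.
  have q2 : a * (1 - 2 * d) <= q0 ^+ 2 / a.
    rewrite ler_pdivlMr //; apply: (@le_trans _ _ ((a * (1 - d)) ^+ 2)).
      have : 0 <= (a * d) ^+ 2 by rewrite sqr_ge0.
      rewrite !expr2; lra.
    by apply: lerXn2r; rewrite ?nnegrE ?(ltW q00) // mulr_ge0 ?(ltW a0) //; lra.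
  have ra0 : 0 <= r%:R * a by rewrite mulr_ge0 // ltW.
  have h1 := ler_wpM2l (ler0n R r) q2.
  have -> : r%:R * q0 ^+ 2 / a = r%:R * (q0 ^+ 2 / a) by rewrite mulrA.
  apply: le_trans h1.
  have h2 := ler_wpM2l ra0 d1.
  move: (D0) ED ra h2 => D0' ED ra h2.
  have -> : r%:R * (a * (1 - 2 * d)) = r%:R * a - 2 * (r%:R * a * d) by ring.
  lra.
rewrite /cut_term; apply: (@le_trans _ _ ((2 ^ n)%:R * cut_bound n P K s m M D q0 r)).
  by rewrite ler_wpM2r // ge_min lexx orbT.
rewrite cut_boundE.
have N1 : 99 / 200 * n%:R <= (n - r - m)%:R :> R by move: rnR mn NR; lra.
(* Since 1/32 <= exp (- 5/2) and at least 99 n / 200 vertices are available, the exponent exceeds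
   that of 2^n <= exp n by more than n / 5. *)
have h3 : (1 - Q) ^+ (n - r - m) <= expR (- (99 / 80 * n%:R)).
  apply: (@le_trans _ _ (expR (- (5 / 2)) ^+ (n - r - m))).
    apply: lerXn2r; rewrite ?nnegrE ?expR_ge0 ?subr_ge0 //; apply: le_trans hQ _.
    rewrite expRN -[leLHS]invrK lef_pV2 ?posrE ?expR_gt0 ?invr_gt0 ?divr_gt0 //.
    have -> : (1 / 32)^-1 = 2 ^+ 5 :> R by field.
    have -> : 5 / 2 = 5%:R * (1 / 2) :> R by field.
    rewrite expRM_natl; apply: lerXn2r; rewrite ?nnegrE ?expR_ge0 //.
    by have := @expR_half_le R 1 ler01 (lexx _); lra.
  by rewrite -expRM_natl ler_expR; lra.
have h4 : (2 ^ n)%:R <= expR n%:R :> R.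
  rewrite natrX -[n%:R in leRHS]mulr1 expRM_natl; apply: lerXn2r; rewrite ?nnegrE ?expR_ge0 //.
  by have := @expR_ge1Dx R 1; lra.
have h5 : (1 + r%:R * A) ^+ m <= expR (m%:R * (2 * L + 1)).
  rewrite expRM_natl; apply: lerXn2r; rewrite ?nnegrE ?expR_ge0 //.
  have rA : 1 + r%:R * A <= n%:R * (1 + A).
    have n2 : 2 <= n%:R :> R by have := rnR; have := rR; lra.
    have : r%:R * A <= n%:R * A by rewrite ler_wpM2r ?(ltW A0) //; have := rnR; have := rR; lra.
    lra.
  apply: le_trans rA _; have -> : 2 * L + 1 = L + (L + 1) by ring.
  rewrite expRD -nE ler_wpM2l ?(ltW n0) //.
  have e1 := @expR_half_le R 1 ler01 (lexx _).
  rewrite expRD mulrC.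
  have h : 1 + A <= 2 * expR L.
    have := expR_ge1Dx L; have /andP[_] := hA; have := L1; lra.
  apply: le_trans h _; rewrite ler_wpM2r ?expR_ge0 //.
  by have := @expR_ge1Dx R 1; lra.
have -> : m%:R * (2 * L + 1) - n%:R / 5 = n%:R + (m%:R * (2 * L + 1) + - (6 / 5 * n%:R)) by field.
rewrite !expRD; apply: ler_pM => //.
  apply: mulr_ge0; apply: exprn_ge0; last by rewrite subr_ge0.
  exact: rA0.
apply: ler_pM => //.
- exact: exprn_ge0.
- by apply: exprn_ge0; rewrite subr_ge0.
apply: le_trans h3 _; rewrite ler_expR; have := ltW n0; lra.
Qed.

End CutTerm.

Lemma geometric_le2 (R : realFieldType) (y : R) N : 0 <= y -> y <= 1 / 2 -> \sum_(i < N) y ^+ i <= 2.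
Proof.
move=> y0 y1; have := subrX1 y N => h.
have yN : 0 <= y ^+ N by rewrite exprn_ge0.
have S0 : 0 <= \sum_(i < N) y ^+ i by apply: sumr_ge0 => i _; rewrite exprn_ge0.
have := ler_wpM2r S0 y1; lra.
Qed.

(** * Absence of small cuts, uniformly in the regime *)

Section CutProb.
Variables (R : realType) (s k : nat) (c : R).
Hypotheses (s1 : (1 <= s)%N) (c0 : 0 < c).
Local Notation t := (@sqln R).
Local Notation A := (scaled_degree R s).
Local Notation regime := (regime s k c).
Local Notation m := k.-1.
Local Notation M := (3 * s).-1.
Local Notation b := (Num.sqrt (9 / 10 * c)).
Local Notation CD := (2 * s%:R * (11 / 10 * s%:R + 2 * M%:R) / b).

Lemma K_const_gt0 : 0 < b.
Proof. by rewrite sqrtr_gt0 mulr_gt0 //; lra. Qed.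

Lemma overlap_max_gt0 : (0 < M)%N.
Proof. by move: s1; case: s => // s' _; rewrite mulnS. Qed.

Lemma overlap_const_ge0 : 0 <= CD.
Proof. by rewrite divr_ge0 ?sqrtr_ge0 // mulr_ge0 // ?addr_ge0 ?mulr_ge0 //; lra. Qed.

Lemma sqln_pow4_le n : 1 <= t n -> t n ^+ 4 / 4 <= n%:R.
Proof.
move=> t1; have [_ ->] := sqlnK t1.
have -> : t n ^+ 4 / 4 = (t n ^+ 2 / 2) ^+ 2 by field.
have {2}-> : t n ^+ 2 = 2 * (t n ^+ 2 / 2) by field.
by apply: expR_ge_sqr; rewrite divr_ge0 ?sqr_ge0.
Qed.

(** The product of the tree and neighbourhood factors per vertex is polynomial in ln n, hence below
    any exponential of a multiple of sqrt(ln n). *)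
Lemma poly_degree_small (e : R) : 0 < e -> \forall n \near \oo, forall K P, regime n K P ->
  4 * A n K P * (1 + A n K P) ^+ m <= expR (e * t n).
Proof.
move=> e0; pose f := e / (4 * m.+1%:R).
have f0 : 0 < f by rewrite divr_gt0 // mulr_gt0 // ltr0n.
near=> n => K P reg.
have t1 : 1 <= t n by near: n; exact: sqln_large.
have tf : 5 / f ^+ 4 <= t n by near: n; exact: sqln_large.
have hA : 9 / 10 * t n ^+ 2 <= A n K P <= 11 / 10 * t n ^+ 2.
  by move: K P reg; near: n; exact: regime_degree.
have t2 : 1 <= t n ^+ 2 by rewrite exprn_ege1.
have h1 : 5 * t n ^+ 2 <= expR (4 * (f * t n)).
  apply: (@le_trans _ _ (((f * t n) ^+ 2) ^+ 2)).
    have -> : ((f * t n) ^+ 2) ^+ 2 = (f ^+ 4 * t n ^+ 2) * t n ^+ 2 by ring.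
    rewrite ler_wpM2r ?sqr_ge0 //; move: tf; rewrite ler_pdivrMr ?exprn_gt0 // => tf.
    apply: le_trans tf _; rewrite mulrC ler_wpM2l ?exprn_ge0 ?(ltW f0) //.
    by rewrite -[leLHS]expr1; apply: ler_weXn2l.
  have -> : 4 * (f * t n) = 2%:R * (2 * (f * t n)) by ring.
  rewrite expRM_natl; apply: lerXn2r; rewrite ?nnegrE ?expR_ge0 ?sqr_ge0 //.
  by apply: expR_ge_sqr; rewrite mulr_ge0 ?(ltW f0) // sqln_ge0.
have -> : e * t n = m.+1%:R * (4 * (f * t n)).
  have q0 : m.+1%:R != 0 :> R by rewrite pnatr_eq0.
  by rewrite /f; move: (m.+1%:R) q0 => q q0; field.
rewrite expRM_natl exprS; have /andP[A1 A2] := hA.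
apply: ler_pM; try lra.
  by apply: exprn_ge0; lra.
by apply: lerXn2r; rewrite ?nnegrE ?expR_ge0 //; lra.
Unshelve. all: by end_near.
Qed.

(** As M + 1 = 3 s, the first error is at most a constant times exp (6 t) / n. The constant [CD] is
    such that, with K >= b t, the deviation exponent D K / (2 M s) exceeds the mean term (11/10) s
    t^2 / M by 2 t^2; one t^2 of this pays for the n = exp (t^2) vertices. *)
Lemma not_good_small (e : R) : 0 < e -> \forall n \near \oo, forall K P, regime n K P ->
  Pr (unif_subset R K) (fun w : {ffun 'I_n -> {set 'I_P}} => ~~ good K s M (CD * t n) w [set: 'I_n]%SET) <= e.
Proof.
move=> e0; near=> n => K P reg.
have t1 : 1 <= t n by near: n; exact: sqln_large.
have te : (e / 2)^-1 <= t n by near: n; exact: sqln_large.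
have hA : 9 / 10 * t n ^+ 2 <= A n K P <= 11 / 10 * t n ^+ 2.
  by move: K P reg; near: n; exact: regime_degree.
have sf : 0 < s`!%:R :> R by rewrite ltr0n fact_gt0.
have h : expR (6 * t n - 1 * t n ^+ 2) <= e / 2 / (8 * s`!%:R ^+ 3).
  by near: n; apply: exp_sqln_small => //; rewrite !divr_gt0 // mulr_gt0 // exprn_gt0.
have [sK KP cP _] := reg.
have t0 := sqln_ge0 R n.
have [_ nE] := sqlnK t1.
have t2 : t n <= t n ^+ 2 by rewrite -[leLHS]expr1; apply: ler_weXn2l.
have e20 : 0 < e / 2 by rewrite divr_gt0.
apply: le_trans (not_good_prob _ KP s1 sK overlap_max_gt0 (mulr_ge0 overlap_const_ge0 t0)) _.
have -> : e = e / 2 + e / 2 by field.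
apply: lerD.
  have -> : M.+1 = (s * 3)%N by rewrite prednK ?muln_gt0 // mulnC.
  rewrite exprM -[_ / P%:R]/(ratio R K P) (ratio_pow s K P t1).
  have hAe := degree_le_exp t1 hA.
  have A0 : 0 <= A n K P by have := degree_ge t1 hA; lra.
  apply: (@le_trans _ _ (n%:R ^+ 2 * (s`!%:R * (2 * expR (2 * t n) * expR (- t n ^+ 2))) ^+ 3)).
    rewrite ler_wpM2l ?sqr_ge0 //; apply: lerXn2r; rewrite ?nnegrE.
    - by rewrite mulr_ge0 ?(ltW sf) // mulr_ge0 ?expR_ge0.
    - by rewrite mulr_ge0 ?(ltW sf) // !mulr_ge0 ?expR_ge0.
    - by rewrite ler_pM2l // ler_wpM2r ?expR_ge0.
  move: h; rewrite ler_pdivlMr ?mulr_gt0 ?exprn_gt0 //; apply: le_trans.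
  rewrite nE; apply: eq_ler.
  have -> : 6 * t n - 1 * t n ^+ 2 = t n ^+ 2 + t n ^+ 2 + 2 * t n + 2 * t n + 2 * t n - t n ^+ 2 - t n ^+ 2 - t n ^+ 2 by ring.
  by rewrite !expRD; ring.
apply: le_trans (ler_expN e20 te).
rewrite nE -!expRD ler_expR.
have K0 : 0 < K%:R :> R by rewrite ltr0n (leq_trans s1).
have M0 : 0 < M%:R :> R by rewrite ltr0n overlap_max_gt0.
have s0 : 0 < s%:R :> R by rewrite ltr0n.
have bK : b * t n <= K%:R by apply: K_ge (proj1 (andP hA)).
have h1 : (11 / 10 * s%:R + 2 * M%:R) * t n ^+ 2 / M%:R <= CD * t n * K%:R / (2 * M%:R * s%:R).
  apply: (@le_trans _ _ (CD * t n * (b * t n) / (2 * M%:R * s%:R))).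
    by apply: eq_ler; field; rewrite !gt_eqF // K_const_gt0.
  by rewrite ler_wpM2r ?invr_ge0 ?mulr_ge0 // ler_wpM2l // mulr_ge0 // overlap_const_ge0.
have h2 : n%:R * (s%:R * edge_rate R P K s / M%:R) <= 11 / 10 * s%:R * t n ^+ 2 / M%:R.
  have -> : n%:R * (s%:R * edge_rate R P K s / M%:R) = s%:R / M%:R * A n K P by rewrite /scaled_degree; ring.
  have -> : 11 / 10 * s%:R * t n ^+ 2 / M%:R = s%:R / M%:R * (11 / 10 * t n ^+ 2) by ring.
  by rewrite ler_wpM2l ?divr_ge0 //; have /andP[] := hA.
have h3 : (11 / 10 * s%:R + 2 * M%:R) * t n ^+ 2 / M%:R = 11 / 10 * s%:R * t n ^+ 2 / M%:R + 2 * t n ^+ 2.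
  by field; rewrite gt_eqF.
move: h2; rewrite {1}nE; lra.
Unshelve. all: by end_near.
Qed.

Lemma cut_prob_small (e : R) : 0 < e -> \forall n \near \oo, forall K P, regime n K P ->
  cut_prob_total R n P K s k <= e.
Proof.
move=> e0; pose CH : R := 129 + 65 * CD.
have CH0 : 0 < CH by have := overlap_const_ge0; rewrite /CH; lra.
(* Both g and y will be f t, and 2 f = 0.04 / CH is below the admissible 0.043 / CH. *)
pose f : R := 2 / 100 / CH.
have f0 : 0 < f by rewrite divr_gt0 //; lra.
pose e' := Num.min (1 / 2) (e / 8).
have e'0 : 0 < e' by rewrite lt_min divr_gt0 //= divr_gt0.
have [e'1 e'e] : e' <= 1 / 2 /\ e' <= e / 8 by rewrite !ge_min !lexx orbT.
have [d d0 d1] : exists2 d : R, 0 < d & d <= 1 / 1000 by exists (1 / 1000); lra.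
near=> n => K P reg.
have t1 : 1 <= t n by near: n; exact: sqln_large.
have hA : 9 / 10 * t n ^+ 2 <= A n K P <= 11 / 10 * t n ^+ 2.
  by move: K P reg; near: n; exact: regime_degree.
have gap : n%:R * (edge_rate R P K s - edge_low R s K P) <= d.
  by move: K P reg {hA}; near: n; exact: edge_gap_small.
have A1 : 1 <= A n K P by move: K P reg {hA gap}; near: n; exact: degree_ge1.
have G : 4 * A n K P * (1 + A n K P) ^+ m <= expR (f * t n).
  by move: K P reg {hA gap A1}; near: n; exact: poly_degree_small.
have ng : Pr (unif_subset R K) (fun w : {ffun 'I_n -> {set 'I_P}} => ~~ good K s M (CD * t n) w [set: 'I_n]%SET) <= e / 4.
  by move: K P reg {hA gap A1 G}; near: n; apply: not_good_small; rewrite divr_gt0.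
have mn : 200 * m%:R <= n%:R :> R by near: n; exact: nbhs_infty_ger.
have tdl : 150 * (M%:R * s%:R) / b <= t n by near: n; exact: sqln_large.
have tH : 2400 * CH <= t n by near: n; exact: sqln_large.
have ty : e'^-1 / f <= t n by near: n; exact: sqln_large.
have tz : e'^-1 <= t n by near: n; exact: sqln_large.
have tm : 20 * (2 + 3 * m%:R) <= t n by near: n; exact: sqln_large.
have [sK KP cP _] := reg.
have t0 := sqln_ge0 R n; have [_ nE] := sqlnK t1.
have t2 : t n <= t n ^+ 2 by rewrite -[leLHS]expr1; apply: ler_weXn2l.
have L1 : 1 <= t n ^+ 2 := le_trans t1 t2.
have nt4 := sqln_pow4_le t1.
have K0 : 0 < K%:R :> R by rewrite ltr0n (leq_trans s1).
have n0 : 0 < n%:R :> R by rewrite nE expR_gt0.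
have nN : (0 < n)%N by rewrite -(@ltr0n R).
have bK : b * t n <= K%:R by apply: K_ge (proj1 (andP hA)).
have D0 : 0 <= CD * t n by rewrite mulr_ge0 // overlap_const_ge0.
have q00 : 0 < edge_low R s K P by apply: (edge_low_gt0 nN gap A1); clear -s1 c0 k d1; lra.
have q0a : edge_low R s K P <= edge_rate R P K s := edge_low_le_a R s1 sK KP.
have nb : 89 / 100 * t n ^+ 2 <= n%:R * (edge_low R s K P ^+ 2 / edge_rate R P K s).
  apply: le_trans (degree_q0 s1 sK KP gap); have /andP[] := hA; clear -s1 c0 k d1 L1; lra.
have dl1 : 150 * (M%:R * (s%:R / K%:R)) <= 1 :> R.
  have -> : 150 * (M%:R * (s%:R / K%:R)) = 150 * (M%:R * s%:R) / K%:R :> R by ring.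
  rewrite ler_pdivrMr // mul1r; apply: le_trans bK.
  by rewrite [leRHS]mulrC -ler_pdivrMr ?K_const_gt0 //.
have nH : 600 * t n ^+ 2 * (CH * t n) <= n%:R.
  apply: le_trans nt4.
  have -> : 600 * t n ^+ 2 * (CH * t n) = 2400 * CH * (t n ^+ 3 / 4) by field.
  have -> : t n ^+ 4 / 4 = t n * (t n ^+ 3 / 4) by ring.
  by rewrite ler_wpM2r // divr_ge0 ?exprn_ge0.
have y1 : expR (- (f * t n)) <= e'.
  by apply: ler_expN => //; rewrite mulrC -ler_pdivrMr.
have z1 : (n.+1)%:R * expR (m%:R * (2 * t n ^+ 2 + 1) - n%:R / 5) <= 2 * e'.
  apply: (@le_trans _ _ (2 * n%:R * expR (m%:R * (2 * t n ^+ 2 + 1) - n%:R / 5))).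
    rewrite ler_wpM2r ?expR_ge0 // -natr1.
    have : 1 <= n%:R :> R by rewrite ler1n.
    clear -s1 c0 k; lra.
  rewrite -mulrA ler_pM2l // nE -expRD.
  apply: le_trans (ler_expN e'0 tz); rewrite ler_expR -nE.
  have h1 : (2 + 3 * m%:R) * t n ^+ 2 <= n%:R / 5.
    apply: (@le_trans _ _ (t n ^+ 4 / 4 / 5)); last by rewrite ler_wpM2r.
    have -> : t n ^+ 4 / 4 / 5 = t n ^+ 2 / 20 * t n ^+ 2 by field.
    rewrite ler_wpM2r ?sqr_ge0 //; clear -s1 c0 k tm t2; lra.
  have h2 := ler_wpM2l (ler0n R m) L1.
  clear -s1 c0 k h1 h2 t2; lra.
have := cut_prob_total_le n KP s1 sK k M D0 q00 (@edge_low_le R s K P s1 sK KP).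
move=> /le_trans; apply.
have -> : e = e / 4 + 3 / 4 * e by field.
apply: lerD => //.
set y := expR _ in y1; set z := expR _ in z1.
have [y0 z0] : 0 <= y /\ 0 <= z by rewrite !expR_ge0.
apply: (@le_trans _ _ (\sum_(r < n.+1 | (1 < r)%N && (r.*2 <= n)%N) (y ^+ r + z))).
  apply: ler_sum => r /andP[r2 rn].
  (* Sparse terms sum to a geometric series in y; dense terms are at most z each. *)
  case: (lerP (r%:R * edge_rate R P K s) (64 * (2 + CD * t n))) => ra.
    apply: (@le_trans _ _ (y ^+ r)); last by rewrite lerDl.
    apply: (cut_term_sparse s1 sK KP nE L1 hA nb q00 q0a r2 rn mn D0 dl1 _ nH G).
    - rewrite /CH; clear -s1 c0 k t1 ra; lra.
    - by rewrite mulr_ge0 // ltW.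
    - have -> : t n ^+ 2 / (CH * t n) = t n / CH by field; rewrite !gt_eqF // (lt_le_trans ltr01).
      rewrite /f; have : 0 <= t n / CH by rewrite divr_ge0 // ltW.
      clear -s1 c0 k; lra.
  apply: (@le_trans _ _ z); last by rewrite lerDr exprn_ge0.
  exact: (cut_term_dense M s1 sK KP nE L1 hA q00 q0a r2 rn mn D0 gap d1 ra A1).
rewrite big_split /=; apply: (@le_trans _ _ (2 * e' + 2 * e')); last by clear -s1 c0 k e0 e'e; lra.
apply: lerD.
  rewrite big_mkcond big_ord_recl /= add0r.
  apply: (@le_trans _ _ (\sum_(i < n) y * y ^+ i)).
    apply: ler_sum => i _; rewrite -exprS; case: ifP => // _; exact: exprn_ge0.
  rewrite -mulr_sumr mulrC ler_pM //; first by apply: sumr_ge0 => i _; rewrite exprn_ge0.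
  by apply: geometric_le2 => //; apply: le_trans e'1.
apply: le_trans z1; rewrite big_mkcond /=.
apply: (@le_trans _ _ (\sum_(i < n.+1) z)); last by rewrite sumr_const card_ord mulr_natl.
by apply: ler_sum => i _; case: ifP.
Unshelve. all: by end_near.
Qed.

End CutProb.

Transparent edge_rate edge_low.

Lemma one_sub_pow_ge (R : realDomainType) (y : R) i : 0 <= y -> y <= 1 -> 1 - i%:R * y <= (1 - y) ^+ i.
Proof.
move=> y0 y1; elim: i => [|i IH]; first by rewrite mul0r subr0.
have y2 : 0 <= 1 - y by rewrite subr_ge0.
rewrite exprSr; apply: le_trans (ler_wpM2r y2 IH).
have : 0 <= i%:R * y * y by rewrite !mulr_ge0.
rewrite -natr1; lra.
Qed.

Lemma first_crossing (p : pred nat) i j : (i <= j)%N -> p i -> ~~ p j ->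
  exists2 l, (i <= l < j)%N & p l && ~~ p l.+1.
Proof.
elim: j => [|j IH]; first by rewrite leqn0 => /eqP -> ->.
rewrite leq_eqVlt => /predU1P[-> ->//|ij] pi npj.
case: (boolP (p j)) => pj; first by exists j; rewrite ?pj ?npj // ltnSn andbT -ltnS.
have [l /andP[il lj] h] := IH ij pi pj; exists l => //.
by rewrite il ltnW // ltnS ltnW.
Qed.

(** * From uniform estimates to limits *)

Section Limits.
Variables (R : realType) (s k : nat) (c : R).
Hypotheses (s1 : (1 <= s)%N) (k1 : (1 <= k)%N) (c0 : 0 < c).
Local Notation t := (@sqln R).
Local Notation A := (scaled_degree R s).
Local Notation regime := (regime s k c).
Local Notation m := k.-1.
Local Notation alpha := (alpha_of R s k).
Local Notation lam := (low_mean R s k).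
Local Notation pv n K P := (isg_prob R n P K (fun w => k_vertex_connected k (isg_adj s w))).
Local Notation pe n K P := (isg_prob R n P K (fun w => k_edge_connected k (isg_adj s w))).
Local Notation pd n K P := (isg_prob R n P K (fun w => min_degree_ge k (isg_adj s w))).

(** By definition of alpha, n exp (- A) = exp (- alpha) / (ln n)^m, so the power of A appears
    divided by that of ln n. *)
Lemma low_mean_eq n K P : 1 <= t n ->
  lam n K P = (A n K P / t n ^+ 2) ^+ m * expR (- alpha n K P) / m`!%:R.
Proof.
move=> t1; have [tE nE] := sqlnK t1.
have t2 : 0 < t n ^+ 2 by rewrite exprn_gt0 // (lt_le_trans ltr01).
have -> : - alpha n K P = t n ^+ 2 + m%:R * ln (t n ^+ 2) + - A n K P.
  by rewrite /alpha_of -tE; ring.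
rewrite !expRD -nE expRM_natl lnK ?posrE // expr_div_n /low_mean /poisson_weight.
by field; rewrite expf_neq0 ?gt_eqF // pnatr_eq0 -lt0n fact_gt0.
Qed.

Lemma prob_bounds n K P : (K <= P)%N -> (k < n)%N -> [/\ 0 <= pv n K P <= pd n K P & 0 <= pe n K P <= pd n K P].
Proof.
move=> KP kn; rewrite !(isg_probE R KP); split; rewrite (Pr_ge0 (@unif_ge0 R P K)) /=.
  by have /andP[] := vertex_connected_prob R P K s k1 kn.
by have /andP[] := edge_connected_prob R P K s k1 (leq_ltn_trans k1 kn).
Qed.

Lemma connected_close (e : R) : 0 < e -> \forall n \near \oo, forall K P, regime n K P ->
  pd n K P - e <= pv n K P /\ pd n K P - e <= pe n K P.
Proof.
move=> e0; near=> n => K P reg.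
have cut : cut_prob_total R n P K s k <= e by move: K P reg; near: n; exact: cut_prob_small.
have kn : (k < n)%N by near: n; exact: nbhs_infty_gt.
have [sK KP _ _] := reg; rewrite !(isg_probE R KP).
have /andP[v _] := vertex_connected_prob R P K s k1 kn.
have /andP[w _] := edge_connected_prob R P K s k1 (leq_ltn_trans k1 kn).
split; [apply: le_trans v | apply: le_trans w]; rewrite lerB //.
Unshelve. all: by end_near.
Qed.

Lemma low_mean_le (e : R) : 0 < e -> exists B : R, \forall n \near \oo, forall K P, regime n K P ->
  B <= alpha n K P -> lam n K P <= e.
Proof.
move=> e0; pose e' := e / 2 ^+ m.
have e'0 : 0 < e' by rewrite divr_gt0 // exprn_gt0.
exists e'^-1; near=> n => K P reg hB.
have t1 : 1 <= t n by near: n; exact: sqln_large.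
have hA : 9 / 10 * t n ^+ 2 <= A n K P <= 11 / 10 * t n ^+ 2.
  by move: K P reg {hB}; near: n; exact: regime_degree.
have t2 : 0 < t n ^+ 2 by rewrite exprn_gt0 // (lt_le_trans ltr01).
rewrite low_mean_eq //.
have h1 := ler_expN e'0 hB.
have h2 : (A n K P / t n ^+ 2) ^+ m <= 2 ^+ m.
  have /andP[a1 a2] := hA.
  apply: lerXn2r; rewrite ?nnegrE // ?divr_ge0 ?(ltW t2) //; first by lra.
  by rewrite ler_pdivrMr //; lra.
have mf : 1 <= m`!%:R :> R by rewrite ler1n fact_gt0.
rewrite ler_pdivrMr ?(lt_le_trans ltr01 mf) //.
apply: (@le_trans _ _ (2 ^+ m * e')).
  apply: ler_pM => //; rewrite ?expR_ge0 // exprn_ge0 // divr_ge0 ?(ltW t2) //.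
  by have /andP[] := hA; lra.
by rewrite /e' mulrCA mulfV ?expf_neq0 // ler_wpM2l // ltW.
Unshelve. all: by end_near.
Qed.

Lemma low_mean_ge (z : R) : exists B : R, \forall n \near \oo, forall K P, regime n K P ->
  alpha n K P <= - B -> z <= lam n K P.
Proof.
pose e' := Num.max 1 z * m`!%:R * 2 ^+ m.
exists e'; near=> n => K P reg hB.
have t1 : 1 <= t n by near: n; exact: sqln_large.
have hA : 9 / 10 * t n ^+ 2 <= A n K P <= 11 / 10 * t n ^+ 2.
  by move: K P reg {hB}; near: n; exact: regime_degree.
have t2 : 0 < t n ^+ 2 by rewrite exprn_gt0 // (lt_le_trans ltr01).
have mf : 0 < m`!%:R :> R by rewrite ltr0n fact_gt0.
rewrite low_mean_eq // ler_pdivlMr //.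
have h2 : (2 ^+ m)^-1 <= (A n K P / t n ^+ 2) ^+ m.
  have /andP[a1 a2] := hA.
  rewrite -exprVn; apply: lerXn2r; rewrite ?nnegrE ?invr_ge0 // ?divr_ge0 ?(ltW t2) //; first by lra.
  by rewrite ler_pdivlMr //; lra.
have h1 : e' <= expR (- alpha n K P).
  by apply: le_trans (expR_ge1Dx _); lra.
have z1 : z <= Num.max 1 z by rewrite le_max lexx orbT.
have e0 : 0 <= e' by rewrite /e' !mulr_ge0 ?exprn_ge0 // ?(ltW mf) // le_max ler01.
apply: (@le_trans _ _ ((2 ^+ m)^-1 * e')); last first.
  by apply: ler_pM => //; rewrite invr_ge0 exprn_ge0.
rewrite /e' [leRHS]mulrC mulfK ?expf_neq0 // ler_wpM2r // ltW.
Unshelve. all: by end_near.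
Qed.

(** First moment method: Bonferroni with one term, the expected number of low-degree vertices being
    small. *)
Lemma prob_high (e : R) : 0 < e -> exists B : R, \forall n \near \oo, forall K P, regime n K P ->
  B <= alpha n K P -> [/\ 1 - e <= pv n K P, 1 - e <= pe n K P & 1 - e <= pd n K P].
Proof.
move=> e0; have e20 : 0 < e / 4 by rewrite divr_gt0.
have [B hB] := low_mean_le e20; exists B; near=> n => K P reg aB.
have l1 : lam n K P <= e / 4 by move: K P reg aB; near: n.
have [v w] : pd n K P - e / 4 <= pv n K P /\ pd n K P - e / 4 <= pe n K P.
  by move: K P reg {aB l1}; near: n; exact: connected_close.
have mom : `|low_moment R n P K s m 1 - lam n K P ^+ 1 / 1`!%:R| <= 1 * lam n K P ^+ 1.
  by move: K P reg {aB l1 v w}; near: n; exact: low_moment_asymp.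
have [sK KP _ _] := reg.
have : 1 - e / 2 <= pd n K P; last by move=> h; split; lra.
rewrite (isg_probE R KP).
have := min_degree_bonferroni R n P K s m 1.
rewrite prednK // big_ord1 expr0 mul1r low_moment0 //.
move: mom; rewrite !expr1 (_ : 1`! = 1)%N // divr1 mul1r !ler_norml => /andP[_ h1] /andP[h2 _].
lra.
Unshelve. all: by end_near.
Qed.

(** Chebyshev: with mean about lambda >= 8 / e, the variance is at most a small multiple of
    lambda^2. *)
Lemma prob_low (e : R) : 0 < e -> exists B : R, \forall n \near \oo, forall K P, regime n K P ->
  alpha n K P <= - B -> pd n K P <= e.
Proof.
move=> e0; pose f := Num.min (1 / 4) (e / 16).
have f0 : 0 < f by rewrite lt_min !divr_gt0.
have [f1 f2] : f <= 1 / 4 /\ f <= e / 16 by rewrite !ge_min !lexx orbT.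
have [B hB] := low_mean_ge (8 / e); exists B; near=> n => K P reg aB.
have l1 : 8 / e <= lam n K P by move: K P reg aB; near: n.
have mom1 : `|low_moment R n P K s m 1 - lam n K P ^+ 1 / 1`!%:R| <= f * lam n K P ^+ 1.
  by move: K P reg {aB l1}; near: n; exact: low_moment_asymp.
have mom2 : `|low_moment R n P K s m 2 - lam n K P ^+ 2 / 2`!%:R| <= f * lam n K P ^+ 2.
  by move: K P reg {aB l1 mom1}; near: n; exact: low_moment_asymp.
have [sK KP _ _] := reg.
rewrite (isg_probE R KP).
have := min_degree_second_moment R n s KP m; rewrite prednK //.
have := Pr_ge0 (@unif_ge0 R P K) (fun w : {ffun 'I_n -> {set 'I_P}} => min_degree_ge k (isg_adj s w)).
set p := Pr _ _; move: mom1 mom2 l1.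
set S1 := low_moment _ _ _ _ _ _ 1; set S2 := low_moment _ _ _ _ _ _ 2; set l := lam _ _ _.
rewrite !expr1 (_ : 1`! = 1)%N // divr1 !ler_norml ler_pdivrMr // => /andP[a1 a2] /andP[b1 b2] le8 p0 h.
have le0 : 0 <= l * e by apply: le_trans le8.
have l0 : 0 <= l by rewrite -(pmulr_lge0 _ e0).
have lf0 : 0 <= f * l by rewrite mulr_ge0 // ltW.
have S1lo : 3 / 4 * l <= S1 by have := ler_wpM2r l0 f1; lra.
have S1sq : 9 / 16 * l ^+ 2 <= S1 ^+ 2.
  have -> : 9 / 16 * l ^+ 2 = (3 / 4 * l) ^+ 2 by field.
  by apply: lerXn2r; rewrite ?nnegrE // ?(le_trans _ S1lo) // mulr_ge0 //; lra.
have S1sq' : l ^+ 2 - 2 * f * l ^+ 2 <= S1 ^+ 2.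
  have h1 : l - f * l <= S1 by lra.
  have h2 : 0 <= l - f * l by have := ler_wpM2r l0 f1; lra.
  have h3 : (l - f * l) ^+ 2 <= S1 ^+ 2 by apply: lerXn2r; rewrite ?nnegrE // (le_trans h2).
  have : 0 <= (f * l) ^+ 2 by rewrite sqr_ge0.
  move: h3; rewrite !expr2; lra.
have l2 : 8 * l <= e * l ^+ 2 by rewrite expr2 mulrA [e * l]mulrC ler_wpM2r.
have f2l : f * l ^+ 2 <= e / 16 * l ^+ 2 by rewrite ler_wpM2r ?sqr_ge0.
have fl : f * l <= 1 / 4 * l by rewrite ler_wpM2r.
have num : 2 * S2 + S1 - S1 ^+ 2 <= 9 / 16 * e * l ^+ 2.
  move: b1 b2; rewrite (_ : 2`!%:R = 2 :> R) //; lra.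
have l2_0 : 0 < l ^+ 2.
  rewrite exprn_gt0 // lt_neqAle l0 andbT eq_sym; apply/negP => /eqP l00.
  by move: le8; rewrite l00 mul0r; lra.
rewrite -(ler_pM2r l2_0).
have := ler_wpM2l p0 S1sq; lra.
Unshelve. all: by end_near.
Qed.

Lemma degree_succ n K P : (0 < K)%N ->
  A n K P = A n K.+1 P * (1 - K.+1%:R^-1) ^+ (2 * s).
Proof.
move=> K0; rewrite /scaled_degree /edge_rate.
have -> : 1 - K.+1%:R^-1 = K%:R / K.+1%:R :> R.
  have q0 : K.+1%:R != 0 :> R by rewrite pnatr_eq0.
  by apply: (mulIf q0); rewrite mulrBl mul1r mulVf // mulfVK // -natr1 addrK.
have -> : K%:R ^+ (2 * s) = K.+1%:R ^+ (2 * s) * (K%:R / K.+1%:R) ^+ (2 * s) :> R.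
  by rewrite -exprMn mulrCA mulfV ?mulr1 // pnatr_eq0.
by ring.
Qed.

(* One more item per vertex changes the degree by a factor 1 + O(1/K), where K >= const sqrt(ln n). *)
Lemma alpha_step : \forall n \near \oo, forall K P th, (s <= K)%N -> (K.+1 <= P)%N -> c * n%:R <= P%:R ->
  - ln n%:R / 40 <= th -> th <= ln n%:R / 20 -> alpha n K P <= th -> th < alpha n K.+1 P ->
  th - ln n%:R / 40 <= alpha n K P.
Proof.
pose b := Num.sqrt (9 / 10 * c).
have b0 : 0 < b by rewrite sqrtr_gt0 mulr_gt0 //; lra.
near=> n => K P th sK KP cP th1 th2 aK aK1.
have t1 : 1 <= t n by near: n; exact: sqln_large.
have tb : 40 * (2 * s)%:R * 2 ^+ (2 * s) * 2 / b <= t n by near: n; exact: sqln_large.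
have [ll0 ll1] : 0 <= ln (ln (n%:R : R)) /\ m%:R * ln (ln n%:R) <= (1 / 20) * t n ^+ 2.
  by near: n; apply: lnln_small; lra.
have [tE nE] := sqlnK t1.
have K0 : (0 < K)%N by apply: leq_trans sK.
have mll : 0 <= m%:R * ln (ln (n%:R : R)) by rewrite mulr_ge0.
have t2 : 1 <= t n ^+ 2 by rewrite exprn_ege1.
move: aK aK1 th1 th2; rewrite /alpha_of -tE in ll1 mll *.
move: ll1 mll; set ll := m%:R * _ => ll1 ll0' aK aK1 th1 th2.
have lowA : 9 / 10 * t n ^+ 2 <= A n K.+1 P by lra.
have KK : b * t n <= K.+1%:R by apply: K_ge lowA => //; apply: leqW.
pose y : R := K.+1%:R^-1.
have y0 : 0 <= y by rewrite invr_ge0.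
have y1 : y <= 1 / 2.
  by rewrite /y -[leRHS]invrK lef_pV2 ?posrE // div1r invrK (ler_nat _ 2).
have AK := degree_succ n P K0.
have A1 : 0 <= A n K.+1 P by lra.
have up : A n K.+1 P <= 2 ^+ (2 * s) * A n K P.
  rewrite AK mulrCA -exprMn ler_peMr //; apply: exprn_ege1; rewrite -/y; lra.
have lo : A n K.+1 P * (1 - (2 * s)%:R * y) <= A n K P.
  by rewrite AK ler_wpM2l // one_sub_pow_ge //; rewrite -/y; lra.
have AK2 : A n K P <= 2 * t n ^+ 2 by lra.
have small : (2 * s)%:R * y * A n K.+1 P <= t n ^+ 2 / 40.
  apply: (@le_trans _ _ ((2 * s)%:R * y * (2 ^+ (2 * s) * (2 * t n ^+ 2)))).
    rewrite ler_wpM2l ?mulr_ge0 //; apply: le_trans up _.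
    by rewrite ler_wpM2l ?exprn_ge0.
  have -> : (2 * s)%:R * y * (2 ^+ (2 * s) * (2 * t n ^+ 2)) =
     (40 * (2 * s)%:R * 2 ^+ (2 * s) * 2) * (t n ^+ 2 / 40) / K.+1%:R.
    by rewrite /y; move: (2 ^+ _) => q; field; rewrite addrC natr1 pnatr_eq0.
  rewrite ler_pdivrMr ?ltr0n //.
  apply: (@le_trans _ _ (t n ^+ 2 / 40 * (b * t n))); last first.
    by rewrite ler_wpM2l // divr_ge0 ?sqr_ge0.
  rewrite mulrC ler_wpM2l ?divr_ge0 ?sqr_ge0 //.
  by rewrite [leRHS]mulrC -ler_pdivrMr.
move: lo; rewrite mulrBr mulr1; lra.
Unshelve. all: by end_near.
Qed.

(** A discrete intermediate value property in [K] for the target [th]. The range of [th] leaves room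
    for an undershoot of (ln n)/40 within the regime. *)
Definition alpha_interpolates n := forall K0 K1 P th, (s <= K0)%N -> (K0 <= K1)%N -> (K1 <= P)%N ->
  c * n%:R <= P%:R -> - ln n%:R / 40 <= th -> th <= ln n%:R / 20 ->
  alpha n K0 P <= th -> th < alpha n K1 P ->
  exists K, [/\ (K0 <= K <= K1)%N, regime n K P, th - ln n%:R / 40 <= alpha n K P & alpha n K P <= th].

Lemma alpha_crossing : \forall n \near \oo, alpha_interpolates n.
Proof.
near=> n => K0 K1 P th sK0 K01 K1P cP th1 th2 a0 a1.
have t1 : 1 <= t n by near: n; exact: sqln_large.
have [tE nE] := sqlnK t1.
have [l /andP[l0 l1] /andP[al]] := first_crossing (p := fun K => alpha n K P <= th) K01 a0 (negbT (lt_geF a1)).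
rewrite -ltNge => al1.
have sl : (s <= l)%N by apply: leq_trans l0.
have lP : (l.+1 <= P)%N by apply: leq_trans K1P.
have st : th - ln n%:R / 40 <= alpha n l P.
  by move: l P th sl lP cP th1 th2 al al1 {K0 K1 sK0 K01 K1P a0 a1 l0 l1}; near: n; exact: alpha_step.
have L0 : 0 <= ln (n%:R : R) by rewrite -tE sqr_ge0.
exists l; split => //; first by rewrite l0 ltnW.
split => //; first exact: ltnW.
rewrite ler_norml; apply/andP; split; lra.
Unshelve. all: by end_near.
Qed.

(** Upper endpoint for the interpolation: for K = P the scaled degree is at least n. *)
Lemma alpha_full_ge0 : \forall n \near \oo, forall P, (s <= P)%N -> c * n%:R <= P%:R -> 0 <= alpha n P P.
Proof.
near=> n => P sP cP.
have t1 : 1 <= t n by near: n; exact: sqln_large.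
have t4 : 8 <= t n by near: n; exact: sqln_large.
have [ll0 ll1] : 0 <= ln (ln (n%:R : R)) /\ m%:R * ln (ln n%:R) <= 1 * t n ^+ 2.
  by near: n; apply: lnln_small.
have [tE nE] := sqlnK t1.
have nc : s`!%:R / c <= n%:R by near: n; exact: nbhs_infty_ger.
have P1 : 1 <= P%:R :> R by rewrite ler1n (leq_trans s1).
have P0 : 0 < P%:R :> R by apply: lt_le_trans P1.
have sf : 0 < s`!%:R :> R by rewrite ltr0n fact_gt0.
have An : n%:R <= A n P P.
  rewrite /scaled_degree ler_peMr // edge_rateE // ler_pdivlMr // mul1r.
  rewrite expr2 mulfK ?gt_eqF //; apply: (@le_trans _ _ P%:R).
    by apply: le_trans cP; rewrite mulrC -ler_pdivrMr.
  by rewrite -[leLHS]expr1; apply: ler_weXn2l.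
have n2 := n_ge_t2 t1.
have n4 := sqln_pow4_le t1.
have : 2 * t n ^+ 2 <= t n ^+ 4 / 4.
  have -> : t n ^+ 4 / 4 = t n ^+ 2 / 4 * t n ^+ 2 by field.
  rewrite ler_wpM2r ?sqr_ge0 //.
  have : 8 ^+ 2 <= t n ^+ 2 by apply: lerXn2r; rewrite ?nnegrE // (le_trans ler01).
  lra.
rewrite /alpha_of -tE in ll1 *; lra.
Unshelve. all: by end_near.
Qed.

(** Lower endpoint for the interpolation: for K = s the scaled degree is bounded. *)
Lemma alpha_min_le0 : \forall n \near \oo, forall P, (s <= P)%N -> c * n%:R <= P%:R -> alpha n s P <= 0.
Proof.
near=> n => P sP cP.
have t1 : 1 <= t n by near: n; exact: sqln_large.
have [ll0 ll1] : 0 <= ln (ln (n%:R : R)) /\ m%:R * ln (ln n%:R) <= 1 * t n ^+ 2.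
  by near: n; apply: lnln_small.
have ts : s%:R ^+ (2 * s) / c <= t n by near: n; exact: sqln_large.
have [tE nE] := sqlnK t1.
have P1 : 1 <= P%:R :> R by rewrite ler1n (leq_trans s1).
have P0 : 0 < P%:R :> R by apply: lt_le_trans P1.
have n0 : 0 < n%:R :> R by rewrite nE expR_gt0.
have As : A n s P <= s%:R ^+ (2 * s) / c.
  rewrite /scaled_degree /edge_rate ler_pdivlMr //.
  have sf : 1 <= s`!%:R :> R by rewrite ler1n fact_gt0.
  have PP : c * n%:R <= P%:R ^+ s * s`!%:R.
    apply: le_trans cP _; rewrite -[leLHS]mulr1 ler_pM //.
    by rewrite -[leLHS]expr1; apply: ler_weXn2l.
  have -> : n%:R * (s%:R ^+ (2 * s) / P%:R ^+ s / s`!%:R) * c = s%:R ^+ (2 * s) * (c * n%:R) / (P%:R ^+ s * s`!%:R).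
    by rewrite invfM; ring.
  rewrite ler_pdivrMr ?mulr_gt0 ?exprn_gt0 ?(lt_le_trans ltr01 sf) //.
  by rewrite ler_wpM2l // exprn_ge0.
have t2 : t n <= t n ^+ 2 by rewrite -[leLHS]expr1; apply: ler_weXn2l.
have : 0 <= m%:R * ln (ln (n%:R : R)) by rewrite mulr_ge0.
rewrite /alpha_of -tE; lra.
Unshelve. all: by end_near.
Qed.

Lemma prob_mono n K K' P : (K <= K')%N -> (K' <= P)%N ->
  [/\ pv n K P <= pv n K' P, pe n K P <= pe n K' P & pd n K P <= pd n K' P].
Proof.
move=> KK KP; split; apply: isg_prob_mono => // w w' h /isg_adj_mono sub.
- exact: vertex_connected_mono (sub s) h.
- exact: edge_connected_mono (sub s) h.
- exact: min_degree_mono (sub s) h.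
Qed.

(** * Sequences with alpha tending to infinity or minus infinity *)

Section Sequences.
Variables K P : nat -> nat.
Hypotheses (sKP : forall n, (s <= K n)%N /\ (K n <= P n)%N)
  (cP : \forall n \near \oo, c * n%:R <= (P n)%:R).

(** If alpha leaves the regime, [K n] is lowered to some [K'] with alpha between (ln n)/40 and (ln
    n)/20, and monotonicity carries the bound back to [K n]. *)
Lemma lim_prob_high (e : R) : 0 < e -> (fun n => alpha n (K n) (P n)) @ \oo --> +oo ->
  \forall n \near \oo, [/\ 1 - e <= pv n (K n) (P n), 1 - e <= pe n (K n) (P n) & 1 - e <= pd n (K n) (P n)].
Proof.
move=> e0 /cvgryPge ainf; have [B hB] := prob_high e0.
near=> n.
have [sK KP] := sKP n.
have cPn : c * n%:R <= (P n)%:R by near: n.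
have aB : B <= alpha n (K n) (P n) by near: n; exact: ainf.
have a0 : 0 <= alpha n (K n) (P n) by near: n; exact: ainf.
have t1 : 1 <= t n by near: n; exact: sqln_large.
have tB : 40 * B <= t n by near: n; exact: sqln_large.
have hBn : forall K P, regime n K P ->
  B <= alpha n K P -> [/\ 1 - e <= pv n K P, 1 - e <= pe n K P & 1 - e <= pd n K P] by near: n.
have [tE _] := sqlnK t1.
have t2 : t n <= t n ^+ 2 by rewrite -[leLHS]expr1; apply: ler_weXn2l.
case: (lerP (alpha n (K n) (P n)) (ln n%:R / 20)) => ha.
  by apply: hBn => //; split => //; rewrite ger0_norm.
have mina : alpha n s (P n) <= 0.
  have h : forall P, (s <= P)%N -> c * n%:R <= P%:R -> alpha n s P <= 0 by near: n; exact: alpha_min_le0.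
  by apply: h => //; apply: leq_trans KP.
have [K' [/andP[sK' K'K] reg lo hi]] : exists K', [/\ (s <= K' <= K n)%N, regime n K' (P n),
    ln n%:R / 20 - ln n%:R / 40 <= alpha n K' (P n) & alpha n K' (P n) <= ln n%:R / 20].
  have cross : alpha_interpolates n by near: n; exact: alpha_crossing.
  by apply: cross => //; rewrite -tE; lra.
have [v w d] : [/\ 1 - e <= pv n K' (P n), 1 - e <= pe n K' (P n) & 1 - e <= pd n K' (P n)].
  by apply: hBn => //; apply: le_trans lo; rewrite -tE; lra.
have [v' w' d'] := prob_mono n K'K KP.
by split; [apply: le_trans v' | apply: le_trans w' | apply: le_trans d'].
Unshelve. all: by end_near.
Qed.

(** Dually, [K n] is raised until alpha lies between - (ln n)/20 and - (ln n)/40. *)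
Lemma lim_prob_low (e : R) : 0 < e -> (fun n => alpha n (K n) (P n)) @ \oo --> -oo ->
  \forall n \near \oo, pd n (K n) (P n) <= e.
Proof.
move=> e0 /cvgrNyPle ainf; have [B hB] := prob_low e0.
near=> n.
have [sK KP] := sKP n.
have cPn : c * n%:R <= (P n)%:R by near: n.
have aB : alpha n (K n) (P n) <= - B by near: n; exact: ainf.
have a0 : alpha n (K n) (P n) <= 0 by near: n; exact: ainf.
have t1 : 1 <= t n by near: n; exact: sqln_large.
have tB : 40 * B <= t n by near: n; exact: sqln_large.
have hBn : forall K P, regime n K P -> alpha n K P <= - B -> pd n K P <= e by near: n.
have [tE _] := sqlnK t1.
have t2 : t n <= t n ^+ 2 by rewrite -[leLHS]expr1; apply: ler_weXn2l.
case: (lerP (- (ln n%:R / 20)) (alpha n (K n) (P n))) => ha.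
  by apply: hBn => //; split => //; rewrite ler0_norm // lerNl.
have maxa : 0 <= alpha n (P n) (P n).
  have h : forall P, (s <= P)%N -> c * n%:R <= P%:R -> 0 <= alpha n P P by near: n; exact: alpha_full_ge0.
  by apply: h => //; apply: leq_trans KP.
have [K' [/andP[sK' K'K] reg lo hi]] : exists K', [/\ (K n <= K' <= P n)%N, regime n K' (P n),
    - ln n%:R / 40 - ln n%:R / 40 <= alpha n K' (P n) & alpha n K' (P n) <= - ln n%:R / 40].
  have cross : alpha_interpolates n by near: n; exact: alpha_crossing.
  by apply: cross => //; move: ha; rewrite -tE; lra.
have [_ _ d'] := prob_mono n sK' K'K.
apply: le_trans d' _; apply: hBn => //; apply: le_trans hi _; rewrite -tE; lra.
Unshelve. all: by end_near.
Qed.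

(** * Convergent alpha *)

Section Finite.
Variable a : R.
Hypothesis cvga : (fun n => alpha n (K n) (P n)) @ \oo --> a.
Local Notation l := (expR (- a) / m`!%:R).

Lemma near_regime : \forall n \near \oo, regime n (K n) (P n).
Proof.
near=> n; have [sK KP] := sKP n; split => //; first by near: n.
have t1 : 1 <= t n by near: n; exact: sqln_large.
have ta : 20 * (`|a| + 1) <= t n by near: n; exact: sqln_large.
have [<- _] := sqlnK t1.
have t2 : t n <= t n ^+ 2 by rewrite -[leLHS]expr1; apply: ler_weXn2l.
have d1 : `|a - alpha n (K n) (P n)| <= 1 by near: n; move/cvgrPdist_le : cvga; apply.
have := ler_normB a (a - alpha n (K n) (P n)); rewrite subKr => h; lra.
Unshelve. all: by end_near.
Qed.

Lemma cvg_low_mean : (fun n => lam n (K n) (P n)) @ \oo --> l.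
Proof.
have cvgA : (fun n => A n (K n) (P n) / t n ^+ 2) @ \oo --> (1 : R).
  apply/cvgrPdist_le => e e0; near=> n.
  have t1 : 1 <= t n by near: n; exact: sqln_large.
  have e20 : 0 < e / 2 by rewrite divr_gt0.
  have te : (`|a| + 1) / (e / 2) <= t n by near: n; exact: sqln_large.
  have [tE _] := sqlnK t1.
  have t2 : t n <= t n ^+ 2 by rewrite -[leLHS]expr1; apply: ler_weXn2l.
  have t20 : 0 < t n ^+ 2 by lra.
  have [ll0 ll1] : 0 <= ln (ln (n%:R : R)) /\ m%:R * ln (ln n%:R) <= (e / 2) * t n ^+ 2.
    by near: n; apply: lnln_small; rewrite divr_gt0.
  have d1 : `|a - alpha n (K n) (P n)| <= 1 by near: n; move/cvgrPdist_le : cvga; apply.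
  have h1 := ler_normB a (a - alpha n (K n) (P n)); rewrite subKr in h1.
  have h2 : `|alpha n (K n) (P n)| <= e / 2 * t n ^+ 2.
    apply: (@le_trans _ _ (`|a| + 1)); first by lra.
    by move: te; rewrite ler_pdivrMr // => te; have := ler_wpM2l (ltW e20) t2; lra.
  have -> : 1 - A n (K n) (P n) / t n ^+ 2 = - ((alpha n (K n) (P n) + m%:R * ln (ln n%:R)) / t n ^+ 2).
    by rewrite /alpha_of -tE; field; rewrite gt_eqF // (lt_le_trans ltr01).
  rewrite normrN normrM normfV [`|t n ^+ 2|]gtr0_norm // ler_pdivrMr //.
  apply: le_trans (ler_normD _ _) _; rewrite [`|m%:R * _|]ger0_norm ?mulr_ge0 //; lra.
have cvgE : (fun n => expR (- alpha n (K n) (P n))) @ \oo --> expR (- a).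
  by apply: continuous_cvg; [exact: continuous_expR | exact: cvgN].
have cvgAm : (fun n => (A n (K n) (P n) / t n ^+ 2) ^+ m) @ \oo --> (1 : R).
  have -> : (1 : R) = 1 ^+ m by rewrite expr1n.
  exact: (cvg_comp _ _ cvgA (@exprn_continuous _ m _)).
have h : (fun n => (A n (K n) (P n) / t n ^+ 2) ^+ m * expR (- alpha n (K n) (P n)) / m`!%:R) @ \oo --> l.
  rewrite -[expR (- a)]mul1r; apply: cvgM; last exact: cvg_cst.
  exact: cvgM.
apply/cvgrPdist_le => e e0; near=> n.
rewrite low_mean_eq; last by near: n; exact: sqln_large.
by near: n; move/cvgrPdist_le : h; exact.
Unshelve. all: by end_near.
Qed.

Lemma cvg_low_moment j : (fun n => low_moment R n (P n) (K n) s m j) @ \oo --> l ^+ j / j`!%:R.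
Proof.
have cvgl : (fun n => lam n (K n) (P n) ^+ j) @ \oo --> l ^+ j.
  exact: (cvg_comp _ _ cvg_low_mean (@exprn_continuous _ j _)).
have h : (fun n => lam n (K n) (P n) ^+ j / j`!%:R) @ \oo --> l ^+ j / j`!%:R.
  by apply: cvgM => //; exact: cvg_cst.
apply/cvgrPdist_le => e e0; near=> n.
have e20 : 0 < e / 2 by rewrite divr_gt0.
have l0 : 0 <= l by rewrite divr_ge0 ?expR_ge0.
pose f := e / 2 / (l ^+ j + 1).
have L0 : 0 < l ^+ j + 1 by rewrite ltr_wpDl // exprn_ge0.
have h1 : `|l ^+ j / j`!%:R - lam n (K n) (P n) ^+ j / j`!%:R| <= e / 2.
  by near: n; move/cvgrPdist_le : h; apply; rewrite divr_gt0.
have h2 : `|l ^+ j - lam n (K n) (P n) ^+ j| <= 1.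
  by near: n; move/cvgrPdist_le : cvgl; apply.
have reg : regime n (K n) (P n) by near: n; exact: near_regime.
have h3 : `|low_moment R n (P n) (K n) s m j - lam n (K n) (P n) ^+ j / j`!%:R| <= f * lam n (K n) (P n) ^+ j.
  have mom : forall K P, regime n K P -> `|low_moment R n P K s m j - lam n K P ^+ j / j`!%:R| <= f * lam n K P ^+ j.
    by near: n; apply: low_moment_asymp => //; rewrite !divr_gt0 // ltr_wpDl // exprn_ge0 // divr_ge0 ?expR_ge0.
  exact: mom.
have h4 : f * lam n (K n) (P n) ^+ j <= e / 2.
  rewrite /f mulrAC ler_pdivrMr //; apply: ler_wpM2l; first exact: ltW.
  by move: h2; rewrite ler_norml => /andP[]; lra.
have -> : l ^+ j / j`!%:R - low_moment R n (P n) (K n) s m j =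
  (l ^+ j / j`!%:R - lam n (K n) (P n) ^+ j / j`!%:R) - (low_moment R n (P n) (K n) s m j - lam n (K n) (P n) ^+ j / j`!%:R).
  by rewrite opprB addrA subrK.
apply: le_trans (ler_normB _ _) _; lra.
Unshelve. all: by end_near.
Qed.

(** For a fixed number N of Bonferroni terms the sums converge to the partial sums of the
    exponential series at - l, with error at most l^N / N! in the limit. Hence N is chosen before
    [n]. *)
Lemma cvg_min_degree : (fun n => pd n (K n) (P n)) @ \oo --> expR (- l).
Proof.
have cvgS N : (fun n => \sum_(i < N) (-1) ^+ i * low_moment R n (P n) (K n) s m i) @ \oo -->
    series (exp_coeff (- l)) N.
  rewrite /series /=; elim: N => [|N IH].
    by rewrite big_nil; under eq_fun do rewrite big_ord0; exact: cvg_cst.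
  rewrite big_nat_recr //=; under eq_fun do rewrite big_ord_recr /=.
  have -> (z : R) : exp_coeff (- z) N = (-1) ^+ N * (z ^+ N / N`!%:R) by rewrite /exp_coeff /= (exprNn z) mulrA.
  apply: cvgD; first exact: IH.
  by apply: cvgM; [exact: cvg_cst | exact: cvg_low_moment].
have ser : series (exp_coeff (- l)) @ \oo --> expR (- l) by exact: is_cvg_series_exp_coeff.
have ser0 : exp_coeff l @ \oo --> (0 : R) by apply: cvg_series_cvg_0; exact: is_cvg_series_exp_coeff.
apply/cvgrPdist_le => e e0.
have e40 : 0 < e / 4 by rewrite divr_gt0.
have [N hN1 hN2] : exists2 N, `|expR (- l) - series (exp_coeff (- l)) N| <= e / 4 & `|0 - exp_coeff l N| <= e / 4.
  have h1 : \forall N \near \oo, `|expR (- l) - series (exp_coeff (- l)) N| <= e / 4.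
    by move/cvgrPdist_le : ser; apply.
  have h2 : \forall N \near \oo, `|0 - exp_coeff l N| <= e / 4 by move/cvgrPdist_le : ser0; apply.
  have [N [h3 h4]] := filter_ex (filterI h1 h2); by exists N.
near=> n.
have [sK KP] := sKP n.
have h1 : `|series (exp_coeff (- l)) N - \sum_(i < N) (-1) ^+ i * low_moment R n (P n) (K n) s m i| <= e / 4.
  by near: n; move/cvgrPdist_le : (cvgS N); apply.
have h2 : `|l ^+ N / N`!%:R - low_moment R n (P n) (K n) s m N| <= e / 4.
  by near: n; move/cvgrPdist_le : (@cvg_low_moment N); apply.
have h3 := min_degree_bonferroni R n (P n) (K n) s m N.
rewrite (isg_probE R KP); rewrite prednK // in h3.
move: hN2 h2 h3 h1 hN1; rewrite /exp_coeff /= sub0r normrN !ler_norml.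
by do !case/andP => ? ?; apply/andP; split; lra.
Unshelve. all: by end_near.
Qed.

Lemma cvg_connected : (fun n => pv n (K n) (P n)) @ \oo --> expR (- l) /\
  (fun n => pe n (K n) (P n)) @ \oo --> expR (- l).
Proof.
have cl (f : nat -> R) : (forall e : R, 0 < e -> \forall n \near \oo,
    pd n (K n) (P n) - e <= f n <= pd n (K n) (P n)) -> f @ \oo --> expR (- l).
  move=> fpd; apply/cvgrPdist_le => e e0; have e20 : 0 < e / 2 by rewrite divr_gt0.
  near=> n.
  have /andP[h1 h2] : pd n (K n) (P n) - e / 2 <= f n <= pd n (K n) (P n) by near: n; exact: fpd.
  have : `|expR (- l) - pd n (K n) (P n)| <= e / 2 by near: n; move/cvgrPdist_le : cvg_min_degree; apply.
  by rewrite !ler_norml => /andP[h3 h4]; apply/andP; split; lra.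
have cls : forall e : R, 0 < e -> \forall n \near \oo, [/\ pd n (K n) (P n) - e <= pv n (K n) (P n) <= pd n (K n) (P n) &
    pd n (K n) (P n) - e <= pe n (K n) (P n) <= pd n (K n) (P n)].
  move=> e e0; near=> n; have [sK KP] := sKP n.
  have kn : (k < n)%N by near: n; exact: nbhs_infty_gt.
  have reg : regime n (K n) (P n) by near: n; exact: near_regime.
  have [/andP[_ v] /andP[_ w]] := prob_bounds KP kn.
  have [v' w'] : pd n (K n) (P n) - e <= pv n (K n) (P n) /\ pd n (K n) (P n) - e <= pe n (K n) (P n).
    have h : forall K P, regime n K P -> pd n K P - e <= pv n K P /\ pd n K P - e <= pe n K P.
      by near: n; exact: connected_close.
    exact: h.
  by rewrite v v' w w'.
split; apply: cl => e e0; apply: filterS (cls e e0) => n [] //.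
Unshelve. all: by end_near.
Qed.

End Finite.
End Sequences.
End Limits.

Theorem theorem1 (R : realType) (s k : nat) (K P : nat -> nat) :
  (1 <= s)%N -> (1 <= k)%N ->
  (forall n, (s <= K n)%N /\ (K n <= P n)%N) ->
  (exists2 c : R, 0 < c & \forall n \near \oo, c * n%:R <= (P n)%:R) ->
  let pv := fun n => isg_prob R n (P n) (K n)
              (fun w => k_vertex_connected k (isg_adj s w)) in
  let pe := fun n => isg_prob R n (P n) (K n)
              (fun w => k_edge_connected k (isg_adj s w)) in
  let pd := fun n => isg_prob R n (P n) (K n)
              (fun w => min_degree_ge k (isg_adj s w)) in
  let alpha := isg_alpha R s k K P in
  (forall a : R, alpha @ \oo --> a ->
     let L := expR (- expR (- a) / (k.-1)`!%:R) in
     [/\ pv @ \oo --> L, pe @ \oo --> L & pd @ \oo --> L]) /\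
  (alpha @ \oo --> -oo ->
     [/\ pv @ \oo --> (0:R), pe @ \oo --> (0:R) & pd @ \oo --> (0:R)]) /\
  (alpha @ \oo --> +oo ->
     [/\ pv @ \oo --> (1:R), pe @ \oo --> (1:R) & pd @ \oo --> (1:R)]).
Proof.
move=> s1 k1 sKP [c c0 cP] pv pe pd alpha.
have bounds : \forall n \near \oo, [/\ 0 <= pv n <= pd n, 0 <= pe n <= pd n & pd n <= 1].
  near=> n; have [sK KP] := sKP n.
  have kn : (k < n)%N by near: n; exact: nbhs_infty_gt.
  have [v w] := prob_bounds R s k1 KP kn; split => //.
  by rewrite /pd (isg_probE R KP); apply: Pr_le1; [exact: unif_ge0 | exact: unif_sum1].
split.
  move=> a ha L; have -> : L = expR (- (expR (- a) / (k.-1)`!%:R)) by rewrite /L mulNr.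
  have [v w] := cvg_connected s1 k1 c0 sKP cP ha.
  by split=> //; exact: (cvg_min_degree s1 k1 c0 sKP cP ha).
split=> ha.
  have sq (f : nat -> R) : (\forall n \near \oo, 0 <= f n <= pd n) -> f @ \oo --> (0 : R).
    move=> fpd; apply/cvgrPdist_le => e e0; near=> n.
    have /andP[h1 h2] : 0 <= f n <= pd n by near: n.
    have h3 : pd n <= e by near: n; exact: (lim_prob_low s1 k1 c0 sKP cP e0 ha).
    by rewrite sub0r normrN ger0_norm // (le_trans h2).
  split; apply: sq; near=> n.
  - by have [] : [/\ 0 <= pv n <= pd n, 0 <= pe n <= pd n & pd n <= 1] by near: n.
  - by have [] : [/\ 0 <= pv n <= pd n, 0 <= pe n <= pd n & pd n <= 1] by near: n.
  - have [/andP[h1 h2] _ _] : [/\ 0 <= pv n <= pd n, 0 <= pe n <= pd n & pd n <= 1] by near: n.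
    by rewrite lexx (le_trans h1 h2).
have sq (f : nat -> R) : (forall e : R, 0 < e -> \forall n \near \oo, 1 - e <= f n) ->
    (\forall n \near \oo, f n <= 1) -> f @ \oo --> (1 : R).
  move=> fe f1; apply/cvgrPdist_le => e e0; near=> n.
  have h1 : 1 - e <= f n by near: n; exact: fe.
  have h2 : f n <= 1 by near: n.
  by rewrite ger0_norm ?subr_ge0 // lerBlDr addrC -lerBlDr.
have hi := fun (e : R) (e0 : 0 < e) => lim_prob_high s1 k1 c0 sKP cP e0 ha.
split; apply: sq.
- by move=> e e0; apply: filterS (hi e e0) => n [].
- by apply: filterS bounds => n [/andP[_ v] _ d]; apply: le_trans v d.
- by move=> e e0; apply: filterS (hi e e0) => n [].
- by apply: filterS bounds => n [_ /andP[_ v] d]; apply: le_trans v d.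
- by move=> e e0; apply: filterS (hi e e0) => n [].
- by apply: filterS bounds => n [].
Unshelve. all: by end_near.
Qed.
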